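(* Let $\mathcal{G}$ be a second-countable locally compact Hausdorff étale groupoid that is amenable. Then $C^*(\mathcal{G})$ is simple if and only if $\mathcal{G}$ is effective and minimal.
   Context: A groupoid $\mathcal{G}$ (a small category in which every morphism is invertible) is identified with its set of morphisms; $\mathcal{G}^{(0)} = \{\gamma^{-1}\gamma \mid \gamma \in \mathcal{G}\}$ is its unit space, $r(\gamma) = \gamma\gamma^{-1}$, $s(\gamma) = \gamma^{-1}\gamma$, and $\alpha\beta$ is defined iff $s(\alpha) = r(\beta)$. For a unit $x$, $\mathcal{G}^x = r^{-1}(x)$. A topological groupoid is a groupoid with a locally compact topology such that $\mathcal{G}^{(0)}$ is Hausdorff and $r$, $s$, inversion and multiplication are continuous. It is étale if $r : \mathcal{G} \to \mathcal{G}$ is a local homeomorphism (each point has an open neighbourhood $U$ with $r(U)$ open in $\mathcal{G}$ and $r|_U : U \to r(U)$ a homeomorphism). $C_c(\mathcal{G})$ is a $^*$-algebra with $(f*g)(\gamma) = \sum_{\alpha\beta=\gamma} f(\alpha)g(\beta)$ and $f^*(\gamma) = \overline{f(\gamma^{-1})}$. $C^*(\mathcal{G})$ is its completion in the norm $\|f\| = \sup\{\|\pi(f)\| : \pi \text{ a } {}^*\text{-representation of } C_c(\mathcal{G}) \text{ on a Hilbert space}\}$. A $C^*$-algebra is simple if its only closed two-sided ideals are $\{0\}$ and itself. Amenability: a continuous system of probability measures for $\mathcal{G}$ is a system $\lambda = \{\lambda^x\mid x\in\mathcal{G}^{(0)}\}$ of Radon probability measures on $\mathcal{G}$ with $\lambda^x$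 supported in $\mathcal{G}^x$ (so, $\mathcal{G}^x$ being discrete, $\lambda^x$ is a function $\mathcal{G}^x\to[0,\infty)$ with total sum $1$), such that $x\mapsto\int_{\mathcal{G}} f\,d\lambda^x$ is continuous for all $f\in C_c(\mathcal{G})$. $\mathcal{G}$ is (topologically) amenable if there is a net $(\lambda_i)$ of continuous systems of probability measures for $\mathcal{G}$ such that the functions $M_i(\gamma) = \|\lambda_i^{r(\gamma)}(\gamma\,\cdot) - \lambda_i^{s(\gamma)}(\cdot)\|_1 = \sum_{\eta\in\mathcal{G}^{s(\gamma)}}|\lambda_i^{r(\gamma)}(\gamma\eta) - \lambda_i^{s(\gamma)}(\eta)|$ converge to $0$ uniformly on every compact subset of $\mathcal{G}$. $\mathcal{G}$ is effective if the interior in $\mathcal{G}$ of $\{\gamma\in\mathcal{G}\mid r(\gamma)=s(\gamma)\}$ equals $\mathcal{G}^{(0)}$. $\mathcal{G}$ is minimal if for every $x\in\mathcal{G}^{(0)}$ the orbit $[x] = \{r(\gamma)\mid s(\gamma)=x\}$ is dense in $\mathcal{G}^{(0)}$. *)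

(* Defs.v *)
From HB Require Import structures.
From mathcomp Require Import all_boot all_order all_algebra.
From mathcomp Require Import complex.
From mathcomp Require Import all_classical all_reals all_analysis.

Set Implicit Arguments.
Unset Strict Implicit.
Unset Printing Implicit Defensive.
Import Order.TTheory GRing.Theory Num.Theory.
Import numFieldNormedType.Exports.
Local Open Scope classical_set_scope.
Local Open Scope ring_scope.

(* R[i] carries no topology in the libraries: give it that of its modulus. *)
HB.instance Definition _ (R : realType) := NormedModule.copy R[i] R[i]^o.

(* The carrier is the set of all morphisms.  [gmul] is a total function whose
   values on non-composable pairs are irrelevant: every axiom is guarded by
   s(a) = r(b), with r(g) = g g^-1 and s(g) = g^-1 g. *)
HB.mixin Record isGroupoid G := {
  gmul : G -> G -> G;
  ginv : G -> G;
  ginvK : involutive ginv;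
  grange_mul : forall a b, gmul (ginv a) a = gmul b (ginv b) ->
    gmul (gmul a b) (ginv (gmul a b)) = gmul a (ginv a);
  gsource_mul : forall a b, gmul (ginv a) a = gmul b (ginv b) ->
    gmul (ginv (gmul a b)) (gmul a b) = gmul (ginv b) b;
  gmulA : forall a b c, gmul (ginv a) a = gmul b (ginv b) ->
    gmul (ginv b) b = gmul c (ginv c) ->
    gmul a (gmul b c) = gmul (gmul a b) c;
  gmul_rangel : forall a, gmul (gmul a (ginv a)) a = a;
  gmul_sourcer : forall a, gmul a (gmul (ginv a) a) = a
}.

#[short(type="groupoidType")]
HB.structure Definition Groupoid := {G of isGroupoid G}.

Definition grange (G : groupoidType) (a : G) : G := gmul a (ginv a).
Definition gsource (G : groupoidType) (a : G) : G := gmul (ginv a) a.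

Definition gcomposable (G : groupoidType) : set (G * G) :=
  [set p | gsource p.1 = grange p.2].

Definition gunits (G : groupoidType) : set G := range (@gsource G).

Definition grange_fiber (G : groupoidType) (x : G) : set G :=
  [set a | grange a = x].

Definition gorbit (G : groupoidType) (x : G) : set G :=
  [set grange a | a in [set a | gsource a = x]].

(* Local compactness and the Hausdorff property are not bundled here. *)
HB.mixin Record isTopologicalGroupoid G & Topological G & Groupoid G := {
  ginv_continuous : continuous (@ginv G);
  gmul_continuous :
    {within @gcomposable G, continuous (fun p : G * G => gmul p.1 p.2)};
  grange_continuous : continuous (@grange G);
  gsource_continuous : continuous (@gsource G)
}.

#[short(type="topologicalGroupoidType")]
HB.structure Definition TopologicalGroupoid :=
  {G of Topological G & Groupoid G & isTopologicalGroupoid G}.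

Definition local_homeomorphism (X Y : topologicalType) (f : X -> Y) : Prop :=
  forall x, exists U : set X,
    [/\ open U, U x, open (f @` U), {within U, continuous f} &
        exists g : Y -> X,
          {within f @` U, continuous g} /\ forall y, U y -> g (f y) = y].

Definition etale (G : topologicalGroupoidType) : Prop :=
  local_homeomorphism (@grange G).

Definition effective (G : topologicalGroupoidType) : Prop :=
  interior [set a : G | grange a = gsource a] = @gunits G.

(* [closure] is taken in G; its trace on the unit space is the closure there. *)
Definition minimal_groupoid (G : topologicalGroupoidType) : Prop :=
  forall x : G, gunits x -> @gunits G `<=` closure (gorbit x).

Definition Cc (R : realType) (X : topologicalType) : set (X -> R[i]) :=
  [set f | continuous f /\ compact (closure [set x | f x != 0])].

Section convolution_algebra.
Variables (R : realType) (G : topologicalGroupoidType).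
Implicit Types f g : G -> R[i].

(* On an etale Hausdorff groupoid only finitely many terms are nonzero when
   f and g are in C_c(G). *)
Definition convolution f g : G -> R[i] := fun c =>
  \sum_(p \in [set p : G * G | gcomposable p /\ gmul p.1 p.2 = c])
    f p.1 * g p.2.

Definition fun_star f : G -> R[i] := fun a => (f (ginv a))^*.

End convolution_algebra.

(* [lam x] is the weight function of the measure lambda^x on the discrete fibre
   r^-1(x); it is only constrained for units x.  The finitely supported sum is
   the integral of f: the compact support of f meets each fibre in a finite
   set. *)
Definition continuous_probability_system (R : realType)
    (G : topologicalGroupoidType) (lam : G -> G -> R) : Prop :=
  (forall x, gunits x ->
    [/\ forall a, 0 <= lam x a,
        forall a, lam x a != 0 -> grange_fiber x a &
        (\esum_(a in grange_fiber x) (lam x a)%:E = 1)%E]) /\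
  (forall f : G -> R[i], Cc f ->
    {within @gunits G, continuous
      (fun x => \sum_(a \in grange_fiber x) f a * ((lam x a)%:C)%C)}).

Definition invariance_defect (R : realType) (G : topologicalGroupoidType)
    (lam : G -> G -> R) (c : G) : \bar R :=
  (\esum_(a in grange_fiber (gsource c))
     `|lam (grange c) (gmul c a) - lam (gsource c) a|%:E)%E.

Definition directed (I : Type) (le : I -> I -> Prop) : Prop :=
  [/\ inhabited I, forall i, le i i,
      forall i j k, le i j -> le j k -> le i k &
      forall i j, exists k, le i k /\ le j k].

Definition amenable (R : realType) (G : topologicalGroupoidType) : Prop :=
  exists (I : Type) (le : I -> I -> Prop) (lam : I -> G -> G -> R),
    [/\ directed le,
        forall i, continuous_probability_system (lam i) &
        forall K : set G, compact K -> forall e : R, 0 < e ->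
          exists i0, forall i, le i0 i -> forall c, K c ->
            (invariance_defect (lam i) c < e%:E)%E].

HB.mixin Record CompleteNormedModule_isHilbert (R : realType) H
    & CompleteNormedModule R[i] H := {
  hdot : {dot H for (@Num.conj R[i])};
  hdot_norm : forall x : H, hdot x x = `|x| ^+ 2
}.

#[short(type="hilbertType")]
HB.structure Definition Hilbert (R : realType) :=
  {H of CompleteNormedModule R[i] H & CompleteNormedModule_isHilbert R H}.

(* A C*-algebra need not be unital, so MathComp's algebra structures do not
   apply. *)
HB.mixin Record CompleteNormedModule_isCstarAlgebra (R : realType) A
    & CompleteNormedModule R[i] A := {
  cmul : {bilinear A -> A -> A};
  cstar : A -> A;
  cmulA : forall a b c : A, cmul a (cmul b c) = cmul (cmul a b) c;
  cstarK : involutive cstar;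
  cstarD : forall a b : A, cstar (a + b) = cstar a + cstar b;
  cstarZ : forall (k : R[i]) (a : A), cstar (k *: a) = k^* *: cstar a;
  cstarM : forall a b : A, cstar (cmul a b) = cmul (cstar b) (cstar a);
  cnormM : forall a b : A, `|cmul a b| <= `|a| * `|b|;
  cnorm_star : forall a : A, `|cmul (cstar a) a| = `|a| ^+ 2
}.

#[short(type="cstarAlgType")]
HB.structure Definition CstarAlgebra (R : realType) :=
  {A of CompleteNormedModule R[i] A & CompleteNormedModule_isCstarAlgebra R A}.

Definition closed_ideal (R : realType) (A : cstarAlgType R) (I : set A) : Prop :=
  [/\ closed I, I 0,
      forall (k : R[i]) a b, I a -> I b -> I (k *: a + b),
      forall a b, I b -> I (cmul a b) &
      forall a b, I a -> I (cmul a b)].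

Definition simple_cstar (R : realType) (A : cstarAlgType R) : Prop :=
  forall I : set A, closed_ideal I -> I = [set 0] \/ I = setT.

(* The norm of the normed module T lives in R[i], where it is real. *)
Definition opnorm (R : realType) (H : completeNormedModType R[i])
    (T : H -> H) : \bar R :=
  ereal_sup [set (complex.Re `|T x|)%:E | x in [set x : H | `|x| <= 1]].

(* A *-representation of C_c(G) by bounded operators; the values of [pi] outside
   C_c(G) are irrelevant. *)
Definition star_representation (R : realType) (G : topologicalGroupoidType)
    (H : hilbertType R) (pi : (G -> R[i]) -> {linear H -> H}) : Prop :=
  [/\ forall f, Cc f -> continuous (pi f),
      forall (k : R[i]) f g, Cc f -> Cc g ->
        forall x, pi (k *: f + g) x = k *: pi f x + pi g x,
      forall f g, Cc f -> Cc g ->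
        forall x, pi (convolution f g) x = pi f (pi g x) &
      forall f, Cc f ->
        forall x y, hdot (pi f x) y = hdot x (pi (fun_star f) y)].

Definition full_norm (R : realType) (G : topologicalGroupoidType)
    (f : G -> R[i]) : \bar R :=
  ereal_sup [set e | exists (H : hilbertType R)
    (pi : (G -> R[i]) -> {linear H -> H}),
    star_representation pi /\ e = opnorm (pi f)].

(* [A], together with [iota : C_c(G) -> A], is the completion C*(G) of the
   *-algebra C_c(G) in [full_norm]: A is a complete normed *-algebra and iota is
   an isometric *-homomorphism with dense range.  This determines (A, iota) up
   to a unique isometric *-isomorphism.  The values of [iota] outside C_c(G) are
   irrelevant. *)
Definition is_full_cstar_algebra (R : realType) (G : topologicalGroupoidType)
    (A : cstarAlgType R) (iota : (G -> R[i]) -> A) : Prop :=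
  [/\ forall (k : R[i]) f g, Cc f -> Cc g ->
        iota (k *: f + g) = k *: iota f + iota g,
      forall f g, Cc f -> Cc g ->
        iota (convolution f g) = cmul (iota f) (iota g),
      forall f, Cc f -> iota (fun_star f) = cstar (iota f),
      forall f, Cc f -> (complex.Re `|iota f|)%:E = full_norm f &
      dense (iota @` @Cc R G)].

(* Main.v *)
Require Import Defs.
From HB Require Import structures.
From mathcomp Require Import all_boot all_order all_algebra.
From mathcomp Require Import finmap complex.
From mathcomp Require Import all_classical all_reals all_analysis.
From mathcomp Require Import ring lra.
From mathcomp Require summability.
Set Implicit Arguments. Unset Strict Implicit. Unset Printing Implicit Defensive.
Import Order.TTheory GRing.Theory Num.Theory.
Import numFieldNormedType.Exports.
Local Open Scope classical_set_scope.
Local Open Scope ring_scope.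

(** For an étale groupoid the compactly supported functions on one bisection (an
    open set on which the range and source maps are injective) span [C_c(G)], by
    partitions of unity. For [f] on a bisection, [f^* * f] is a nonnegative
    function on the units, bounded by the square of the supremum norm of [f], and
    a function on the units is bounded by its supremum norm in every
    representation. So every representation is contractive on each bisection
    ([rep_bisection]), and bounded on functions supported in a fixed compact set
    by a multiple of the supremum norm ([rep_compact_bound]).

    Simple implies effective and minimal. [G] permutes its units, which gives a
    representation on the square-summable families indexed by the units
    ([action_representation], [orbit_representation]). The kernel of its
    extension to the full algebra, possibly restricted to an invariant set of
    vectors, is a closed ideal ([kernel_ideal_closed]), so that simplicity makes
    it trivial ([simple_kernel]). If [G] is not effective, some bisection consists
    of isotropy that is not a unit; for a real [g] on it the pointwise square [g^2]
    and [g * g^*] act in the same way but are different functions. If [G] is not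
    minimal, the vectors supported on an orbit that is not dense are killed by a
    function on the units supported off the closure of the orbit.

    Effective and minimal imply simple. Amenability enters once, to show that an
    element of the algebra which is a limit of functions tending uniformly to [0]
    vanishes ([faithful_on_functions]). Square roots of truncated measures of an
    approximately invariant system are functions [xi] with compact support and
    norm at most [1] on every range fibre, for which the positive definite function
    [h = xi * xi^*] is close to [1] on a given compact set ([amenable_overlap]).
    Multiplication by [h] is a contraction of the full norm ([multiplier_le]).
    For this [xi (x) xi] is cut along bisections ([overlap_decomposition]): up to
    a small error, [h f] is then a sum of convolutions [X_j * X_k^*] with
    coefficients [f (j k^-1)], and such a matrix of coefficients is a corner of the
    regular representation of [f] on Hilbert space valued families. Since [h f]
    is supported in a compact set that depends only on [h], its norm is controlled
    by the supremum norm of [f]; letting [h] tend to [1] gives the claim.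

    A nonzero closed ideal [J] therefore contains some [a] all of whose close
    approximants [f] in [C_c(G)] exceed a fixed [e] somewhere, and a translation
    moves the point where this happens to a unit. By effectiveness the finitely
    many bisections covering the part of the support of [f] off the units move
    some open set of units off itself ([effective_shrink]); cutting down by a
    function [k] on that set leaves a function [phi = k f k] on the units within
    [e / 4] of [J] and larger than [e] at a unit. Functional calculus among
    functions on the units then puts a nonzero function on the units into [J]
    ([ideal_unit_function]). Finally minimality carries the nonvanishing of this
    function to every unit, and every function in [C_c(G)] is a sum of multiples of
    elements of [J] ([ideal_full]). *)

(** * Real-valued norms and completeness of the complex numbers *)

Section real_norm.
Variable R : realType.
Local Notation C := R[i].

(** A norm over [R[i]] takes values in [R[i]]; its real part carries the same
    information in the totally ordered field [R]. *)
Definition rnorm (V : normedZmodType C) (v : V) : R := complex.Re `|v|.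

Section theory.
Variable V : normedZmodType C.
Implicit Types u v w : V.

Lemma rnormE v : `|v| = (rnorm v)%:C%C.
Proof. by rewrite RRe_real// realE normr_ge0. Qed.

Lemma rnorm_ge0 v : 0 <= rnorm v.
Proof. by rewrite -ler0c -rnormE. Qed.

Lemma rnorm0 : rnorm (0 : V) = 0.
Proof. by rewrite /rnorm normr0. Qed.

Lemma rnormN v : rnorm (- v) = rnorm v.
Proof. by rewrite /rnorm normrN. Qed.

Lemma rnormBC u v : rnorm (u - v) = rnorm (v - u).
Proof. by rewrite -rnormN opprB. Qed.

Lemma rnorm_eq0 v : rnorm v = 0 -> v = 0.
Proof. by move=> v0; apply: normr0_eq0; rewrite rnormE v0. Qed.

Lemma rnormD u v : rnorm (u + v) <= rnorm u + rnorm v.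
Proof. by rewrite -lecR rmorphD /= -!rnormE ler_normD. Qed.

Lemma rnormB u v : rnorm (u - v) <= rnorm u + rnorm v.
Proof. by rewrite -(rnormN v) rnormD. Qed.

Lemma rnorm_triangle u v w : rnorm (u - w) <= rnorm (u - v) + rnorm (v - w).
Proof. by rewrite -{1}[u](subrK v) -addrA rnormD. Qed.

Lemma rnorm_sub_le u v : rnorm u <= rnorm (u - v) + rnorm v.
Proof. by rewrite -{1}[u](subrK v) rnormD. Qed.

Lemma rnorm_sum I (r : seq I) (P : pred I) (F : I -> V) :
  rnorm (\sum_(i <- r | P i) F i) <= \sum_(i <- r | P i) rnorm (F i).
Proof.
elim/big_ind2 : _ => //; first by rewrite rnorm0.
by move=> u1 a1 u2 a2 h1 h2; rewrite (le_trans (rnormD _ _))// lerD.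
Qed.

End theory.

Lemma rnormZ (V : normedModType C) (k : C) (v : V) :
  rnorm (k *: v) = rnorm k * rnorm v.
Proof. by apply: complexI; rewrite rmorphM/= -!rnormE normrZ. Qed.

Lemma rnormM (a b : C) : rnorm (a * b) = rnorm a * rnorm b.
Proof. by apply: complexI; rewrite rmorphM/= -!rnormE normrM. Qed.

Lemma rnorm_conj (a : C) : rnorm a^* = rnorm a.
Proof. by rewrite /rnorm norm_conjC. Qed.

Lemma rnormC (x : R) : rnorm (x%:C%C : C) = `|x|.
Proof.
apply: complexI; rewrite -rnormE; have [x0|x0] := leP 0 x.
  by rewrite !ger0_norm// ler0c.
by rewrite !ltr0_norm ?rmorphN// ltcR.
Qed.

Lemma rnorm1 : rnorm (1 : C) = 1.
Proof. by rewrite /rnorm normr1. Qed.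

Lemma rnorm_sqr (a : C) : (rnorm a ^+ 2)%:C%C = a * a^*.
Proof. by rewrite rmorphXn/= -rnormE normCK. Qed.

Lemma Re_le_rnorm (a : C) : `|complex.Re a| <= rnorm a.
Proof. by rewrite -lecR -rnormE normc_ge_Re. Qed.

Lemma conjC_conjc (a : C) : a^* = (a^*)%C.
Proof.
have [->|a0] := eqVneq a 0; first by rewrite rmorph0 conjc0.
by apply: (mulfI a0); rewrite -normCK sqr_normc.
Qed.

Lemma conjC_realc (x : R) : (x%:C%C : C)^* = x%:C%C.
Proof. by rewrite conjC_conjc conjc_real. Qed.

Lemma rnorm_le_ReIm (a : C) :
  rnorm a <= `|complex.Re a| + `|complex.Im a|.
Proof.
rewrite {1}[a]complexE (le_trans (rnormD _ _))// rnormM !rnormC lerD2l.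
by rewrite -[leRHS]mul1r ler_wpM2r// /rnorm normc_def/= expr0n/= expr1n add0r sqrtr1.
Qed.

Lemma Im_le_rnorm (a : C) : `|complex.Im a| <= rnorm a.
Proof.
have -> : `|complex.Im a| = `|complex.Re (a * 'i%C)|.
  by rewrite ReiNIm normrN.
rewrite (le_trans (Re_le_rnorm _))// rnormM.
by rewrite /rnorm [X in _ * complex.Re X]normc_def/= expr0n/= expr1n add0r sqrtr1 mulr1.
Qed.

(** Radii in [R[i]] are positive, hence real, so that real radii suffice. *)
Lemma cvg_rnormP (V : normedModType C) (T : Type) (F : set_system T)
    {FF : Filter F} (f : T -> V) (l : V) :
  f @ F --> l <-> forall e : R, 0 < e -> \forall x \near F, rnorm (l - f x) < e.
Proof.
split=> [/cvgrPdist_lt h e e0|h].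
  have /h : (0 : C) < e%:C%C by rewrite ltcR.
  by apply: filterS => x; rewrite rnormE ltcR.
apply/cvgrPdist_lt => e e0; have er : e = (complex.Re e)%:C%C.
  by rewrite RRe_real// gtr0_real.
have /h : 0 < complex.Re e by rewrite -ltcR -er.
by apply: filterS => x; rewrite rnormE er ltcR.
Qed.

Lemma nbhs_rnormP (V : normedModType C) (x : V) (A : set V) :
  nbhs x A <-> exists2 e : R, 0 < e & forall y, rnorm (x - y) < e -> A y.
Proof.
split.
  move=> /nbhs_normP[e/= e0 h]; have er : e = (complex.Re e)%:C%C.
    by rewrite RRe_real// gtr0_real.
  exists (complex.Re e); first by rewrite -ltcR -er.
  by move=> y xy; apply: h; rewrite /= /ball_/= er rnormE ltcR.
move=> [e e0 h]; apply/nbhs_normP; exists e%:C%C; first by rewrite /= ltcR.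
by move=> y/=; rewrite /ball_/= rnormE ltcR => /h.
Qed.

Lemma continuous_realc : continuous (fun x : R => x%:C%C : C).
Proof.
move=> x; apply/cvg_rnormP => e e0.
have /cvgrPdist_lt/(_ _ e0) : (fun y : R => y) @ x --> x by exact: cvg_id.
by apply: filterS => y; rewrite -rmorphB/= rnormC.
Qed.

Lemma continuous_distP (T : topologicalType) (f : T -> R) (x : T) :
  (forall e, 0 < e -> \forall y \near x, `|f x - f y| < e) ->
  {for x, continuous f}.
Proof. by move=> h; apply/cvgrPdist_lt. Qed.

Lemma continuous_rnormP (V : normedModType C) (T : topologicalType)
    (f : T -> V) (x : T) :
  {for x, continuous f} <->
  forall e, 0 < e -> \forall y \near x, rnorm (f x - f y) < e.
Proof. exact: cvg_rnormP. Qed.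

Lemma continuous_Re : continuous (fun a : C => complex.Re a : R).
Proof.
move=> x; apply: continuous_distP => e e0; apply/nbhs_rnormP; exists e => // y xy.
have -> : complex.Re x - complex.Re y = complex.Re (x - y) by rewrite -raddfB.
exact: le_lt_trans (Re_le_rnorm _) xy.
Qed.

Lemma continuous_conjC : continuous (fun a : C => a^* : C).
Proof.
move=> x; apply/continuous_rnormP => e e0; apply/nbhs_rnormP; exists e => // y xy.
by rewrite -rmorphB rnorm_conj.
Qed.

Lemma continuous_rnorm (V : normedModType C) : continuous (@rnorm V).
Proof.
move=> x; apply: continuous_distP => e e0; apply/nbhs_rnormP; exists e => // y xy.
rewrite (le_lt_trans _ xy)// ler_norml; apply/andP; split.
  by have := rnorm_sub_le y x; rewrite rnormBC; lra.
by have := rnorm_sub_le x y; lra.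
Qed.

Lemma cauchy_rnormP (V : normedModType C) (F : set_system V) {FF : ProperFilter F} :
  cauchy F <-> forall e : R, 0 < e -> exists2 A : set V, F A &
    forall a b, A a -> A b -> rnorm (a - b) < e.
Proof.
split=> [Fc e e0|h A].
  have /Fc : entourage [set ab : V * V | rnorm (ab.1 - ab.2) < e].
    rewrite -entourage_ballE/=; exists e%:C%C; first by rewrite /= ltcR.
    by move=> [a b]; rewrite /= -ball_normE /ball_/= rnormE ltcR.
  move=> [[A1 A2]/= [F1 F2] h]; exists (A1 `&` A2); first exact: filterI.
  by move=> a b [a1 _] [_ b2]; apply: (h (a, b)).
rewrite -entourage_ballE => -[e/= e0 hA].
have er : e = (complex.Re e)%:C%C by rewrite RRe_real// gtr0_real.
have [|B FB hB] := h (complex.Re e); first by rewrite -ltcR -er.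
exists (B, B) => //= -[a b]/= [Ba Bb]; apply: hA.
by rewrite /= -ball_normE /ball_/= er rnormE ltcR hB.
Qed.

(** A Cauchy filter converges because its images under the real and imaginary
    parts, which do not increase distances, converge. *)
Lemma complex_complete : Uniform_isComplete R[i].
Proof.
constructor => F FF /cauchy_rnormP Fc.
have cR (g : C -> R) : (forall a b, `|g a - g b| <= rnorm (a - b)) -> cvg (g @ F).
  move=> hg; apply: cauchy_cvg; apply/cauchy_ballP => e e0.
  have [B FB hB] := Fc e e0.
  exists (g @` B, g @` B) => /=.
    have h : F (g @^-1` (g @` B)) by apply: (filterS _ FB) => a Ba; exists a.
    by split; exact: h.
  move=> [_ _]/= [[a Ba <-] [b Bb <-]].
  by rewrite -ball_normE /ball_/= (le_lt_trans (hg _ _))// hB.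
have /cvg_ex[/= x Fx] : cvg ((fun a : C => complex.Re a) @ F).
  by apply: cR => a b; rewrite -raddfB Re_le_rnorm.
have /cvg_ex[/= y Fy] : cvg ((fun a : C => complex.Im a) @ F).
  by apply: cR => a b; rewrite -raddfB Im_le_rnorm.
apply/cvg_ex; exists (x +i* y)%C; apply/(@cvg_rnormP _ C F _ idfun) => e e0.
have e2 : 0 < e / 2 by rewrite divr_gt0.
move: Fx => /cvgrPdist_lt/(_ _ e2) Fx; move: Fy => /cvgrPdist_lt/(_ _ e2) Fy.
near=> a; rewrite (le_lt_trans (rnorm_le_ReIm _))// [X in _ < X](splitr e) ltrD//.
  by rewrite raddfB/=; near: a.
by rewrite raddfB/=; near: a.
Unshelve. all: by end_near. Qed.

HB.instance Definition _ := complex_complete.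

End real_norm.

(** * Groupoid identities and bisections *)

Section groupoid_algebra.
Variable G : groupoidType.
Implicit Types a b c x : G.

Lemma grange_inv a : grange (ginv a) = gsource a.
Proof. by rewrite /grange ginvK. Qed.
Lemma gsource_inv a : gsource (ginv a) = grange a.
Proof. by rewrite /gsource ginvK. Qed.
Lemma grangeM a b : gsource a = grange b -> grange (gmul a b) = grange a.
Proof. exact: grange_mul. Qed.
Lemma gsourceM a b : gsource a = grange b -> gsource (gmul a b) = gsource b.
Proof. exact: gsource_mul. Qed.
Lemma gmulgA a b c : gsource a = grange b -> gsource b = grange c ->
  gmul a (gmul b c) = gmul (gmul a b) c.
Proof. exact: gmulA. Qed.
Lemma grangel a : gmul (grange a) a = a. Proof. exact: gmul_rangel. Qed.
Lemma gsourcer a : gmul a (gsource a) = a. Proof. exact: gmul_sourcer. Qed.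
Lemma gmulgV a : gmul a (ginv a) = grange a. Proof. by []. Qed.
Lemma gmulVg a : gmul (ginv a) a = gsource a. Proof. by []. Qed.

Lemma grange_grange a : grange (grange a) = grange a.
Proof. by rewrite {2}/grange grangeM ?grange_inv. Qed.
Lemma gsource_grange a : gsource (grange a) = grange a.
Proof. by rewrite {2}/grange gsourceM ?grange_inv ?gsource_inv. Qed.
Lemma grange_gsource a : grange (gsource a) = gsource a.
Proof. by rewrite -(grange_inv a) grange_grange. Qed.
Lemma gsource_gsource a : gsource (gsource a) = gsource a.
Proof. by rewrite -(grange_inv a) gsource_grange. Qed.

Lemma gunits_source a : gunits (gsource a). Proof. by exists a. Qed.
Lemma gunits_range a : gunits (grange a). Proof. by exists (ginv a) => //; rewrite gsource_inv. Qed.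
Lemma gunitsP x : gunits x <-> grange x = x.
Proof. by split=> [[a _ <-]|<-]; [exact: grange_gsource|exact: gunits_range]. Qed.
Lemma gunits_grange x : gunits x -> grange x = x. Proof. by move/gunitsP. Qed.
Lemma gunits_gsource x : gunits x -> gsource x = x.
Proof. by move=> [a _ <-]; rewrite gsource_gsource. Qed.
Lemma gunits_inv x : gunits x -> ginv x = x.
Proof.
move=> ux; have rx := gunits_grange ux; have sx := gunits_gsource ux.
by rewrite -[LHS]grangel grange_inv sx; exact: rx.
Qed.
Lemma gunits_grange_gsource x : gunits x -> grange x = gsource x.
Proof. by move=> ux; rewrite gunits_grange ?gunits_gsource. Qed.

Lemma gmulKg a b : gsource a = grange b -> gmul (ginv a) (gmul a b) = b.
Proof. by move=> ab; rewrite gmulgA ?gsource_inv// gmulVg ab grangel. Qed.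
Lemma gmulVKg a b : grange a = grange b -> gmul a (gmul (ginv a) b) = b.
Proof. by move=> ab; rewrite gmulgA ?grange_inv ?gsource_inv// gmulgV ab grangel. Qed.
Lemma gmulgK a b : gsource a = grange b -> gmul (gmul a b) (ginv b) = a.
Proof. by move=> ab; rewrite -gmulgA ?grange_inv// gmulgV -ab gsourcer. Qed.
Lemma gmulgVK a b : gsource a = gsource b -> gmul (gmul a (ginv b)) b = a.
Proof. by move=> ab; rewrite -gmulgA ?grange_inv ?gsource_inv// gmulVg -ab gsourcer. Qed.

Lemma ginvM a b : gsource a = grange b -> ginv (gmul a b) = gmul (ginv b) (ginv a).
Proof.
move=> ab; have h : gsource (ginv b) = grange (ginv a).
  by rewrite gsource_inv grange_inv.
have h2 : gmul (gmul a b) (gmul (ginv b) (ginv a)) = grange a.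
  by rewrite gmulgA//; [rewrite gmulgK|rewrite gsourceM// grange_inv].
rewrite -[LHS]gsourcer gsource_inv grangeM// -h2 gmulKg//.
by rewrite gsourceM// grangeM// grange_inv.
Qed.

Lemma gmul_Vr a b : grange a = grange b -> ginv (gmul (ginv a) b) = gmul (ginv b) a.
Proof. by move=> ab; rewrite ginvM ?ginvK// gsource_inv. Qed.

Lemma grange_divl a b : grange a = grange b -> grange (gmul (ginv a) b) = gsource a.
Proof. by move=> ab; rewrite grangeM ?grange_inv ?gsource_inv. Qed.
Lemma gsource_divl a b : grange a = grange b -> gsource (gmul (ginv a) b) = gsource b.
Proof. by move=> ab; rewrite gsourceM ?grange_inv ?gsource_inv. Qed.

Lemma gmulgI a b c : gsource a = grange b -> gsource a = grange c ->
  gmul a b = gmul a c -> b = c.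
Proof. by move=> ab ac e; rewrite -(gmulKg ab) e gmulKg. Qed.

End groupoid_algebra.

(** Injectivity suffices: by [grange_open] and [gsource_open] below, the range and
    source maps of an étale groupoid are open, so that both are homeomorphisms
    from a bisection to an open set. *)
Definition bisection (G : topologicalGroupoidType) (U : set G) : Prop :=
  [/\ open U, {in U &, injective (@grange G)} & {in U &, injective (@gsource G)}].

Lemma within_continuous_nbhs (X Y : topologicalType) (A : set X) (f : X -> Y) x N :
  {within A, continuous f} -> A x -> nbhs (f x) N ->
  nbhs x [set y | A y -> N (f y)].
Proof. by move=> /subspace_continuousP fc Ax; exact: (fc x Ax). Qed.

Lemma hausdorff_separate (X : topologicalType) (x y : X) : hausdorff_space X -> x <> y ->
  exists A B : set X, [/\ open A, open B, A x, B y & forall z, A z -> ~ B z].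
Proof.
rewrite open_hausdorff => hX /eqP/hX[[A B]/= [/set_mem Ax /set_mem By]].
move=> [oA oB /eqP AB]; exists A, B; split => // z Az Bz.
by have : (A `&` B) z by []; rewrite AB.
Qed.

Section etale_groupoid.
Variable G : topologicalGroupoidType.
Hypothesis G_etale : etale G.
Implicit Types (a b c x : G) (U V W : set G).

Lemma gmul_cont_at a b : gsource a = grange b ->
  forall N, nbhs (gmul a b) N ->
  exists A B, [/\ nbhs a A, nbhs b B & forall a' b', A a' -> B b' ->
    gsource a' = grange b' -> N (gmul a' b')].
Proof.
move=> ab N Nab.
have := within_continuous_nbhs (x := (a, b)) (@gmul_continuous G) ab Nab.
move=> [[A B]/= [nA nB] h]; exists A, B; split => // a' b' Aa Bb ab'.
exact: (h (a', b')).
Qed.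

Lemma grange_open U : open U -> open (@grange G @` U).
Proof.
move=> oU; rewrite openE => _ [x Ux <-].
have [V [oV Vx oVr _ [g [gc gK]]]] := G_etale x.
have nr : nbhs (grange x) (@grange G @` V).
  by apply: open_nbhs_nbhs; split => //; exists x.
have ng : nbhs (g (grange x)) (U `&` V).
  by rewrite gK//; apply: open_nbhs_nbhs; split => //; exact: openI.
have xV : (@grange G @` V) (grange x) by exists x.
have h := within_continuous_nbhs gc xV ng.
apply: filterS2 nr h => _ [y Vy <-] /= [|Uy _]; first by exists y.
by rewrite gK// in Uy; exists y.
Qed.

Lemma ginv_open U : open U -> open (@ginv G @^-1` U).
Proof. by move=> oU; apply: open_comp => // x _; exact: ginv_continuous. Qed.

Lemma gsource_open U : open U -> open (@gsource G @` U).
Proof.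
move=> /ginv_open/grange_open.
suff -> : @grange G @` (@ginv G @^-1` U) = @gsource G @` U by [].
apply/seteqP; split=> _ [a Ua <-].
  by exists (ginv a) => //; rewrite gsource_inv.
by exists (ginv a); rewrite /= ?ginvK// grange_inv.
Qed.

Lemma gunits_open : open (@gunits G).
Proof. exact: (gsource_open openT). Qed.

Lemma bisection_open U : bisection U -> open U. Proof. by case. Qed.

Lemma bisection_rinj U a b : bisection U -> U a -> U b -> grange a = grange b -> a = b.
Proof. by move=> [_ h _] Ua Ub; apply: h; rewrite inE. Qed.

Lemma bisection_sinj U a b : bisection U -> U a -> U b -> gsource a = gsource b -> a = b.
Proof. by move=> [_ _ h] Ua Ub; apply: h; rewrite inE. Qed.

Lemma bisection_inv U : bisection U -> bisection (@ginv G @^-1` U).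
Proof.
move=> bU; split; first exact/ginv_open/bisection_open.
  move=> a b; rewrite !inE => Ua Ub ab; apply: (inv_inj (@ginvK G)).
  by apply: (bisection_sinj bU) => //; rewrite !gsource_inv.
move=> a b; rewrite !inE => Ua Ub ab; apply: (inv_inj (@ginvK G)).
by apply: (bisection_rinj bU) => //; rewrite !grange_inv.
Qed.

Lemma bisection_units : bisection (@gunits G).
Proof.
split; first exact: gunits_open.
  by move=> a b; rewrite !inE => /gunits_grange ra /gunits_grange rb; rewrite ra rb.
by move=> a b; rewrite !inE => /gunits_gsource ra /gunits_gsource rb; rewrite ra rb.
Qed.

(** The range map is injective near [a]; the source map is the range map composed
    with inversion, and the range map is also injective near [a^-1]. *)
Lemma exists_bisection a W : open W -> W a -> exists U, [/\ bisection U, U a & U `<=` W].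
Proof.
move=> oW Wa.
have [V [oV Va _ _ [g [_ gK]]]] := G_etale a.
have [V' [oV' Va' _ _ [g' [_ gK']]]] := G_etale (ginv a).
exists (W `&` V `&` (@ginv G @^-1` V')); split => //.
- split; first exact: openI (openI oW oV) (ginv_open oV').
    by move=> x y; rewrite !inE => -[[_ Vx] _] [[_ Vy] _] xy; rewrite -(gK x)// xy gK.
  move=> x y; rewrite !inE => -[_ Vx] [_ Vy] xy; apply: (inv_inj (@ginvK G)).
  by rewrite -(gK' (ginv x))// grange_inv xy -grange_inv gK'.
- by move=> x [[]].
Qed.

(** On a bisection the range map has a continuous inverse. *)
Lemma bisection_section U a N : bisection U -> U a -> nbhs a N ->
  nbhs (grange a) [set y | forall b, U b -> grange b = y -> N b].
Proof.
move=> bU Ua; rewrite nbhsE => -[W [oW Wa] WN].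
have o : open (@grange G @` (U `&` W)) by apply/grange_open/openI => //; exact: bisection_open bU.
rewrite nbhsE; exists (@grange G @` (U `&` W)); first by split => //; exists a.
move=> _ [b [Ub Wb] <-] b' Ub' bb'; apply: WN.
by rewrite (bisection_rinj bU Ub' Ub).
Qed.

Hypothesis G_hausdorff : hausdorff_space G.

Lemma gunits_closed : closed (@gunits G).
Proof.
have -> : @gunits G = [set x | grange x = x] by apply/seteqP; split=> x /gunitsP.
rewrite -[X in closed X]setCK; apply: open_closedC; rewrite openE => x /= xr.
have [A [B [oA oB Ax Bx AB]]] := hausdorff_separate G_hausdorff xr.
have h : nbhs x (@grange G @^-1` A).
  by apply: grange_continuous; exact: open_nbhs_nbhs.
have h2 : nbhs x B by exact: open_nbhs_nbhs.
by apply: filterS2 h h2 => y Ay By ry; apply: (AB y) => //; rewrite -ry.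
Qed.

End etale_groupoid.

(** * Compactly supported functions and partitions of unity *)

Section continuity.
Variable X : topologicalType.

Lemma continuous_near (Y : topologicalType) (f g : X -> Y) x :
  (\forall y \near x, f y = g y) -> {for x, continuous g} -> {for x, continuous f}.
Proof.
move=> fg gc; have fgx : f x = g x := nbhs_singleton fg.
rewrite /prop_for /continuous_at fgx.
by apply: cvg_trans gc; apply: near_eq_cvg; apply: filterS fg => y ->.
Qed.

Lemma continuous_at_comp (Y Z : topologicalType) (f : X -> Y) (g : Y -> Z) x :
  {for x, continuous f} -> {for f x, continuous g} ->
  {for x, continuous (fun y => g (f y))}.
Proof. exact: continuous_comp. Qed.

Lemma nbhs_preimage (Y : topologicalType) (f : X -> Y) x N :
  {for x, continuous f} -> nbhs (f x) N -> nbhs x (f @^-1` N).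
Proof. by move=> fc Nfx; exact: fc. Qed.

Lemma closed_preimage (Y : topologicalType) (f : X -> Y) (A : set Y) :
  continuous f -> closed A -> closed (f @^-1` A).
Proof. by move=> fc cA; apply: closed_comp => // x _; exact: fc. Qed.

Lemma open_preimage (Y : topologicalType) (f : X -> Y) (A : set Y) :
  continuous f -> open A -> open (f @^-1` A).
Proof. by move=> fc oA; apply: open_comp => // x _; exact: fc. Qed.

Lemma compact_image (Y : topologicalType) (f : X -> Y) (K : set X) :
  continuous f -> compact K -> compact (f @` K).
Proof. by move=> fc cK; apply: continuous_compact => //; exact: continuous_subspaceT. Qed.

End continuity.

Lemma compact_finite_cover (X : topologicalType) (K : set X) (f : X -> set X) :
  compact K -> (forall x, K x -> nbhs x (f x)) ->
  exists s : seq X, (forall i, i \in s -> K i) /\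
    forall x, K x -> exists2 i, i \in s & f i x.
Proof.
move=> cK Kf; have [[x0 Kx0]|K0] := pselect (K !=set0); last first.
  by exists [::]; split => // x Kx; exfalso; apply: K0; exists x.
(* covers are indexed by a pointed space in the characterization of compactness *)
pose pX : ptopologicalType := HB.pack (Topological.sort X) (isPointed.Build X x0).
have : @compact pX K by exact: cK.
rewrite compact_cover => /(_ X K (fun i => interior (f i))).
case=> [i _|x Kx|D DK Kcov]; first exact: open_interior.
  by exists x => //; exact: Kf.
exists (enum_fset D); split => [i iD|x Kx]; first by have := DK i iD; rewrite inE.
by have [i iD /= /interior_subset h] := Kcov _ Kx; exists i.
Qed.

Lemma continuous_sum_seq (R : realType) (X : topologicalType) (I : eqType) (s : seq I)
    (b : I -> X -> R) : (forall i, i \in s -> continuous (b i)) ->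
  continuous (fun x => \sum_(i <- s) b i x).
Proof.
elim: s => [_ x|i s ih h x].
  by under eq_fun do rewrite big_nil; exact: cst_continuous.
under eq_fun do rewrite big_cons; apply: (@continuousD R R^o X).
  by apply: h; rewrite mem_head.
by apply: ih => j js; apply: h; rewrite inE js orbT.
Qed.

(** The compact set is any set containing the points where [f] does not vanish,
    not the closure of these points, so that sums, products and restrictions need
    no closures; for [U] the whole of a Hausdorff space the two conditions agree,
    by [CcinT]. *)
Definition supported_in (X : topologicalType) (V : nmodType) (U : set X) (f : X -> V) :=
  exists K : set X, [/\ compact K, K `<=` U & forall x, f x != 0 -> K x].

Definition Ccin (R : realType) (X : topologicalType) (U : set X) : set (X -> R[i]) :=
  [set f | continuous f /\ supported_in U f].

Section compact_support.
Variables (R : realType) (X : topologicalType).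
Local Notation C := R[i].
Hypothesis X_hausdorff : hausdorff_space X.
Implicit Types (f g : X -> C) (U V : set X).

Lemma continuousMC f g : continuous f -> continuous g -> continuous (fun x => f x * g x).
Proof. by move=> fc gc x; apply: continuousM; [exact: fc|exact: gc]. Qed.

Lemma continuousDC f g : continuous f -> continuous g -> continuous (fun x => f x + g x).
Proof. by move=> fc gc x; apply: (@continuousD C C X); [exact: fc|exact: gc]. Qed.

Lemma continuous_conj f : continuous f -> continuous (fun x => (f x)^*).
Proof. by move=> fc x; apply: (continuous_at_comp (fc x)); exact: continuous_conjC. Qed.

Lemma supported_inS (V : nmodType) (U U' : set X) (f : X -> V) :
  U `<=` U' -> supported_in U f -> supported_in U' f.
Proof. by move=> UU' [K [cK KU fK]]; exists K; split => //; exact: subset_trans UU'. Qed.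

Lemma supported_in_sub (V V' : nmodType) (U : set X) (f : X -> V) (g : X -> V') :
  (forall x, g x != 0 -> f x != 0) -> supported_in U f -> supported_in U g.
Proof. by move=> gf [K [cK KU fK]]; exists K; split => // x /gf/fK. Qed.

Lemma supported_inD (V : nmodType) (U : set X) (f g : X -> V) :
  supported_in U f -> supported_in U g -> supported_in U (fun x => f x + g x).
Proof.
move=> [K [cK KU fK]] [L [cL LU gL]]; exists (K `|` L); split.
- exact: compactU.
- by move=> x [/KU|/LU].
- move=> x; have [->|/fK] := eqVneq (f x) 0; last by left.
  by rewrite add0r => /gL; right.
Qed.

Lemma supported_in0 (V : nmodType) (U : set X) : supported_in U (fun=> 0 : V).
Proof. by exists set0; split => // [|x]; [exact: compact0|rewrite eqxx]. Qed.

Lemma CcinT f : Cc f <-> Ccin setT f.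
Proof.
split=> [[fc cf]|[fc [K [cK _ fK]]]].
  by split => //; exists (closure [set x | f x != 0]); split => // x fx; exact: (@subset_closure _ [set y | f y != 0]).
have clK : closed K by exact: (compact_closed X_hausdorff cK).
split => //; apply: (@subclosed_compact _ _ K) => //; first exact: closed_closure.
by move=> x /(closure_subset fK); rewrite -((closure_id K).1 clK).
Qed.

Lemma Ccin_Cc U f : Ccin U f -> Cc f.
Proof. by move=> [fc fU]; apply/CcinT; split => //; exact: supported_inS fU. Qed.

Lemma CcinS U V f : U `<=` V -> Ccin U f -> Ccin V f.
Proof. by move=> UV [fc fU]; split => //; exact: supported_inS fU. Qed.

Lemma Cc_continuous f : Cc f -> continuous f. Proof. by case. Qed.
Lemma Ccin_continuous U f : Ccin U f -> continuous f. Proof. by case. Qed.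

Lemma Cc_support f : Cc f -> exists2 K, compact K & forall x, f x != 0 -> K x.
Proof. by move=> /CcinT[_ [K [cK _ fK]]]; exists K. Qed.

Lemma Ccin_out U f x : Ccin U f -> ~ U x -> f x = 0.
Proof. by move=> [_ [K [_ KU fK]]] nUx; apply: contrapT => /eqP/fK/KU. Qed.

(** The compact set carrying [f] is closed and misses every point off [U]. *)
Lemma supported_in_near (V : nmodType) (U : set X) (f : X -> V) x : supported_in U f -> ~ U x ->
  \forall y \near x, f y = 0.
Proof.
move=> [K [cK KU fK]] nUx.
have oK : open (~` K) by apply: closed_openC; exact: (compact_closed X_hausdorff cK).
have : nbhs x (~` K) by apply: open_nbhs_nbhs; split => // /KU.
by apply: filterS => y nKy; apply: contrapT => /eqP/fK.
Qed.

Lemma Ccin0 U : Ccin U (0 : X -> C).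
Proof. by split; [exact: cst_continuous|exact: supported_in0]. Qed.

Lemma CcinD U f g : Ccin U f -> Ccin U g -> Ccin U (f + g).
Proof.
move=> [fc fU] [gc gU]; split; [exact: (continuousDC fc gc)|exact: (supported_inD fU gU)].
Qed.

Lemma CcinMl U f g : Ccin U f -> continuous g -> Ccin U (fun x => g x * f x).
Proof.
move=> [fc fU] gc; split; first exact: (continuousMC gc fc).
by apply: supported_in_sub fU => x; apply: contra_neq => ->; rewrite mulr0.
Qed.

Lemma CcinMr U f g : Ccin U f -> continuous g -> Ccin U (fun x => f x * g x).
Proof. by move=> fU gc; under eq_fun do rewrite mulrC; exact: CcinMl. Qed.

Lemma CcinZ U (k : C) f : Ccin U f -> Ccin U (k *: f).
Proof. by move=> fU; apply: (CcinMl (g := fun=> k)) => //; exact: cst_continuous. Qed.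

Lemma Cc0 : Cc (0 : X -> C). Proof. exact: Ccin_Cc (Ccin0 setT). Qed.
Lemma CcD f g : Cc f -> Cc g -> Cc (f + g).
Proof. by move=> /CcinT fc /CcinT gc; apply/CcinT; exact: CcinD. Qed.
Lemma CcZ (k : C) f : Cc f -> Cc (k *: f).
Proof. by move=> /CcinT fc; apply/CcinT; exact: CcinZ. Qed.
Lemma CcN f : Cc f -> Cc (- f).
Proof. by move=> /(CcZ (-1)); rewrite scaleN1r. Qed.
Lemma CcB f g : Cc f -> Cc g -> Cc (f - g).
Proof. by move=> fc gc; apply: CcD => //; exact: CcN. Qed.
Lemma Cc_sum I (r : seq I) (P : pred I) (F : I -> X -> C) :
  (forall i, P i -> Cc (F i)) -> Cc (\sum_(i <- r | P i) F i).
Proof. by move=> FU; elim/big_ind : _ => //; [exact: Cc0|exact: CcD]. Qed.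
Lemma CcMl f g : Cc f -> continuous g -> Cc (fun x => g x * f x).
Proof. by move=> /CcinT fc gc; apply/CcinT; exact: CcinMl. Qed.

Lemma Cc_bounded f : Cc f -> exists2 B : R, 0 <= B & forall x, rnorm (f x) <= B.
Proof.
move=> fC; have [K cK fK] := Cc_support fC; have fc := Cc_continuous fC.
have cn : compact ((fun x => rnorm (f x)) @` K).
  by apply: compact_image => // x; apply: (continuous_at_comp (fc x)); exact: continuous_rnorm.
have [M [_ hM]] := compact_bounded cn.
exists (Num.max 0 (M + 1)); first by rewrite le_max lexx.
move=> x; have [->|/fK Kx] := eqVneq (f x) 0; first by rewrite rnorm0 le_max lexx.
rewrite le_max; apply/orP; right.
have := hM (M + 1); rewrite ltrDl ltr01 => /(_ isT (rnorm (f x))) h.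
by rewrite (le_trans (ler_norm _))// h//; exists x.
Qed.

Lemma Ccin_intro U f K : continuous f -> compact K -> K `<=` U ->
  (forall x, f x != 0 -> K x) -> Ccin U f.
Proof. by move=> *; split => //; exists K. Qed.

Lemma continuous_realC_inv (b : X -> R) :
  continuous (fun x => (b x)%:C%C : C) -> continuous b.
Proof.
move=> bc x; have h : {for x, continuous (fun y => complex.Re ((b y)%:C%C : C))}.
  by apply: (continuous_at_comp (bc x)); exact: continuous_Re.
exact: h.
Qed.

Lemma realC_continuous (b : X -> R) : continuous b -> continuous (fun x => (b x)%:C%C : C).
Proof. by move=> bc x; apply: (continuous_at_comp (bc x)); exact: continuous_realc. Qed.

End compact_support.

Definition bump_in (R : realType) (X : topologicalType) (U : set X) (b : X -> R) :=
  [/\ continuous b, forall x, 0 <= b x, forall x, b x <= 1 & supported_in U b].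

Section partition_of_unity.
Variables (R : realType) (X : topologicalType).
Hypothesis X_hausdorff : hausdorff_space X.
Hypothesis X_lc : locally_compact [set: X].
Implicit Types (U V K : set X).

Lemma bump_Ccin U (b : X -> R) : bump_in U b -> Ccin U (fun x => (b x)%:C%C : R[i]).
Proof.
move=> [bc _ _ bU]; split; first exact: realC_continuous.
by apply: supported_in_sub bU => x; apply: contra_neq => ->.
Qed.

(** A continuous function separating [x] from the complement of a compact
    neighbourhood is [0] at [x] and [1] off the neighbourhood; [1 - 2 f] cut at [0]
    vanishes where [f] is at least [1/2], and thus lives on a compact set. *)
Lemma exists_bump U x : open U -> U x -> exists2 b : X -> R, bump_in U b & b x = 1.
Proof.
move=> oU Ux; have [C] := X_lc (I : [set: X] x); rewrite withinET => Cx [cC clC].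
pose B := ~` (interior C `&` U).
have clB : closed B by apply: open_closedC; apply: openI => //; exact: open_interior.
have nBx : ~ B x by move=> nB; apply: nB; split.
have := @locally_compact_completely_regular X R X_lc X_hausdorff x B clB nBx.
move=> /(@uniform_separatorP _ R)[f [fc f01 fx fB]].
have f01' y : 0 <= f y <= 1.
  by have := f01 (f y) (ex_intro2 _ _ y I erefl); rewrite /= in_itv.
have fx0 : f x = 0 by apply: fx; exists x.
exists (fun y => Num.max 0 (1 - 2 * f y)); last by rewrite fx0 mulr0 subr0 max_r.
split.
- move=> y; apply: (@continuous_max R X (fun=> 0) (fun y => 1 - 2 * f y)); first exact: cst_continuous.
  apply: (@continuousB R R^o X (fun=> 1) (fun y => 2 * f y)); first exact: cst_continuous.
  by apply: (@continuousM R X (fun=> 2) f); [exact: cst_continuous|exact: fc].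
- by move=> y; rewrite le_max lexx.
- by move=> y; rewrite ge_max ler01/=; have := f01' y; lra.
- exists (C `&` f @^-1` [set r | r <= 2^-1]); split.
  + apply: compact_closedI => //; apply: closed_preimage => //; exact: closed_le.
  + move=> y [_ /= fy]; apply: contrapT => nU.
    have : f y = 1 by apply: fB; exists y => // -[].
    by move=> fy1; move: fy; rewrite fy1; lra.
  + move=> y; rewrite /Num.max; case: ltP => [h _|]; last by rewrite eqxx.
    have fy : f y < 1 by lra.
    split; last by rewrite /=; lra.
    apply: interior_subset; apply: contrapT => nC.
    have : f y = 1 by apply: fB; exists y => // -[].
    by move=> fy1; rewrite fy1 ltxx in fy.
Qed.

(** Bumps [b i] with [b i > 1/2] on the pieces of a finite cover are divided by
    [max (sum b) (1/2)] rather than by their sum, which keeps the quotients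
    defined, and of sum at most 1, off the compact set. *)
Lemma partition_of_unity K (U : X -> set X) : compact K ->
  (forall x, K x -> open (U x) /\ U x x) ->
  exists (s : seq X) (p : X -> X -> R), [/\
    forall i, i \in s -> K i /\ bump_in (U i) (p i),
    forall x, \sum_(i <- s) p i x <= 1 &
    forall x, K x -> \sum_(i <- s) p i x = 1].
Proof.
move=> cK KU.
have /choice[b hb] : forall i, exists b : X -> R, K i -> bump_in (U i) b /\ b i = 1.
  move=> i; have [Ki|nK] := pselect (K i); last by exists (fun=> 0).
  by have [oU Ui] := KU _ Ki; have [b ? ?] := exists_bump oU Ui; exists b.
have [x Kx|D [DK' Kcov]] := compact_finite_cover (f := fun i => [set x | 2^-1 < b i x]) cK.
  have [[bc _ _ _] bx] := hb _ Kx.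
  apply: (@open_nbhs_nbhs _ x [set y | 2^-1 < b x y]); split.
    have o : open [set r : R | 2^-1 < r] by exact: open_gt.
    exact: (open_preimage bc o).
  by rewrite /= bx; lra.
pose B x := \sum_(i <- D) b i x; pose M x := Num.max (B x) 2^-1.
have bc i : i \in D -> continuous (b i) by move=> /DK'/hb[[]].
have Bc : continuous B by exact: continuous_sum_seq.
have M0 x : 0 < M x by rewrite /M lt_max invr_gt0 ltr0n orbT.
have Mc : continuous M.
  move=> x; apply: (@continuous_max R X B (fun=> 2^-1)); first exact: Bc.
  exact: cst_continuous.
have b0 i x : i \in D -> 0 <= b i x by move=> /DK'/hb[[]].
have B0 x : 0 <= B x by rewrite /B big_seq sumr_ge0// => i /b0.
have bB i x : i \in D -> b i x <= B x.
  move=> iD; rewrite /B (big_rem i)//= lerDl big_seq sumr_ge0// => j /mem_rem; exact: b0.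
exists D, (fun i x => b i x / M x); split.
- move=> i iD; have Ki := DK' _ iD; have [[_ _ _ bU] _] := hb _ Ki.
  split => //; split.
  + move=> x; apply: (@continuousM R X (b i) (fun x => (M x)^-1)); first exact: bc.
    by apply: continuousV; [rewrite gt_eqF|exact: Mc].
  + by move=> x; rewrite divr_ge0 ?b0// ltW.
  + move=> x; rewrite ler_pdivrMr// mul1r (le_trans (bB _ _ iD))//.
    by rewrite /M le_max lexx.
  + by apply: supported_in_sub bU => x; apply: contra_neq => ->; rewrite mul0r.
- move=> x; rewrite -mulr_suml ler_pdivrMr// mul1r.
  by rewrite -/(B x) /M le_max lexx.
- move=> x Kx; rewrite -mulr_suml -/(B x) /M max_l ?divff//.
    by have [i iD /= h] := Kcov _ Kx; rewrite gt_eqF// (lt_le_trans _ (bB _ _ iD))// (lt_trans _ h)// invr_gt0.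
  by have [i iD /= h] := Kcov _ Kx; rewrite (le_trans (ltW h))// bB.
Qed.

End partition_of_unity.

(** * Sums over range fibres and the convolution algebra *)

Section fibre_sums.
Variables (R : realType) (G : topologicalGroupoidType).
Local Notation C := R[i].
Implicit Types (f g : G -> C) (a b c x : G).

(** The integral of [F] over the discrete fibre [r^-1(x)] with weight [f]: both
    the convolution product and the operators of a groupoid action are of this
    form. *)
Definition fint (V : lmodType C) (x : G) (f : G -> C) (F : G -> V) : V :=
  \sum_(a \in grange_fiber x) f a *: F a.

Section general.
Variable V : lmodType C.
Implicit Types F : G -> V.

Lemma fint_finite x f F (S : set G) : finite_set S -> S `<=` grange_fiber x ->
  (forall a, grange a = x -> f a != 0 -> S a) ->
  fint x f F = \sum_(a <- fset_set S) f a *: F a.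
Proof.
move=> fS Sx fS0; rewrite -fsbig_finite//; symmetry; apply: fsbig_widen => // a [ax nSa].
rewrite /=; have [->|/(fS0 _ ax)//] := eqVneq (f a) 0; by rewrite scale0r.
Qed.

Lemma eq_fint x f g F F' :
  (forall a, grange a = x -> f a *: F a = g a *: F' a) -> fint x f F = fint x g F'.
Proof. by move=> h; apply: eq_fsbigr => a; rewrite inE => ax; exact: h. Qed.

Lemma fint_eq0 x f F : (forall a, grange a = x -> f a *: F a = 0) -> fint x f F = 0.
Proof. by move=> h; apply: fsbig1. Qed.

Lemma fint_single x f F a : grange a = x ->
  (forall b, grange b = x -> b != a -> f b *: F b = 0) -> fint x f F = f a *: F a.
Proof.
move=> ax h; rewrite -[RHS](fsbig_set1 +%R a (fun a => f a *: F a)); symmetry.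
apply: fsbig_widen => [_ -> //|b [bx /= ba]]; apply: h => //.
by apply/eqP.
Qed.

Lemma fint_bisection U x f F a : bisection U -> (forall b, ~ U b -> f b = 0) ->
  U a -> grange a = x -> fint x f F = f a *: F a.
Proof.
move=> bU fU Ua ax; apply: fint_single => // b bx ba; rewrite fU ?scale0r// => Ub.
by move/eqP: ba; apply; apply: (bisection_rinj bU) => //; rewrite bx.
Qed.

Lemma fint_shift a f F : fint (grange a) f F =
  fint (gsource a) (fun b => f (gmul a b)) (fun b => F (gmul a b)).
Proof.
rewrite /fint; apply: (reindex_fsbig (gmul a)); split.
- by move=> b /= bx; rewrite /grange_fiber/= grangeM.
- move=> b b'; rewrite !inE => /= h h'; by apply: gmulgI.
- move=> c /= ca; exists (gmul (ginv a) c); first by rewrite /grange_fiber/= grange_divl.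
  by rewrite gmulVKg.
Qed.

End general.

Definition fibre_finite f := forall x, finite_set [set a | grange a = x /\ f a != 0].

Lemma fint_fset (V : lmodType C) x f : fibre_finite f -> exists s : {fset G},
  (forall a, a \in s = (grange a == x) && (f a != 0)) /\
  forall F : G -> V, fint x f F = \sum_(a <- s) f a *: F a.
Proof.
move=> ff; exists (fset_set [set a | grange a = x /\ f a != 0]); split.
  move=> a; rewrite in_fset_set//; apply/idP/andP; rewrite inE/=.
    by move=> [/eqP ? ?].
  by move=> [/eqP ? ?].
by move=> F; apply: fint_finite => // a; case.
Qed.

Lemma fint_linear (V : lmodType C) x f (k : C) (F F' : G -> V) : fibre_finite f ->
  fint x f (fun a => k *: F a + F' a) = k *: fint x f F + fint x f F'.
Proof.
move=> /(@fint_fset V x)[s [_ h]]; rewrite !h scaler_sumr -big_split/=.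
by apply: eq_bigr => a _; rewrite scalerDr !scalerA mulrC.
Qed.

Lemma fint_linearl (V : lmodType C) x f g (k : C) (F : G -> V) :
  fibre_finite f -> fibre_finite g ->
  fint x (k *: f + g) F = k *: fint x f F + fint x g F.
Proof.
move=> ff fg.
pose S := [set a | grange a = x /\ f a != 0] `|` [set a | grange a = x /\ g a != 0].
have fS : finite_set S by rewrite finite_setU.
have Sx : S `<=` grange_fiber x by move=> a [[]|[]].
rewrite !(@fint_finite _ x _ _ S)//.
- rewrite scaler_sumr -big_split/=; apply: eq_bigr => a _.
  by rewrite scalerA -scalerDl.
- by move=> a ax fa; right.
- by move=> a ax fa; left.
- move=> a ax; rewrite !fctE; have [->|fa _] := eqVneq (f a) 0; last by left.
  by rewrite scaler0 add0r => ga; right.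
Qed.

Lemma fibre_finiteD f g : fibre_finite f -> fibre_finite g -> fibre_finite (f + g).
Proof.
move=> ff fg x.
apply: (@sub_finite_set _ _ ([set a | grange a = x /\ f a != 0] `|` [set a | grange a = x /\ g a != 0])).
  move=> a [ax]; rewrite fctE; have [->|fa _] := eqVneq (f a) 0; last by left.
  by rewrite add0r => ga; right.
by rewrite finite_setU; split; [exact: ff|exact: fg].
Qed.

Lemma fibre_finite_bisection U f : bisection U -> (forall b, ~ U b -> f b = 0) ->
  fibre_finite f.
Proof.
move=> bU fU x; have [[a [Ua ax]]|h] := pselect (exists a, U a /\ grange a = x).
  apply: (@sub_finite_set _ _ [set a]); last exact: finite_set1.
  move=> b [bx fb] /=; apply: (bisection_rinj bU) => //; last by rewrite bx.
  by apply: contrapT => /fU fb0; rewrite fb0 eqxx in fb.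
rewrite (_ : [set _ | _] = set0); first exact: finite_set0.
apply/seteqP; split=> // a [ax fa]; apply: h; exists a; split => //.
by apply: contrapT => /fU fb0; rewrite fb0 eqxx in fa.
Qed.

(** A factorisation [c = a b] is determined by [a]. *)
Lemma convolutionE f g c :
  convolution f g c = fint (grange c) f (fun a => g (gmul (ginv a) c)).
Proof.
rewrite /convolution /fint; apply: (reindex_fsbig (fun a => (a, gmul (ginv a) c))); split.
- move=> a /= ac; split; last by rewrite gmulVKg.
  by rewrite /gcomposable/= grange_divl.
- by move=> a b _ _ [].
- move=> [a b]/= [ab <-]; exists a; last by rewrite gmulKg.
  by rewrite /grange_fiber/= grangeM.
Qed.

End fibre_sums.

Section Cc_groupoid.
Variables (R : realType) (G : topologicalGroupoidType).
Hypothesis G_etale : etale G.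
Hypothesis G_hausdorff : hausdorff_space G.
Hypothesis G_lc : locally_compact [set: G].
Local Notation C := R[i].
Implicit Types (f g : G -> C) (a b c x : G) (U : set G).

Lemma Ccin_units f : Cc f -> (forall c, ~ gunits c -> f c = 0) -> Ccin (@gunits G) f.
Proof.
move=> fC fu; have [K cK fK] := Cc_support G_hausdorff fC.
apply: (Ccin_intro (Cc_continuous fC) (compact_closedI cK (gunits_closed G_hausdorff))).
  exact: subIsetr.
move=> x nx; split; first exact: fK.
by apply: contrapT => nu; move/eqP: nx; apply; exact: fu.
Qed.

Definition small_basis (small : set G -> Prop) :=
  forall x, exists U, [/\ open U, U x & small U].

Lemma bisection_basis : small_basis (@bisection G).
Proof. by move=> x; have [U [bU Ux _]] := exists_bisection G_etale openT (I : setT x); exists U; split => //; case: bU. Qed.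

Lemma small_partition (small : set G -> Prop) (K : set G) : small_basis small ->
  compact K -> exists (s : seq G) (U : G -> set G) (p : G -> G -> R), [/\
    forall i, i \in s -> small (U i) /\ bump_in (U i) (p i),
    forall x, \sum_(i <- s) p i x <= 1 &
    forall x, K x -> \sum_(i <- s) p i x = 1].
Proof.
move=> /choice[U hU] cK.
have [|s [p [h1 h2 h3]]] := partition_of_unity R G_hausdorff G_lc (U := U) cK.
  by move=> x _; have [] := hU x.
exists s, U, p; split => // i /h1[_ ?]; split => //; by have [] := hU i.
Qed.

(** A partition of unity splits [f] into functions on small sets, so that a
    property stable under addition need only be checked there. *)
Lemma Cc_ind (small : set G -> Prop) (P : (G -> C) -> Prop) : small_basis small ->
  P 0 -> (forall f g, Cc f -> Cc g -> P f -> P g -> P (f + g)) ->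
  (forall U f, small U -> Ccin U f -> P f) -> forall f, Cc f -> P f.
Proof.
move=> hs P0 PD Ps f fC; have [K cK fK] := Cc_support G_hausdorff fC.
have [s [U [p [h1 _ h3]]]] := small_partition hs cK.
have Ef : f = \sum_(i <- s) (fun x => (p i x)%:C%C * f x).
  apply/funext => x; rewrite fct_sumE -mulr_suml -rmorph_sum/=.
  by have [->|/fK/h3 ->] := eqVneq (f x) 0; [rewrite mulr0|rewrite mul1r].
have h i : i \in s -> Ccin (U i) (fun x => (p i x)%:C%C * f x).
  by move=> /h1[_ /bump_Ccin pU]; apply: CcinMr => //; exact: Cc_continuous.
rewrite Ef; have : Cc (\sum_(i <- s) (fun x => (p i x)%:C%C * f x)) /\
    P (\sum_(i <- s) (fun x => (p i x)%:C%C * f x)); last by case.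
elim: s h1 h {Ef h3} => [|i s ih] h1 h.
  by rewrite big_nil; split => //; exact: Cc0.
rewrite big_cons; have [|//|sC Psum] := ih.
    by move=> j js; apply: h1; rewrite inE js orbT.
  by move=> j js; apply: h; rewrite inE js orbT.
have si : i \in i :: s by rewrite mem_head.
have iC : Cc (fun x => (p i x)%:C%C * f x) by exact: (Ccin_Cc G_hausdorff (h _ si)).
split; first exact: CcD.
by apply: PD => //; apply: (Ps (U i)); [have [] := h1 _ si|exact: h].
Qed.

Lemma Cc_fibre_finite f : Cc f -> fibre_finite f.
Proof.
move: f; apply: (Cc_ind bisection_basis).
- by move=> x; rewrite (_ : [set _ | _] = set0)//; apply/seteqP; split=> // a []; rewrite eqxx.
- by move=> f g _ _; exact: fibre_finiteD.
- move=> U f bU fU; apply: (fibre_finite_bisection bU) => b; exact: Ccin_out fU.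
Qed.

Lemma convolutionDl f g h : Cc f -> Cc g -> convolution (f + g) h = convolution f h + convolution g h.
Proof.
move=> /Cc_fibre_finite fC /Cc_fibre_finite gC; apply/funext => c.
change (convolution (f + g) h c = convolution f h c + convolution g h c).
rewrite !convolutionE.
have := fint_linearl (grange c) 1 (fun a => h (gmul (ginv a) c)) fC gC.
by rewrite !scale1r.
Qed.

Lemma fun_star_Ccin U f : Ccin U f -> Ccin (@ginv G @^-1` U) (fun_star f).
Proof.
move=> [fc [K [cK KU fK]]]; apply: (Ccin_intro (K := @ginv G @` K)).
- apply: continuous_conj => x.
  by apply: (continuous_at_comp (@ginv_continuous G x)); exact: fc.
- by apply: compact_image => //; exact: ginv_continuous.
- by move=> _ [a Ka <-]; rewrite /= ginvK; exact: KU.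
- move=> a; rewrite /fun_star conjC_eq0 => /fK Ka; exists (ginv a) => //.
  by rewrite ginvK.
Qed.

Lemma fun_star_Cc f : Cc f -> Cc (fun_star f).
Proof. by move=> /(CcinT G_hausdorff)/fun_star_Ccin/(Ccin_Cc G_hausdorff). Qed.

Lemma fun_starK f : fun_star (fun_star f) = f.
Proof. by apply/funext => a; rewrite /fun_star ginvK conjCK. Qed.

Lemma gcomposable_closed : closed (@gcomposable G).
Proof.
rewrite -[X in closed X]setCK; apply: open_closedC; rewrite openE => -[a b]/= ab.
have [A [B [oA oB Aa Bb AB]]] := hausdorff_separate G_hausdorff ab.
have nA : nbhs a (@gsource G @^-1` A).
  by apply: gsource_continuous; exact: open_nbhs_nbhs.
have nB : nbhs b (@grange G @^-1` B).
  by apply: grange_continuous; exact: open_nbhs_nbhs.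
exists (@gsource G @^-1` A, @grange G @^-1` B) => // -[a' b']/= [Aa' Bb'] e.
by apply: (AB (gsource a')) => //; rewrite e.
Qed.

Lemma compact_gmul (K L : set G) : compact K -> compact L ->
  compact [set gmul p.1 p.2 | p in (K `*` L) `&` @gcomposable G].
Proof.
move=> cK cL; apply: continuous_compact.
  apply: continuous_subspaceW (@gmul_continuous G); exact: subIsetr.
by apply: compact_closedI; [exact: compact_setX|exact: gcomposable_closed].
Qed.

(** Over a bisection, [f * g] is [c |-> f (sigma c) * g (sigma c ^-1 c)] where
    [sigma c] is the point of the bisection with the range of [c]. *)
Lemma convolution_continuous U f g : bisection U -> Ccin U f -> continuous g ->
  continuous (convolution f g).
Proof.
move=> bU fU gc; have fU0 b : ~ U b -> f b = 0 by exact: Ccin_out.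
have fc := Ccin_continuous fU.
suff key (c : G) : {for c, continuous (convolution f g)} by move=> c; exact: key.
have [[a [Ua ac]]|h] := pselect (exists a, U a /\ grange a = grange c); last first.
  apply: (@continuous_near _ _ _ (fun=> 0)); last exact: cst_continuous.
  have [K [cK KU fK]] := fU.2.
  have crK : closed (@grange G @` K).
    apply: (compact_closed G_hausdorff); apply: compact_image => //; exact: grange_continuous.
  have nrc : (~` (@grange G @` K)) (grange c) by move=> [b Kb bc]; apply: h; exists b; split => //; exact: KU.
  have : nbhs c (@grange G @^-1` (~` (@grange G @` K))).
    by apply: grange_continuous; apply: open_nbhs_nbhs; split => //; exact: closed_openC.
  apply: filterS => c' nc'; rewrite convolutionE; apply: fint_eq0 => b bc'.
  have [->|/fK Kb] := eqVneq (f b) 0; first by rewrite scale0r.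
  by exfalso; apply: nc'; exists b.
pose sigma c' := xget a [set b | U b /\ grange b = grange c'].
have sigmaP c' : (exists b, U b /\ grange b = grange c') ->
    U (sigma c') /\ grange (sigma c') = grange c'.
  move=> ex; rewrite /sigma; case: xgetP => [b -> //|nb].
  by have [b hb] := ex; have := nb b.
have sigmac : sigma c = a.
  have [Us sc] : U (sigma c) /\ grange (sigma c) = grange c by apply: sigmaP; exists a.
  by apply: (bisection_rinj bU) => //; rewrite sc.
have near_ex : \forall c' \near c, exists b, U b /\ grange b = grange c'.
  have : nbhs c (@grange G @^-1` (@grange G @` U)).
    apply: grange_continuous; apply: open_nbhs_nbhs; split; last by exists a.
    by apply: grange_open => //; case: bU.
  by apply: filterS => c' [b Ub bc']; exists b.
have sc : {for c, continuous sigma}.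
  move=> N; rewrite sigmac => Na.
  have h : nbhs c (@grange G @^-1` [set y | forall b, U b -> grange b = y -> N b]).
    by apply: grange_continuous; rewrite -ac; exact: bisection_section.
  apply: filterS2 near_ex h => c' ex h.
  by have [Us sc'] := sigmaP _ ex; exact: h.
have kc : {for c, continuous (fun c' => gmul (ginv (sigma c')) c')}.
  move=> N; rewrite /= sigmac => Nm.
  have [|A [B [nA nB AB]]] := gmul_cont_at (a := ginv a) (b := c) _ Nm.
    by rewrite gsource_inv.
  have h1 : nbhs c (sigma @^-1` (@ginv G @^-1` A)).
    by apply: sc; rewrite sigmac; exact: ginv_continuous.
  suff : \forall c' \near c, N (gmul (ginv (sigma c')) c') by [].
  near=> c'; have [_ sc'] : U (sigma c') /\ grange (sigma c') = grange c'.
    by apply: sigmaP; near: c'.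
  apply: AB; [|by near: c'|by rewrite gsource_inv].
  by near: c'.
apply: (@continuous_near _ _ _ (fun c' => f (sigma c') * g (gmul (ginv (sigma c')) c'))).
  apply: filterS near_ex => c' /sigmaP[Us sc'].
  by rewrite convolutionE (fint_bisection _ bU fU0 Us).
apply: continuousM; first exact: (continuous_at_comp sc (fc _)).
exact: (continuous_at_comp kc (gc _)).
Unshelve. all: by end_near. Qed.

Lemma convolution_support f g c : convolution f g c != 0 ->
  exists a, [/\ grange a = grange c, f a != 0 & g (gmul (ginv a) c) != 0].
Proof.
move=> h; apply: contrapT => nex; move/eqP: h; apply.
rewrite convolutionE; apply: fint_eq0 => a ac.
have [->|fa] := eqVneq (f a) 0; first by rewrite scale0r.
have [->|ga] := eqVneq (g (gmul (ginv a) c)) 0; first by rewrite scaler0.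
by exfalso; apply: nex; exists a.
Qed.

Lemma convolution_Cc f g : Cc f -> Cc g -> Cc (convolution f g).
Proof.
move=> fC gC; move: f fC; apply: (Cc_ind bisection_basis).
- have -> : convolution 0 g = 0 :> (G -> C); last exact: Cc0.
  by apply/funext => c; rewrite convolutionE fint_eq0// => a _; rewrite scale0r.
- by move=> f1 f2 C1 C2 h1 h2; rewrite convolutionDl//; exact: CcD.
move=> U f bU fU; apply: (@Ccin_Cc _ _ G_hausdorff setT).
have [K [cK KU fK]] := fU.2; have [L cL gL] := Cc_support G_hausdorff gC.
apply: (Ccin_intro _ (compact_gmul cK cL)) => //.
  by apply: (convolution_continuous bU fU); exact: Cc_continuous.
move=> c /convolution_support[a [ac /fK Ka /gL La]].
exists (a, gmul (ginv a) c) => /=; last by rewrite gmulVKg.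
by split => //; rewrite /gcomposable/= grange_divl.
Qed.

End Cc_groupoid.

(** * Inner products *)

(** The Cauchy-Schwarz and triangle inequalities are needed before a space of
    square-summable families is known to be normed, hence for a bare form. *)
Section positive_form.
Variables (R : realType) (U : lmodType R[i]) (f : U -> U -> R[i]) (n : U -> R).
Hypothesis fBl : forall u v w, f (u - v) w = f u w - f v w.
Hypothesis fZl : forall k u v, f (k *: u) v = k * f u v.
Hypothesis fC : forall u v, f u v = (f v u)^*.
Hypothesis fE : forall u, f u u = (n u ^+ 2)%:C%C.
Hypothesis n_ge0 : forall u, 0 <= n u.
Hypothesis n_eq0 : forall u, n u = 0 -> u = 0.

Lemma form_cauchy_schwarz u v : rnorm (f u v) <= n u * n v.
Proof.
have fBr w w1 w2 : f w (w1 - w2) = f w w1 - f w w2.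
  by rewrite fC fBl rmorphB (fC w w1) (fC w w2).
have fZr k w1 w2 : f w1 (k *: w2) = k^* * f w1 w2 by rewrite fC fZl rmorphM (fC w1 w2).
have [v0|v0] := eqVneq (n v) 0.
  by rewrite (n_eq0 v0) -(scale0r 0) fZr rmorph0 mul0r rnorm0 mulr_ge0.
have nv : 0 < n v by rewrite lt_neqAle n_ge0 andbT eq_sym.
(* the square norm of [m u - a v] is [m (m (n u)^2 - |a|^2)] *)
set a := f u v; set m := n v ^+ 2.
have m0 : 0 < m by rewrite exprn_gt0.
rewrite -(ler_pXn2r (ltn0Sn 1))// ?nnegrE ?rnorm_ge0 ?mulr_ge0//.
rewrite exprMn -/m -subr_ge0 -(pmulr_rge0 _ m0) -ler0c.
have := sqr_ge0 (n (m%:C%C *: u - a *: v)).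
rewrite -ler0c -fE fBl !fBr !fZl !fZr [f v u]fC -/a.
rewrite conjC_realc !fE -/m.
congr (_ <= _); rewrite [RHS]rmorphM [X in _ = _ * X]rmorphB/= rnorm_sqr [X in _ = _ * (X - _)]rmorphM/=; ring.
Qed.

Lemma form_triangle u v : n (u + v) <= n u + n v.
Proof.
rewrite -(ler_pXn2r (ltn0Sn 1))// ?nnegrE ?addr_ge0//.
have fBr w w1 w2 : f w (w1 - w2) = f w w1 - f w w2.
  by rewrite fC fBl rmorphB (fC w w1) (fC w w2).
have -> : n (u + v) ^+ 2 = n u ^+ 2 + 2 * complex.Re (f u v) + n v ^+ 2.
  apply: complexI; rewrite -fE -{1 2}(opprK v) fBl !fBr.
  have fNr w1 w2 : f w1 (- w2) = - f w1 w2 by rewrite -sub0r fBr -(scale0r 0) fC fZl mul0r rmorph0 sub0r.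
  have fNl w1 w2 : f (- w1) w2 = - f w1 w2 by rewrite fC fNr rmorphN (fC w1 w2).
  rewrite !fNr !fNl !fE [RHS]rmorphD [X in _ = X + _]rmorphD.
  rewrite [X in _ = _ + X + _]rmorphM/= rmorph_nat -addcJ -conjC_conjc (fC v u).
  by ring.
have := Re_le_rnorm (f u v); have := form_cauchy_schwarz u v.
by rewrite ler_norml => h /andP[_ h2]; nra.
Qed.

End positive_form.

Section hilbert_theory.
Variables (R : realType) (H : hilbertType R).
Local Notation C := R[i].
Implicit Types u v w : H.

Lemma hdotDl u v w : hdot (u + v) w = hdot u w + hdot v w.
Proof. exact: linearDl. Qed.
Lemma hdotDr u v w : hdot u (v + w) = hdot u v + hdot u w.
Proof. exact: linearDr. Qed.
Lemma hdotBl u v w : hdot (u - v) w = hdot u w - hdot v w.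
Proof. exact: linearBl. Qed.
Lemma hdotBr u v w : hdot u (v - w) = hdot u v - hdot u w.
Proof. exact: linearBr. Qed.
Lemma hdotZl (k : C) u v : hdot (k *: u) v = k * hdot u v.
Proof. exact: linearZl_LR. Qed.
Lemma hdotZr (k : C) u v : hdot u (k *: v) = k^* * hdot u v.
Proof. exact: linearZr_LR. Qed.
Lemma hdot0l u : hdot 0 u = 0. Proof. exact: linear0l. Qed.
Lemma hdot0r u : hdot u 0 = 0. Proof. exact: linear0r. Qed.
Lemma hdot_suml I (r : seq I) (P : pred I) (F : I -> H) u :
  hdot (\sum_(i <- r | P i) F i) u = \sum_(i <- r | P i) hdot (F i) u.
Proof. exact: linear_sumlz. Qed.
Lemma hdot_sumr I (r : seq I) (P : pred I) (F : I -> H) u :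
  hdot u (\sum_(i <- r | P i) F i) = \sum_(i <- r | P i) hdot u (F i).
Proof. exact: linear_sumr. Qed.
Lemma hdotC u v : hdot u v = (hdot v u)^*.
Proof. by have := hermC (@hdot R H) u v; rewrite expr0 mul1r. Qed.
Lemma hdotE u : hdot u u = (rnorm u ^+ 2)%:C%C.
Proof. by rewrite hdot_norm rnormE rmorphXn. Qed.

Lemma cauchy_schwarz u v : rnorm (hdot u v) <= rnorm u * rnorm v.
Proof.
by apply: form_cauchy_schwarz; [exact: hdotBl|exact: hdotZl|exact: hdotC|
  exact: hdotE|exact: rnorm_ge0|exact: rnorm_eq0].
Qed.

(** Polarization: the scalar products are recovered from norms, so that a family
    of them is summable as soon as families of squared norms are. *)
Lemma polarization (i : C) u v : i^* = - i -> i * i = -1 -> hdot u v =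
  4%:R^-1 * ((rnorm (u + v) ^+ 2)%:C%C - (rnorm (u - v) ^+ 2)%:C%C
  + i * ((rnorm (u + i *: v) ^+ 2)%:C%C - (rnorm (u - i *: v) ^+ 2)%:C%C)).
Proof.
move=> ci i2.
rewrite -!hdotE !(hdotBl, hdotBr) !(hdotDl, hdotDr) !(hdotZl, hdotZr) ci.
apply: (@mulfI _ 4%:R); first by rewrite pnatr_eq0.
rewrite mulrA mulfV ?pnatr_eq0// mul1r.
set a := hdot u u; set b := hdot u v; set c := hdot v u; set d := hdot v v.
transitivity (2%:R * b + 2%:R * c + (i * i) * (2%:R * c - 2%:R * b)); last by ring.
by rewrite i2; ring.
Qed.

Lemma parallelogram_le u v :
  rnorm (u + v) ^+ 2 <= 2 * (rnorm u ^+ 2 + rnorm v ^+ 2).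
Proof.
have h := rnormD u v; have := rnorm_ge0 (u + v).
have := sqr_ge0 (rnorm u - rnorm v); nra.
Qed.

End hilbert_theory.

(** * Bounds valid in every representation *)

Section unit_functions.
Variables (R : realType) (G : topologicalGroupoidType).
Hypothesis G_etale : etale G.
Local Notation C := R[i].
Implicit Types (f g : G -> C) (a b c x : G) (U : set G).

Lemma convolution_unitl f g c : (forall a, ~ gunits a -> f a = 0) ->
  convolution f g c = f (grange c) * g c.
Proof.
move=> fu; rewrite convolutionE.
rewrite (fint_bisection _ (bisection_units G_etale) fu (gunits_range c)) ?grange_grange//.
by rewrite (gunits_inv (gunits_range c)) grangel.
Qed.

Lemma convolution_unitr f g c : (forall a, ~ gunits a -> g a = 0) ->
  convolution f g c = f c * g (gsource c).
Proof.
move=> gu; rewrite convolutionE (fint_single (a := c))// => b bc bnc.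
rewrite gu ?scaler0// => u; move/eqP: bnc; apply.
by rewrite -[RHS](gmulVKg bc) -(gunits_grange u) grange_divl// gsourcer.
Qed.

Lemma convolution_starE f g c : convolution f (fun_star g) c =
  fint (grange c) f (fun a => (g (gmul (ginv c) a))^* : C).
Proof.
rewrite convolutionE; apply: eq_fint => a ac.
by rewrite /fun_star gmul_Vr.
Qed.

(** Two points of a bisection with the same source are equal, so that [c = a b^-1]
    with [a] and [b] in the bisection is a unit. *)
Lemma convolution_star_off U f g c : bisection U ->
  (forall a, ~ U a -> f a = 0) -> (forall a, ~ U a -> g a = 0) ->
  ~ gunits c -> convolution f (fun_star g) c = 0.
Proof.
move=> bU fU gU nc; rewrite convolution_starE; apply: fint_eq0 => a ac.
have [Ua|/fU ->] := pselect (U a); last by rewrite scale0r.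
have [Ub|/gU ->] := pselect (U (gmul (ginv c) a)); last by rewrite rmorph0 scaler0.
have e : a = gmul (ginv c) a by apply: (bisection_sinj bU) => //; rewrite gsource_divl.
exfalso; apply: nc; rewrite -[c]ginvK -(gmulgK (a := ginv c) (b := a)); last by rewrite gsource_inv.
by rewrite -e gmulgV gunits_inv; exact: gunits_range.
Qed.

Lemma convolution_star_diag (x : G) f : gunits x ->
  convolution f (fun_star f) x = fint x f (fun a => (f a)^* : C).
Proof.
move=> ux; rewrite convolution_starE gunits_grange//; apply: eq_fint => a ax.
by rewrite gunits_inv// -ax grangel.
Qed.

Lemma convolution_star_bisection U f x a : bisection U ->
  (forall b, ~ U b -> f b = 0) -> U a -> grange a = x ->
  convolution f (fun_star f) x = (rnorm (f a) ^+ 2)%:C%C.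
Proof.
move=> bU fU Ua <-; rewrite convolution_star_diag; last exact: gunits_range.
by rewrite (fint_bisection _ bU fU Ua)// rnorm_sqr.
Qed.

Lemma convolution_star_bisection0 U f x :
  (forall b, ~ U b -> f b = 0) -> gunits x -> (forall a, U a -> grange a <> x) ->
  convolution f (fun_star f) x = 0.
Proof.
move=> fU ux h; rewrite convolution_star_diag//; apply: fint_eq0 => a ax.
by have [/h//|/fU ->] := pselect (U a); rewrite scale0r.
Qed.

(** By [convolution_star_off] only units matter, and the value at a unit is [|f a|^2]
    for the one [a] of the bisection with this range, if there is one. *)
Lemma convolution_star_real U f (M : R) : bisection U -> (forall b, ~ U b -> f b = 0) ->
  (forall a, rnorm (f a) <= M) -> exists2 p : G -> R,
  convolution f (fun_star f) = (fun x => (p x)%:C%C) & forall x, 0 <= p x <= M ^+ 2.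
Proof.
move=> bU fU fM; have M2 : 0 <= M ^+ 2 by rewrite sqr_ge0.
have h x : exists p, convolution f (fun_star f) x = (p%:C%C : C) /\ 0 <= p <= M ^+ 2.
  have [ux|nu] := pselect (gunits x); last first.
    by exists 0; rewrite (convolution_star_off bU fU fU nu) lexx.
  have [[a [Ua ax]]|nex] := pselect (exists a, U a /\ grange a = x); last first.
    exists 0; rewrite (convolution_star_bisection0 fU ux) ?lexx//.
    by move=> a Ua ax; apply: nex; exists a.
  exists (rnorm (f a) ^+ 2); rewrite (convolution_star_bisection bU fU Ua ax); split => //.
  have M0 : 0 <= M by exact: le_trans (rnorm_ge0 (f a)) (fM a).
  by rewrite sqr_ge0/= ler_pXn2r ?nnegrE ?rnorm_ge0.
have [p hp] := choice h; exists p; last by move=> x; have [] := hp x.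
by apply/funext => x; have [] := hp x.
Qed.

End unit_functions.

Section representation_bounds.
Variables (R : realType) (G : topologicalGroupoidType).
Hypothesis G_etale : etale G.
Hypothesis G_hausdorff : hausdorff_space G.
Hypothesis G_lc : locally_compact [set: G].
Local Notation C := R[i].
Implicit Types (f g : G -> C) (a b c x : G) (U : set G).

Section one_representation.
Variables (H : hilbertType R) (pi : (G -> C) -> {linear H -> H}).
Hypothesis pi_rep : star_representation pi.

Lemma rep_linear (k : C) f g v : Cc f -> Cc g -> pi (k *: f + g) v = k *: pi f v + pi g v.
Proof. by case: pi_rep => _ h _ _ fC gC; exact: h. Qed.

Lemma repD f g v : Cc f -> Cc g -> pi (f + g) v = pi f v + pi g v.
Proof. by move=> fC gC; rewrite -[f]scale1r rep_linear// !scale1r. Qed.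

Lemma rep0 v : pi 0 v = 0.
Proof.
by apply: (addIr (pi 0 v)); rewrite -repD ?addr0 ?add0r//; exact: Cc0.
Qed.

Lemma repZ (k : C) f v : Cc f -> pi (k *: f) v = k *: pi f v.
Proof. by move=> fC; rewrite -[k *: f]addr0 rep_linear// ?rep0 ?addr0//; exact: Cc0. Qed.

Lemma repB f g v : Cc f -> Cc g -> pi (f - g) v = pi f v - pi g v.
Proof. by move=> fC gC; rewrite -scaleN1r addrC rep_linear// scaleN1r addrC. Qed.

Lemma rep_sum I (r : seq I) (P : pred I) (F : I -> G -> C) v :
  (forall i, P i -> Cc (F i)) ->
  pi (\sum_(i <- r | P i) F i) v = \sum_(i <- r | P i) pi (F i) v.
Proof.
move=> FC; elim: r => [|i r ih]; first by rewrite !big_nil rep0.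
rewrite !big_cons; case: ifPn => // Pi; rewrite repD ?ih//; first exact: FC.
exact: Cc_sum.
Qed.

Lemma repM f g v : Cc f -> Cc g -> pi (convolution f g) v = pi f (pi g v).
Proof. by case: pi_rep => _ _ h _ fC gC; exact: h. Qed.

Lemma rep_star f v w : Cc f -> hdot (pi f v) w = hdot v (pi (fun_star f) w).
Proof. by case: pi_rep => _ _ _ h fC; exact: h. Qed.

Lemma rep_star_norm f v : Cc f ->
  hdot (pi (convolution (fun_star f) f) v) v = (rnorm (pi f v) ^+ 2)%:C%C.
Proof.
move=> fC; have sC : Cc (fun_star f) by exact: fun_star_Cc.
by rewrite repM// rep_star// fun_starK hdotE.
Qed.

Local Notation toC p := (fun x => (p x)%:C%C : C).

Lemma unit_star (p : G -> R) : (forall x, ~ gunits x -> p x = 0) ->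
  fun_star (toC p) = toC p.
Proof.
move=> pu; apply/funext => x; rewrite /fun_star conjC_realc.
have [ux|nux] := pselect (gunits x); first by rewrite gunits_inv.
rewrite (pu _ nux) pu// => u; apply: nux.
by rewrite -[x]ginvK gunits_inv.
Qed.

Lemma unit_mul (p q : G -> R) : (forall x, ~ gunits x -> p x = 0) ->
  (forall x, ~ gunits x -> q x = 0) ->
  convolution (toC p) (toC q) = toC (fun x => p x * q x).
Proof.
move=> pu qu; apply/funext => x; rewrite (convolution_unitl G_etale); last by move=> a /pu ->.
have [ux|nux] := pselect (gunits x); first by rewrite gunits_grange// rmorphM.
by rewrite (qu _ nux) !mulr0.
Qed.

(** A nonnegative function on the units is [q^* * q], with [q] its square root. *)
Lemma rep_unit_ge0 (p : G -> R) v : Ccin (@gunits G) (toC p) -> (forall x, 0 <= p x) ->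
  0 <= hdot (pi (toC p) v) v.
Proof.
move=> pC p0; pose q x := Num.sqrt (p x).
have pc := continuous_realC_inv (Ccin_continuous pC).
have qC : Ccin (@gunits G) (toC q).
  split; first by apply: realC_continuous => x; apply: (continuous_at_comp (pc x)); exact: sqrt_continuous.
  by apply: supported_in_sub pC.2 => x; apply: contra_neq => /complexI px; rewrite /q px sqrtr0.
have qu x : ~ gunits x -> q x = 0 by move=> nu; apply: complexI; exact: (Ccin_out qC).
have qCc : Cc (toC q) by exact: Ccin_Cc qC.
have -> : toC p = convolution (fun_star (toC q)) (toC q).
  by rewrite unit_star// unit_mul//; apply/funext => x; rewrite -expr2 sqr_sqrtr.
by rewrite rep_star_norm// ler0c sqr_ge0.
Qed.

(** For [0 <= p <= B] one has [p^2 <= B p], so that [|pi(p) v|^2 <= B |pi(p) v| |v|]. *)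
Lemma rep_unit_bound (p : G -> R) (B : R) v : Ccin (@gunits G) (toC p) ->
  0 <= B -> (forall x, 0 <= p x <= B) -> rnorm (pi (toC p) v) <= B * rnorm v.
Proof.
move=> pC B0 pB; have p0 x : 0 <= p x by have /andP[] := pB x.
have pu x : ~ gunits x -> p x = 0 by move=> nu; apply: complexI; exact: (Ccin_out pC).
have pCc : Cc (toC p) by exact: Ccin_Cc pC.
have pcont := Ccin_continuous pC.
have h : 0 <= hdot (pi (toC (fun x => B * p x - p x * p x)) v) v.
  apply: rep_unit_ge0; last by move=> x; have /andP[h1 h2] := pB x; nra.
  have -> : toC (fun x => B * p x - p x * p x) =
      B%:C%C *: toC p - (fun x => toC p x * toC p x).
    by apply/funext => x; rewrite rmorphB !rmorphM.
  by rewrite -scaleN1r; apply: CcinD; [exact: CcinZ|apply: CcinZ; exact: CcinMl].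
have E : toC (fun x => B * p x - p x * p x) =
    B%:C%C *: toC p - convolution (fun_star (toC p)) (toC p).
  by rewrite unit_star// unit_mul//; apply/funext => x; rewrite rmorphB [X in X - _]rmorphM.
have sC := fun_star_Cc G_hausdorff pCc.
have cC : Cc (convolution (fun_star (toC p)) (toC p)) by exact: convolution_Cc.
have BC : Cc (B%:C%C *: toC p) by exact: CcZ.
move: h; rewrite E (repB _ BC cC) repZ// hdotBl hdotZl rep_star_norm//.
have := cauchy_schwarz (pi (toC p) v) v; have := Re_le_rnorm (hdot (pi (toC p) v) v).
move=> h1 h2; rewrite lecE => /andP[_].
have -> : complex.Re (B%:C%C * hdot (pi (toC p) v) v - (rnorm (pi (toC p) v) ^+ 2)%:C%C) =
   B * complex.Re (hdot (pi (toC p) v) v) - rnorm (pi (toC p) v) ^+ 2.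
  by case: (hdot _ _) => a b /=; rewrite !mul0r subr0.
rewrite /= => h3; have := rnorm_ge0 (pi (toC p) v); have := rnorm_ge0 v.
move: h1; rewrite ler_norml => /andP[_ h1] v0.
rewrite le_eqVlt => /predU1P[<-|w0]; first by rewrite mulr_ge0.
rewrite -(ler_pM2r w0); nra.
Qed.

Lemma rep_unit_dot (p : G -> R) v : Ccin (@gunits G) (toC p) ->
  (forall x, 0 <= p x <= 1) -> complex.Re (hdot (pi (toC p) v) v) <= rnorm v ^+ 2.
Proof.
move=> pC pB; rewrite (le_trans (ler_norm _))// (le_trans (Re_le_rnorm _))//.
rewrite (le_trans (cauchy_schwarz _ _))// expr2 ler_wpM2r ?rnorm_ge0//.
by rewrite -[leRHS]mul1r rep_unit_bound.
Qed.

(** [|pi(f) v|^2] is the inner product of [pi(f^* * f) v] with [v], and [f^* * f] is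
    a function on the units with values in [[0, M^2]]. *)
Lemma rep_bisection U f (M : R) v : bisection U -> Ccin U f -> 0 <= M ->
  (forall a, rnorm (f a) <= M) -> rnorm (pi f v) <= M * rnorm v.
Proof.
move=> bU fU M0 fM; have fC := Ccin_Cc G_hausdorff fU; have sC := fun_star_Cc G_hausdorff fC.
have fU0 a : ~ U a -> f a = 0 by exact: Ccin_out.
have bV := bisection_inv bU.
have sU := fun_star_Ccin fU.
have sU0 a : ~ (@ginv G @^-1` U) a -> fun_star f a = 0 by exact: Ccin_out.
have [|p Ep pM] := convolution_star_real bV sU0 (M := M).
  by move=> a; rewrite /fun_star rnorm_conj.
rewrite fun_starK in Ep.
have pC : Ccin (@gunits G) (toC p).
  rewrite -Ep; apply: Ccin_units => // [|x nu]; first exact: convolution_Cc.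
  by rewrite -{2}[f]fun_starK (convolution_star_off bV sU0 sU0 nu).
rewrite -(ler_pXn2r (ltn0Sn 1))// ?nnegrE ?mulr_ge0 ?rnorm_ge0//.
rewrite -lecR -rep_star_norm// Ep.
have h0 : 0 <= hdot (pi (toC p) v) v by apply: rep_unit_ge0 => // x; have /andP[] := pM x.
rewrite -(RRe_real (ger0_real h0)) lecR (le_trans (ler_norm _))// (le_trans (Re_le_rnorm _))//.
rewrite (le_trans (cauchy_schwarz _ _))//.
have -> : (M * rnorm v) ^+ 2 = M ^+ 2 * rnorm v * rnorm v by ring.
by rewrite ler_wpM2r ?rnorm_ge0// rep_unit_bound// sqr_ge0.
Qed.

End one_representation.

(** A compact set is covered by finitely many bisections, whose number bounds
    all representations uniformly. *)
Lemma rep_compact_bound (K : set G) : compact K -> exists2 n : R, 0 <= n &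
  forall f (M : R), 0 <= M -> Cc f -> (forall a, f a != 0 -> K a) -> (forall a, rnorm (f a) <= M) ->
  forall (H : hilbertType R) (pi : (G -> C) -> {linear H -> H}) v,
  star_representation pi -> rnorm (pi f v) <= n * M * rnorm v.
Proof.
move=> cK.
have [s [U [p [h1 _ h3]]]] := small_partition R G_hausdorff G_lc (bisection_basis G_etale) cK.
exists (size s)%:R => // f M M0 fC fK fM H pi v pi_rep.
have Ef : f = \sum_(i <- s | i \in s) (fun x => (p i x)%:C%C * f x).
  apply/funext => x; rewrite -big_seq fct_sumE -mulr_suml -rmorph_sum/=.
  by have [->|/fK/h3 ->] := eqVneq (f x) 0; [rewrite mulr0|rewrite mul1r].
have hC i : i \in s -> Ccin (U i) (fun x => (p i x)%:C%C * f x).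
  by move=> /h1[_ /bump_Ccin pU]; apply: CcinMr => //; exact: Cc_continuous.
rewrite {1}Ef (rep_sum pi_rep); last by move=> i /hC; exact: Ccin_Cc.
rewrite (le_trans (rnorm_sum _ _ _))//.
rewrite (@le_trans _ _ (\sum_(i <- s | i \in s) M * rnorm v))//; last first.
  by rewrite -big_seq big_const_seq count_predT iter_addr_0 -[leLHS]mulr_natl mulrA.
apply: ler_sum => i si; have [bU [_ p0 p1 _]] := h1 _ si.
apply: (rep_bisection pi_rep _ bU (hC _ si) M0) => a.
rewrite rnormM rnormC ger0_norm// (le_trans _ (fM a))//.
by rewrite -[leRHS]mul1r ler_wpM2r ?rnorm_ge0.
Qed.

End representation_bounds.

(** * Square-summable families *)

Notation totally := summability.totally.
#[global] Existing Instance summability.totally_filter.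

Section finite_sums.
Variables (R : realType) (X : choiceType).
Local Notation C := R[i].
Local Open Scope fset_scope.

Lemma totally_above (F : {fset X}) : totally [set F' : {fset X} | F `<=` F'].
Proof. by exists F. Qed.

Lemma sum_fset_le (f : X -> R) (F F' : {fset X}) : (forall x, 0 <= f x) ->
  F `<=` F' -> \sum_(x <- F) f x <= \sum_(x <- F') f x.
Proof.
move=> f0 FF'; rewrite [leRHS](big_fsetID _ (mem F))/=.
have -> : [fset x in F' | x \in F] = F.
  by apply/fsetP => x; rewrite !inE/= andbC; case: (boolP (x \in F)) => // /(fsubsetP FF').
by rewrite lerDl sumr_ge0.
Qed.

(** The net of sums over finite sets is monotone, so that it converges to its
    supremum. *)
Lemma cvg_sum_ge0 (f : X -> R) (B : R) : (forall x, 0 <= f x) ->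
  (forall F : {fset X}, \sum_(x <- F) f x <= B) ->
  exists2 s, (fun F : {fset X} => \sum_(x <- F) f x) @ totally --> s &
     s <= B /\ forall F : {fset X}, \sum_(x <- F) f x <= s.
Proof.
move=> f0 fB; pose S := range (fun F : {fset X} => \sum_(x <- F) f x).
have S0 : S (\sum_(x <- fset0) f x) by exists fset0.
have hS : has_sup S by split; [exists (\sum_(x <- fset0) f x)|exists B => _ [F _ <-]].
have leS (F : {fset X}) : \sum_(x <- F) f x <= sup S.
  by apply: ub_le_sup; [exact: hS.2 | exists F].
exists (sup S); last first.
  by split => //; apply: sup_le_ub; [exact: hS.1 | move=> _ [F _ <-]].
apply/cvgrPdist_lt => e e0.
have [s [F _ Fs] hF] := sup_adherent e0 hS; rewrite -{}Fs in hF.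
apply: filterS (totally_above F) => F' FF'.
have := sum_fset_le f0 FF'; have := leS F' => h1 h2.
by rewrite ger0_norm; lra.
Qed.

Lemma cvg_realc T (F : set_system T) {FF : Filter F} (f : T -> R) (l : R) :
  f @ F --> l -> (fun t => (f t)%:C%C : C) @ F --> (l%:C%C : C).
Proof. by move=> fl; apply: (cvg_comp _ _ fl); exact: continuous_realc. Qed.

End finite_sums.

Section square_summable.
Variables (R : realType) (X : choiceType) (H : hilbertType R).
Local Notation C := R[i].
Implicit Types z w : X -> H.

Definition square_summable z : Prop :=
  exists B : R, forall F : {fset X}, \sum_(x <- F) rnorm (z x) ^+ 2 <= B.

Definition l2_pred : {pred X -> H} := fun z => `[< square_summable z >].

Lemma l2_submod_closed : submod_closed l2_pred.
Proof.
split=> [|k z w /asboolP[Bz hz] /asboolP[Bw hw]]; apply/asboolP.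
  by exists 0 => F; rewrite big1// => x _; rewrite rnorm0 expr0n.
exists (2 * (rnorm k ^+ 2 * Bz + Bw)) => F.
rewrite (@le_trans _ _ (\sum_(x <- F) 2 * (rnorm k ^+ 2 * rnorm (z x) ^+ 2 + rnorm (w x) ^+ 2)))//.
  by apply: ler_sum => x _; rewrite (le_trans (parallelogram_le _ _))// rnormZ exprMn.
by rewrite -mulr_sumr big_split/= -mulr_sumr ler_wpM2l// lerD// ler_wpM2l ?sqr_ge0.
Qed.

HB.instance Definition _ :=
  GRing.isSubmodClosed.Build C (X -> H) l2_pred l2_submod_closed.

Record l2 := L2 { l2val :> X -> H; l2P : l2val \in l2_pred }.
HB.instance Definition _ := [isSub for l2val].
HB.instance Definition _ := [Choice of l2 by <:].
HB.instance Definition _ := [SubChoice_isSubLmodule of l2 by <:].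

Implicit Types a b : l2.

Lemma l2_bounded a : square_summable a.
Proof. by have /asboolP := l2P a. Qed.

Lemma l2B a b x : (a - b) x = a x - b x. Proof. by []. Qed.

Lemma l2_ext a b : (forall x, a x = b x) -> a = b.
Proof. by move=> ab; apply/val_inj/funext. Qed.

Definition dot_sum a b : {fset X} -> C :=
  fun F => \sum_(x <- F) hdot (a x) (b x).

Lemma cvg_norm_sum a : exists2 s,
  (fun F : {fset X} => \sum_(x <- F) rnorm (a x) ^+ 2) @ totally --> s &
  forall F : {fset X}, \sum_(x <- F) rnorm (a x) ^+ 2 <= s.
Proof.
have [B aB] := l2_bounded a.
have [x|s as_ [_ h]] := cvg_sum_ge0 _ aB; first by rewrite sqr_ge0.
by exists s.
Qed.

Lemma dot_sum_cvg a b : exists l : C, dot_sum a b @ totally --> l.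
Proof.
have [s1 h1 _] := cvg_norm_sum (a + b).
have [s2 h2 _] := cvg_norm_sum (a - b).
have [s3 h3 _] := cvg_norm_sum (a + 'i *: b).
have [s4 h4 _] := cvg_norm_sum (a - 'i *: b).
exists (4%:R^-1 * (s1%:C%C - s2%:C%C + 'i * (s3%:C%C - s4%:C%C))).
have -> : dot_sum a b = fun F : {fset X} => 4%:R^-1 *
    (((\sum_(x <- F) rnorm ((a + b) x) ^+ 2)%:C%C - (\sum_(x <- F) rnorm ((a - b) x) ^+ 2)%:C%C)
  + 'i * ((\sum_(x <- F) rnorm ((a + 'i *: b) x) ^+ 2)%:C%C
          - (\sum_(x <- F) rnorm ((a - 'i *: b) x) ^+ 2)%:C%C)).
  apply/funext => F; rewrite /dot_sum !rmorph_sum/= -!sumrB mulr_sumr -big_split mulr_sumr.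
  apply: eq_bigr => x _; rewrite (@polarization _ _ ('i : C))//.
    exact: conjCi.
  by rewrite -expr2 sqrCi.
exact: (cvgMl_tmp (cvgD (cvgB (cvg_realc h1) (cvg_realc h2))
  (cvgMl_tmp (cvgB (cvg_realc h3) (cvg_realc h4))))).
Qed.

Definition l2dot a b : C := lim (dot_sum a b @ totally).

Lemma l2dotP a b : dot_sum a b @ totally --> l2dot a b.
Proof. by have [l h] := dot_sum_cvg a b; apply/cvg_ex; exists l. Qed.

Lemma l2dot_unique a b (l : C) : dot_sum a b @ totally --> l -> l2dot a b = l.
Proof. by move=> h; apply: cvg_lim. Qed.

Lemma l2dotPl k a b c : l2dot (k *: a + b) c = k * l2dot a c + l2dot b c.
Proof.
apply: l2dot_unique.
have -> : dot_sum (k *: a + b) c = (fun F => k * dot_sum a c F + dot_sum b c F).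
  apply/funext => F; rewrite /dot_sum.
  change (\sum_(x <- F) hdot ((k *: a + b) x) (c x) =
    k * (\sum_(x <- F) hdot (a x) (c x)) + \sum_(x <- F) hdot (b x) (c x)).
  rewrite mulr_sumr -big_split.
  by apply: eq_bigr => x _; rewrite /= hdotDl hdotZl.
exact: (cvgD (cvgMl_tmp (@l2dotP a c)) (@l2dotP b c)).
Qed.

Lemma l2dotC a b : l2dot a b = (l2dot b a)^*.
Proof.
apply: l2dot_unique.
have -> : dot_sum a b = (fun F => (dot_sum b a F)^*).
  by apply/funext => F; rewrite /dot_sum rmorph_sum; apply: eq_bigr => x _; rewrite hdotC.
by apply: (cvg_comp _ _ (@l2dotP b a)); exact: continuous_conjC.
Qed.

Lemma l2dotDl a b c : l2dot (a + b) c = l2dot a c + l2dot b c.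
Proof. by rewrite -[a]scale1r l2dotPl mul1r scale1r. Qed.

Lemma l2dot0l c : l2dot 0 c = 0.
Proof. by apply: (addIr (l2dot 0 c)); rewrite -l2dotDl addr0 add0r. Qed.

Lemma l2dotZl k a c : l2dot (k *: a) c = k * l2dot a c.
Proof. by rewrite -[k *: a]addr0 l2dotPl l2dot0l addr0. Qed.

Lemma l2dotBl a b c : l2dot (a - b) c = l2dot a c - l2dot b c.
Proof. by rewrite -scaleN1r addrC l2dotPl mulN1r addrC. Qed.

Lemma l2dotPr k a b c : l2dot c (k *: a + b) = k^* * l2dot c a + l2dot c b.
Proof. by rewrite l2dotC l2dotPl rmorphD rmorphM (l2dotC c a) (l2dotC c b). Qed.

Lemma l2dotZr k a c : l2dot c (k *: a) = k^* * l2dot c a.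
Proof. by rewrite l2dotC l2dotZl rmorphM (l2dotC c a). Qed.

Definition l2norm a : R := Num.sqrt (complex.Re (l2dot a a)).

Lemma l2norm_ge0 a : 0 <= l2norm a. Proof. exact: sqrtr_ge0. Qed.

Lemma l2norm_spec a : [/\ l2dot a a = (l2norm a ^+ 2)%:C%C,
  forall F : {fset X}, \sum_(x <- F) rnorm (a x) ^+ 2 <= l2norm a ^+ 2 &
  (fun F : {fset X} => \sum_(x <- F) rnorm (a x) ^+ 2) @ totally --> l2norm a ^+ 2].
Proof.
have [s as_ hs] := cvg_norm_sum a.
have E : l2dot a a = s%:C%C.
  apply: l2dot_unique.
  have -> : dot_sum a a = fun F : {fset X} => (\sum_(x <- F) rnorm (a x) ^+ 2)%:C%C.
    apply/funext => F; rewrite /dot_sum rmorph_sum/=.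
    by apply: eq_bigr => x _; rewrite hdotE.
  exact: cvg_realc.
have s0 : 0 <= s by have := hs fset0; rewrite big_seq_fset0.
have En : l2norm a ^+ 2 = s by rewrite /l2norm E/= sqr_sqrtr.
by rewrite En.
Qed.

Lemma l2dotE a : l2dot a a = (l2norm a ^+ 2)%:C%C.
Proof. by have [] := l2norm_spec a. Qed.

Lemma l2norm_sum a (F : {fset X}) :
  \sum_(x <- F) rnorm (a x) ^+ 2 <= l2norm a ^+ 2.
Proof. by have [] := l2norm_spec a. Qed.

Lemma l2norm_le a (B : R) : 0 <= B ->
  (forall F : {fset X}, \sum_(x <- F) rnorm (a x) ^+ 2 <= B ^+ 2) -> l2norm a <= B.
Proof.
move=> B0 aB; rewrite -(ler_pXn2r (ltn0Sn 1))// ?nnegrE ?l2norm_ge0//.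
have [_ _ h] := l2norm_spec a.
apply: (cvgr_to_le h); exact: filterE.
Qed.

Lemma l2norm_eq0 a : l2norm a = 0 -> a = 0.
Proof.
move=> a0; apply: l2_ext => x; apply: rnorm_eq0.
have := l2norm_sum a [fset x]%fset; rewrite big_seq_fset1 a0 expr0n/=.
by have := rnorm_ge0 (a x); nra.
Qed.

Definition l2normC a : C := (l2norm a)%:C%C.

Lemma l2normCD a b : l2normC (a + b) <= l2normC a + l2normC b.
Proof.
rewrite -rmorphD lecR; apply: (@form_triangle _ _ l2dot).
- exact: l2dotBl.
- exact: l2dotZl.
- exact: l2dotC.
- exact: l2dotE.
- exact: l2norm_ge0.
- exact: l2norm_eq0.
Qed.

Lemma l2normCZ k a : l2normC (k *: a) = `|k| * l2normC a.
Proof.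
rewrite rnormE -rmorphM; congr (_%:C)%C.
apply: (@pexpIrn _ 2) => //; rewrite ?nnegrE ?mulr_ge0 ?l2norm_ge0 ?rnorm_ge0//.
apply: complexI; rewrite -l2dotE l2dotZl l2dotZr l2dotE.
by rewrite mulrA -rnorm_sqr exprMn [RHS]rmorphM.
Qed.

Lemma l2normC_eq0 a : l2normC a = 0 -> a = 0.
Proof. by move=> /complexI/l2norm_eq0. Qed.

HB.instance Definition _ :=
  Lmodule_isNormed.Build C l2 l2normCD l2normCZ l2normC_eq0.

Lemma l2_rnorm_sum a (F : {fset X}) :
  \sum_(x <- F) rnorm (a x) ^+ 2 <= rnorm a ^+ 2.
Proof. exact: l2norm_sum. Qed.

Lemma l2_rnorm_le a (B : R) : 0 <= B ->
  (forall F : {fset X}, \sum_(x <- F) rnorm (a x) ^+ 2 <= B ^+ 2) -> rnorm a <= B.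
Proof. exact: l2norm_le. Qed.

Lemma l2_eval_le a x : rnorm (a x) <= rnorm a.
Proof.
rewrite -(ler_pXn2r (ltn0Sn 1))// ?nnegrE ?rnorm_ge0//.
by have := l2_rnorm_sum a [fset x]%fset; rewrite big_seq_fset1.
Qed.

(** The limit is taken coordinate by coordinate; the estimates on finite sets of
    coordinates pass to the limit and do not depend on the finite set. *)
Lemma l2_complete : Uniform_isComplete l2.
Proof.
constructor => F FF /cauchy_rnormP Fc.
pose ev x : set_system H := (fun a : l2 => a x) @ F.
have evc x : cvg (ev x).
  apply: cauchy_cvg; apply/cauchy_rnormP => e e0; have [A FA hA] := Fc e e0.
  exists ((fun a : l2 => a x) @` A).
    have h : F ((fun a : l2 => a x) @^-1` ((fun a : l2 => a x) @` A)).
      by apply: (filterS _ FA) => a Aa; exists a.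
    exact: h.
  by move=> _ _ [a Aa <-] [b Ab <-]; rewrite -l2B (le_lt_trans (l2_eval_le _ _))// hA.
pose z x : H := lim (ev x).
have zP x : (fun a : l2 => a x) @ F --> z x by exact: evc.
have key (e : R) : 0 < e -> exists2 A : set l2, F A &
    forall a, A a -> forall S : {fset X}, \sum_(x <- S) rnorm (a x - z x) ^+ 2 <= e ^+ 2.
  move=> e0; have [A FA hA] := Fc _ e0; exists A => // a Aa S.
  have h : (fun b : l2 => \sum_(x <- S) rnorm (a x - b x) ^+ 2) @ F -->
      (\sum_(x <- S) rnorm (a x - z x) ^+ 2 : R).
    apply: cvg_big => [|x _]; first exact: add_continuous.
    have h1 : (fun b : l2 => rnorm (a x - b x)) @ F --> rnorm (a x - z x).
      apply: (@cvg_comp _ _ _ (fun b : l2 => a x - b x) (@rnorm R H)); last exact: continuous_rnorm.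
      by apply: cvgB; [exact: cvg_cst|exact: zP].
    by apply: (@cvg_comp _ _ _ _ (fun r : R => r ^+ 2) _ _ _ h1); exact: exprn_continuous.
  apply: (cvgr_to_le h).
  apply: filterS FA => b Ab; rewrite (le_trans (l2_rnorm_sum (a - b) S))//.
  by rewrite ler_pXn2r ?nnegrE ?rnorm_ge0// ltW// hA.
have zl2 : z \in l2_pred.
  have [A FA hA] := key _ ltr01; have [a Aa] := filter_ex FA.
  have -> : z = (a : X -> H) - (fun x => a x - z x).
    by apply/funext => x; rewrite fctE subKr.
  by apply: rpredB; [exact: l2P | apply/asboolP; exists (1 ^+ 2); exact: hA].
apply/cvg_ex; exists (L2 zl2); apply/(@cvg_rnormP R l2 l2 F _ idfun) => e e0.
have [A FA hA] := key _ (divr_gt0 e0 (ltr0Sn _ 1)).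
apply: filterS FA => a Aa; rewrite rnormBC (@le_lt_trans _ _ (e / 2))//.
  by apply: l2_rnorm_le; [exact/ltW/divr_gt0 | exact: hA].
by rewrite ltr_pdivrMr// ltr_pMr// ltr1n.
Qed.

HB.instance Definition _ := l2_complete.

Lemma l2dot_pos a : a != 0 -> 0 < l2dot a a.
Proof.
move=> a0; rewrite l2dotE ltcR exprn_gt0// lt_neqAle l2norm_ge0 andbT eq_sym.
by apply: contra_neq a0 => /l2norm_eq0.
Qed.

Lemma l2dot_hermitian a b : l2dot a b = (-1) ^+ false * (l2dot b a)^*.
Proof. by rewrite expr0 mul1r -l2dotC. Qed.

Lemma l2dot_bilinear : bilinear_for
  (GRing.Scale.Law.clone _ _ ( *%R ) _)
  (GRing.Scale.Law.clone _ _ (@Num.conj C \; *%R ) _) l2dot.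
Proof. by split => c k a b; [exact: l2dotPl|exact: l2dotPr]. Qed.

HB.instance Definition _ :=
  bilinear_isBilinear.Build C l2 l2 C _ _ l2dot l2dot_bilinear.
HB.instance Definition _ :=
  isHermitianSesquilinear.Build C l2 false (@Num.conj C) l2dot l2dot_hermitian.
HB.instance Definition _ := isDotProduct.Build C l2 l2dot l2dot_pos.

Lemma l2dot_norm a : l2dot a a = `|a| ^+ 2.
Proof. by rewrite l2dotE rmorphXn. Qed.

HB.instance Definition _ :=
  CompleteNormedModule_isHilbert.Build R l2 l2dot_norm.

End square_summable.

Section complex_hilbert.
Variable R : realType.
Local Notation C := R[i].

(** [R[i]] is a Hilbert space, so that [l2 X C] is the space of square-summable
    scalar families. *)
Definition cdot (a b : C) : C := a * b^*.

Lemma cdot_bilinear : bilinear_for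
  (GRing.Scale.Law.clone _ _ ( *%R ) _)
  (GRing.Scale.Law.clone _ _ (@Num.conj C \; *%R ) _) cdot.
Proof.
split=> c k a b; rewrite /cdot/=.
  by rewrite mulrDl -mulrA.
by rewrite rmorphD rmorphM/= mulrDr mulrCA.
Qed.

HB.instance Definition _ :=
  bilinear_isBilinear.Build C C C C _ _ cdot cdot_bilinear.

Lemma cdot_hermitian a b : cdot a b = (-1) ^+ false * (cdot b a)^*.
Proof.
have E : (b * a^*)^* = b^* * (a^*)^* by exact: rmorphM.
by rewrite expr0 mul1r /cdot E conjCK mulrC.
Qed.

HB.instance Definition _ :=
  isHermitianSesquilinear.Build C C false (@Num.conj C) cdot cdot_hermitian.

Lemma cdot_norm a : cdot a a = `|a| ^+ 2.
Proof. by rewrite normCK. Qed.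

Lemma cdot_pos a : a != 0 -> 0 < cdot a a.
Proof. by move=> a0; rewrite cdot_norm exprn_gt0// normr_gt0. Qed.

HB.instance Definition _ := isDotProduct.Build C C cdot cdot_pos.
HB.instance Definition _ := CompleteNormedModule_isHilbert.Build R C cdot_norm.

End complex_hilbert.

Section delta.
Variables (R : realType) (X : choiceType) (H : hilbertType R).
Local Notation C := R[i].
Local Notation L := (l2 X H).
Implicit Types (a b : L) (v w : H).

Lemma l2_hdotE a b : hdot a b = l2dot a b. Proof. by []. Qed.

Lemma l2_sum I (r : seq I) (P : pred I) (F : I -> L) x :
  (\sum_(i <- r | P i) F i) x = \sum_(i <- r | P i) F i x.
Proof. by elim/big_ind2 : _ => // a1 b1 a2 b2 <- <-. Qed.

Lemma delta_l2 y v : (fun x : X => if x == y then v else 0) \in @l2_pred R X H.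
Proof.
apply/asboolP; exists (rnorm v ^+ 2) => F.
have [yF|yF] := boolP (y \in F).
  rewrite (big_rem y)//= eqxx big1_seq ?addr0// => x /andP[_].
  rewrite mem_rem_uniq ?fset_uniq// inE => /andP[/negbTE -> _].
  by rewrite rnorm0 expr0n.
rewrite big1_seq ?sqr_ge0// => x /andP[_ xF]; case: eqP => [xy|_].
  by rewrite xy (negbTE yF) in xF.
by rewrite rnorm0 expr0n.
Qed.

Definition delta y v : L := L2 (delta_l2 y v).

Lemma deltaE y v x : delta y v x = if x == y then v else 0. Proof. by []. Qed.

Lemma hdot_delta a y v : hdot a (delta y v) = hdot (a y) v.
Proof.
rewrite l2_hdotE; apply: l2dot_unique.
apply: cvg_near_cst; apply: filterS (totally_above [fset y]%fset) => F.
rewrite /= fsub1set => yF; rewrite /dot_sum (big_rem y)//= eqxx.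
rewrite big1_seq ?addr0// => x /andP[_].
rewrite mem_rem_uniq ?fset_uniq// inE => /andP[/negbTE xy _].
by rewrite /= xy hdot0r.
Qed.

Lemma hdot_deltal a y v : hdot (delta y v) a = hdot v (a y).
Proof. by rewrite hdotC hdot_delta -hdotC. Qed.

Lemma delta_norm y v : rnorm (delta y v) = rnorm v.
Proof.
by apply: (@pexpIrn _ 2); rewrite ?nnegrE ?rnorm_ge0//; apply: complexI;
  rewrite -!hdotE hdot_delta deltaE eqxx.
Qed.

(** The squares of the norms are summable, so that their sum off a large finite
    set is small. *)
Lemma l2_dense a (e : R) : 0 < e ->
  exists F : {fset X}, rnorm (a - \sum_(x <- F) delta x (a x)) < e.
Proof.
move=> e0; have e2 : 0 < (e / 2) ^+ 2 by rewrite exprn_gt0// divr_gt0.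
have [_ _ /cvgrPdist_lt/(_ _ e2)[F _ /(_ F)/=]] := l2norm_spec a.
move=> /(_ (fsubset_refl _)).
rewrite ger0_norm ?subr_ge0 ?l2norm_sum// => hF; exists F.
rewrite (@le_lt_trans _ _ (e / 2))//; last by rewrite ltr_pdivrMr// ltr_pMr// ltr1n.
apply: l2_rnorm_le; first exact/ltW/divr_gt0.
have E x : (a - \sum_(y <- F) delta y (a y)) x =
    a x - \sum_(y <- F) (if x == y then a y else 0) by rewrite l2B l2_sum.
move=> S; rewrite (eq_bigr (fun x => rnorm (a x - \sum_(y <- F) (if x == y then a y else 0)) ^+ 2));
  last by move=> x _; congr (rnorm _ ^+ 2); exact: E.
apply: le_trans (ltW hF); rewrite lerBrDr.
apply: le_trans (l2norm_sum a (F `|` S)%fset).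
rewrite [leRHS](big_fsetID _ (mem F))/= addrC lerD//; last first.
  have -> : [fset x in (F `|` S)%fset | x \in F]%fset = F.
    by apply/fsetP => x; rewrite !inE/= andbC; case: (x \in F).
  by [].
rewrite [leLHS](big_fsetID _ (mem F))/= [X in X + _]big_seq [X in X + _]big1 ?add0r.
  apply: (@le_trans _ _ (\sum_(x <- [fset x in S | x \notin F]%fset) rnorm (a x) ^+ 2)).
    rewrite big_seq [leRHS]big_seq; apply: ler_sum => x; rewrite !inE/= => /andP[_ xF].
    rewrite big1_seq ?subr0// => y /andP[_ yF].
    by case: eqP => // xy; rewrite xy yF in xF.
  apply: sum_fset_le => [x|]; first exact: sqr_ge0.
  by apply/fsubsetP => x; rewrite !inE/= => /andP[-> ->]; rewrite orbT.
move=> x; rewrite !inE/= => /andP[_ xF].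
rewrite (big_rem x)//= eqxx big1_seq ?addr0 ?subrr ?rnorm0 ?expr0n//.
move=> y /andP[_]; rewrite mem_rem_uniq ?fset_uniq// inE => /andP[yx _].
by rewrite eq_sym (negbTE yx).
Qed.

End delta.

(** * Representations from groupoid actions *)

Lemma bounded_linear_continuous (R : realType) (H H' : hilbertType R)
    (T : {linear H -> H'}) (M : R) :
  (forall v, rnorm (T v) <= M * rnorm v) -> continuous T.
Proof.
move=> TM x; apply/continuous_rnormP => e e0.
have M1 : 0 < `|M| + 1 by rewrite ltr_wpDl.
apply/nbhs_rnormP; exists (e / (`|M| + 1)); first by rewrite divr_gt0.
move=> y; rewrite ltr_pdivlMr// => h; rewrite -linearB (le_lt_trans (TM _))//.
apply: le_lt_trans h; rewrite mulrC ler_wpM2l ?rnorm_ge0//.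
by rewrite (le_trans (ler_norm _))// lerDl.
Qed.

Section action_representation.
Variables (R : realType) (G : topologicalGroupoidType).
Hypothesis G_etale : etale G.
Hypothesis G_hausdorff : hausdorff_space G.
Hypothesis G_lc : locally_compact [set: G].
Variable H : hilbertType R.
Local Notation C := R[i].
Local Notation L := (l2 G H).
Implicit Types (f g : G -> C) (a b c x y : G) (U : set G) (z w : L) (v : H).

(** [G] acts on its own points: [act a y] is defined when the source of [a] is
    [rho y]. Left multiplication, with [rho] the range map, gives the regular
    representation; [act a y] the range of [a], with [rho] the identity, gives
    the representation on the units. *)
Variables (rho : G -> G) (act : G -> G -> G).
Hypothesis rho_act : forall a y, gsource a = rho y -> rho (act a y) = grange a.
Hypothesis actM : forall a b y, gsource a = grange b -> gsource b = rho y ->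
  act (gmul a b) y = act a (act b y).
Hypothesis actV : forall a y, gsource a = rho y -> act (ginv a) (act a y) = y.

Lemma act_inv a y : grange a = rho y -> act a (act (ginv a) y) = y.
Proof. by move=> ay; rewrite -{1}[a]ginvK actV// gsource_inv. Qed.

Lemma rho_act_inv a y : grange a = rho y -> rho (act (ginv a) y) = gsource a.
Proof. by move=> ay; rewrite rho_act ?grange_inv// gsource_inv. Qed.

Definition translate f (z : G -> H) y : H :=
  fint (rho y) f (fun a => z (act (ginv a) y)).

Lemma translateD f g z y : Cc f -> Cc g ->
  translate (f + g) z y = translate f z y + translate g z y.
Proof.
move=> /(Cc_fibre_finite G_etale G_hausdorff G_lc) ff /(Cc_fibre_finite G_etale G_hausdorff G_lc) gf.
have := fint_linearl (rho y) 1 (fun a => z (act (ginv a) y)) ff gf.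
by rewrite !scale1r.
Qed.

Lemma translate_bisection U f (z : G -> H) y a : bisection U -> (forall b, ~ U b -> f b = 0) ->
  U a -> grange a = rho y -> translate f z y = f a *: z (act (ginv a) y).
Proof. by move=> bU fU Ua ay; rewrite /translate (fint_bisection _ bU fU Ua). Qed.

Lemma translate_bisection0 U f (z : G -> H) y : (forall b, ~ U b -> f b = 0) ->
  ~ (exists2 a, U a & grange a = rho y) -> translate f z y = 0.
Proof.
move=> fU nex; apply: fint_eq0 => a ay.
have [Ua|/fU ->] := pselect (U a); last by rewrite scale0r.
by exfalso; apply: nex; exists a.
Qed.

Definition translate_bounded f := exists2 M : R, 0 <= M & forall z (F : {fset G}),
  \sum_(y <- F) rnorm (translate f z y) ^+ 2 <= (M * rnorm z) ^+ 2.

(** On a bisection, translation is a weighted injective reindexing. *)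
Lemma translate_bounded_bisection U f : bisection U -> Ccin U f -> translate_bounded f.
Proof.
move=> bU fU; have fU0 b : ~ U b -> f b = 0 by exact: Ccin_out.
have [M M0 fM] := Cc_bounded G_hausdorff (Ccin_Cc G_hausdorff fU).
exists M => // z F.
pose s y := xget y [set a | U a /\ grange a = rho y].
pose D := [fset y in F | `[< exists2 a, U a & grange a = rho y >]]%fset.
have sP y : y \in D -> U (s y) /\ grange (s y) = rho y.
  rewrite !inE/= => /andP[_ /asboolP[a Ua ay]]; rewrite /s.
  by case: xgetP => [b -> //|/(_ a) []].
pose h y := act (ginv (s y)) y.
have h_inj : {in D &, injective h}.
  move=> y y' yD yD' hh; have [Us sy] := sP _ yD; have [Us' sy'] := sP _ yD'.
  have e : s y = s y'.
    by apply: (bisection_sinj bU) => //; rewrite -(rho_act_inv sy) -(rho_act_inv sy') -/(h y) hh.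
  by rewrite -(act_inv sy) -/(h y) hh /h e act_inv.
apply: (@le_trans _ _ (\sum_(y <- D) (M * rnorm (z (h y))) ^+ 2)).
  rewrite (big_fsetID _ (mem D))/= [X in _ + X]big_seq [X in _ + X]big1 ?addr0; last first.
    move=> y; rewrite !inE/= => /andP[yF]; rewrite yF/= => /asboolP nex.
    by rewrite (translate_bisection0 _ fU0 nex) rnorm0 expr0n.
  have -> : [fset x in F | x \in D]%fset = D.
    by apply/fsetP => y; rewrite !inE/=; case: (y \in F).
  rewrite big_seq [leRHS]big_seq; apply: ler_sum => y yD; have [Us sy] := sP _ yD.
  rewrite (translate_bisection z bU fU0 Us sy) rnormZ.
  rewrite ler_pXn2r ?nnegrE ?mulr_ge0 ?rnorm_ge0//.
  by rewrite ler_wpM2r ?rnorm_ge0.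
under eq_bigr do rewrite exprMn.
rewrite -mulr_sumr exprMn ler_wpM2l ?sqr_ge0//.
apply: le_trans (l2_rnorm_sum z [fset h y | y in D]%fset).
by rewrite [leRHS]big_imfset.
Qed.

Lemma translate_boundedP f : Cc f -> translate_bounded f.
Proof.
move: f; apply: (Cc_ind G_hausdorff G_lc (bisection_basis G_etale)).
- exists 0 => // z F; rewrite mul0r expr0n/= big1// => y _.
  by rewrite /translate fint_eq0 ?rnorm0 ?expr0n// => a _; rewrite scale0r.
- move=> f g fC gC [M M0 hM] [N N0 hN]; exists (2 * (M + N)).
    by rewrite mulr_ge0// addr_ge0.
  move=> z F; under eq_bigr => y _ do rewrite translateD//.
  apply: (@le_trans _ _ (\sum_(y <- F) 2 * (rnorm (translate f z y) ^+ 2 + rnorm (translate g z y) ^+ 2))).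
    by apply: ler_sum => y _; exact: parallelogram_le.
  rewrite -mulr_sumr big_split/=; have := hM z F; have := hN z F.
  have := rnorm_ge0 z; set n := rnorm z => n0 h1 h2.
  have h3 : 0 <= n * n by rewrite mulr_ge0.
  have h4 : 0 <= M * N * (n * n) by rewrite !mulr_ge0.
  have h5 : 0 <= M * M * (n * n) by rewrite !mulr_ge0.
  have h6 : 0 <= N * N * (n * n) by rewrite !mulr_ge0.
  move: h1 h2; rewrite !expr2 => h1 h2; nra.
- by move=> U f bU fU; exact: translate_bounded_bisection fU.
Qed.

Lemma translate_l2 f z : Cc f -> translate f z \in @l2_pred R G H.
Proof.
move=> /translate_boundedP[M _ hM]; apply/asboolP; exists ((M * rnorm z) ^+ 2) => F.
exact: hM.
Qed.

(** By additivity [f] lives on a bisection, where the outer sums have at most one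
    term. *)
Lemma translate_convolution f g (z : G -> H) y : Cc f -> Cc g ->
  translate (convolution f g) z y = translate f (translate g z) y.
Proof.
move=> fC gC; move: f fC; apply: (Cc_ind G_hausdorff G_lc (bisection_basis G_etale)).
- rewrite /translate !fint_eq0// => a _; first by rewrite scale0r.
  by rewrite convolutionE fint_eq0 ?scale0r// => b _; rewrite scale0r.
- move=> f1 f2 C1 C2 h1 h2; rewrite convolutionDl//.
  have D1 : Cc (convolution f1 g) by exact: convolution_Cc.
  have D2 : Cc (convolution f2 g) by exact: convolution_Cc.
  have ff := Cc_fibre_finite G_etale G_hausdorff G_lc.
  have := fint_linearl (rho y) 1 (fun a => z (act (ginv a) y)) (ff _ _ D1) (ff _ _ D2).
  have := fint_linearl (rho y) 1 (fun a => translate g z (act (ginv a) y)) (ff _ _ C1) (ff _ _ C2).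
  by rewrite !scale1r /translate => -> ->; congr (_ + _).
move=> U f bU fU; have fU0 b : ~ U b -> f b = 0 by exact: Ccin_out.
have [[a Ua ay]|nex] := pselect (exists2 a, U a & grange a = rho y); last first.
  rewrite (translate_bisection0 _ fU0 nex); apply: fint_eq0 => c cy.
  rewrite convolutionE fint_eq0 ?scale0r// => b bc.
  have [Ub|/fU0 ->] := pselect (U b); last by rewrite scale0r.
  by exfalso; apply: nex; exists b => //; rewrite bc.
rewrite (translate_bisection _ bU fU0 Ua ay) /translate -ay fint_shift rho_act_inv//.
have gf := Cc_fibre_finite G_etale G_hausdorff G_lc gC.
have -> : f a *: fint (gsource a) g (fun b => z (act (ginv b) (act (ginv a) y))) =
   fint (gsource a) g (fun b => f a *: z (act (ginv b) (act (ginv a) y)) + 0).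
  by rewrite (fint_linear _ _ _ (fun=> 0) gf) [X in _ + X]fint_eq0 ?addr0// => b _; rewrite scaler0.
apply: eq_fint => b ba; rewrite addr0 convolutionE.
rewrite (fint_bisection _ bU fU0 Ua) ?grangeM// gmulKg// ginvM// actM.
- by rewrite scalerA; congr (_ *: _); exact: mulrC.
- by rewrite gsource_inv grange_inv.
- by rewrite gsource_inv.
Qed.

Lemma exists_translation f : exists T : {linear L -> L}, Cc f -> forall z y, T z y = translate f z y.
Proof.
have [fC|nfC] := pselect (Cc f); last by exists \0%R.
pose T0 (z : L) : L := L2 (translate_l2 z fC).
have T0l : linear T0.
  move=> k z w; apply: l2_ext => y.
  exact: (fint_linear _ k (fun a => z (act (ginv a) y)) (fun a => w (act (ginv a) y))
    (Cc_fibre_finite G_etale G_hausdorff G_lc fC)).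
pose T : {linear L -> L} := HB.pack T0 (GRing.isLinear.Build C L L *:%R T0 T0l).
by exists T.
Qed.

Lemma translate_delta U f x v a y : bisection U -> (forall b, ~ U b -> f b = 0) ->
  U a -> gsource a = rho x -> translate f (delta x v) y = delta (act a x) (f a *: v) y.
Proof.
move=> bU fU Ua ax; rewrite deltaE.
have [->|ya] := eqVneq y (act a x).
  rewrite (translate_bisection _ bU fU Ua); last by rewrite rho_act.
  by rewrite deltaE actV// eqxx.
apply: fint_eq0 => b by_; have [Ub|/fU ->] := pselect (U b); last by rewrite scale0r.
rewrite deltaE; case: eqP => [e|]; last by rewrite scaler0.
move/eqP: ya; case; rewrite -e -(_ : b = a) ?act_inv//.
by apply: (bisection_sinj bU) => //; rewrite ax -e rho_act_inv.
Qed.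

Lemma translate_delta0 U f x v y : (forall b, ~ U b -> f b = 0) ->
  ~ (exists2 a, U a & gsource a = rho x) -> translate f (delta x v) y = 0.
Proof.
move=> fU nex; apply: fint_eq0 => b by_; have [Ub|/fU ->] := pselect (U b); last by rewrite scale0r.
rewrite deltaE; case: eqP => [e|]; last by rewrite scaler0.
by exfalso; apply: nex; exists b => //; rewrite -e rho_act_inv.
Qed.

(** Preservation of adjoints is checked on point masses, by density and
    boundedness, and on bisections, by additivity. *)
Theorem action_representation : exists pi : (G -> C) -> {linear L -> L},
  star_representation pi /\
  forall f z y, Cc f -> pi f z y = fint (rho y) f (fun a => z (act (ginv a) y)).
Proof.
have [pi hpi] := choice exists_translation.
have piE f z y : Cc f -> pi f z y = translate f z y by move=> fC; exact: hpi.
have pi_bounded f : Cc f -> exists2 M : R, 0 <= M & forall z, rnorm (pi f z) <= M * rnorm z.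
  move=> fC; have [M M0 hM] := translate_boundedP fC; exists M => // z.
  apply: l2_rnorm_le => [|F]; first by rewrite mulr_ge0 ?rnorm_ge0.
  apply: le_trans (hM z F); apply: ler_sum => y _; by rewrite piE.
exists pi; split => //; split.
- by move=> f /pi_bounded[M _ hM]; exact: bounded_linear_continuous hM.
- move=> k f g fC gC z; apply: l2_ext => y.
  have kC : Cc (k *: f + g) by apply: CcD => //; exact: CcZ.
  have -> : pi (k *: f + g) z y = translate (k *: f + g) z y by exact: piE.
  have -> : (k *: pi f z + pi g z) y = k *: translate f z y + translate g z y.
    by rewrite -!piE.
  have ff := Cc_fibre_finite G_etale G_hausdorff G_lc.
  exact: (fint_linearl (rho y) k (fun a => z (act (ginv a) y)) (ff _ _ fC) (ff _ _ gC)).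
- move=> f g fC gC z; apply: l2_ext => y.
  rewrite piE; last exact: convolution_Cc.
  rewrite translate_convolution// piE//.
  by congr translate; apply/funext => x; rewrite piE.
have piD f g z : Cc f -> Cc g -> pi (f + g) z = pi f z + pi g z.
  move=> fC gC; apply: l2_ext => y; rewrite piE; last exact: CcD.
  by rewrite translateD// -!piE.
apply: (Cc_ind G_hausdorff G_lc (bisection_basis G_etale)).
- move=> z w; have p0 u : pi 0 u = 0.
    by apply: (addIr (pi 0 u)); rewrite -piD ?addr0 ?add0r//; exact: Cc0.
  have -> : fun_star 0 = 0 :> (G -> C) by apply/funext => x; rewrite /fun_star rmorph0.
  by rewrite !p0 hdot0l hdot0r.
- move=> f g fC gC hf hg z w.
  have -> : fun_star (f + g) = fun_star f + fun_star g :> (G -> C).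
    by apply/funext => x; rewrite /fun_star rmorphD.
  by rewrite !piD ?hdotDl ?hdotDr ?hf ?hg//; exact: fun_star_Cc.
move=> U f bU fU z w; have fU0 b : ~ U b -> f b = 0 by exact: Ccin_out.
have fC := Ccin_Cc G_hausdorff fU; have sC := fun_star_Cc G_hausdorff fC.
have sU0 b : ~ (@ginv G @^-1` U) b -> fun_star f b = 0 by move=> nU; rewrite /fun_star fU0 ?rmorph0.
have hdelta x v : hdot (pi f (delta x v)) w = hdot (delta x v) (pi (fun_star f) w).
  rewrite hdot_deltal piE//.
  have [[a Ua ax]|nex] := pselect (exists2 a, U a & gsource a = rho x).
    have -> : pi f (delta x v) = delta (act a x) (f a *: v).
      by apply: l2_ext => y; rewrite piE//; exact: (translate_delta _ _ bU fU0 Ua ax).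
    rewrite hdot_deltal (translate_bisection _ (bisection_inv bU) sU0 (a := ginv a)).
    + by rewrite /fun_star ginvK hdotZl hdotZr conjCK.
    + by rewrite /= ginvK.
    + by rewrite grange_inv.
  have -> : pi f (delta x v) = 0.
    by apply: l2_ext => y; rewrite piE//; exact: (translate_delta0 _ _ fU0 nex).
  rewrite hdot0l (translate_bisection0 _ sU0) ?hdot0r//.
  by move=> [a Ua ax]; apply: nex; exists (ginv a) => //; rewrite gsource_inv.
have [M M0 hM] := pi_bounded _ fC; have [N N0 hN] := pi_bounded _ sC.
apply/eqP; rewrite -subr_eq0; apply/eqP; apply: rnorm_eq0.
have n0 := rnorm_ge0 w.
have D0 : 0 < (M + N) * rnorm w + 1 by rewrite ltr_wpDl// mulr_ge0// addr_ge0.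
apply/eqP; rewrite eq_le rnorm_ge0 andbT; apply/ler_addgt0Pl => e e0; rewrite addr0.
have [F hF] := l2_dense z (divr_gt0 e0 D0).
set zF := \sum_(x <- F) delta x (z x) in hF.
have E : hdot (pi f zF) w = hdot zF (pi (fun_star f) w).
  rewrite /zF linear_sum !hdot_suml; apply: eq_bigr => x _; exact: hdelta.
have [u Eu hu] : exists2 u : L, hdot (pi f z) w - hdot z (pi (fun_star f) w) =
    hdot (pi f u) w - hdot u (pi (fun_star f) w) & rnorm u < e / ((M + N) * rnorm w + 1).
  exists (z - zF); last exact: hF.
  by rewrite linearB !hdotBl E; ring.
rewrite Eu (le_trans (rnormB _ _))//.
apply: (@le_trans _ _ (M * rnorm u * rnorm w + rnorm u * (N * rnorm w))).
  apply: lerD; rewrite (le_trans (cauchy_schwarz _ _))//.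
    by rewrite ler_wpM2r// hM.
  by rewrite ler_wpM2l ?rnorm_ge0// hN.
have := rnorm_ge0 u; move: hu; rewrite ltr_pdivlMr//; nra.
Qed.

End action_representation.

(** * The norm of the full algebra and the regular representation *)

Section full_algebra.
Variables (R : realType) (G : topologicalGroupoidType).
Hypothesis G_etale : etale G.
Hypothesis G_hausdorff : hausdorff_space G.
Hypothesis G_lc : locally_compact [set: G].
Variables (A : cstarAlgType R) (iota : (G -> R[i]) -> A).
Hypothesis A_full : is_full_cstar_algebra iota.
Local Notation C := R[i].
Implicit Types (f g : G -> C) (a b c x y : G) (U : set G).

Lemma iota_linear (k : C) f g : Cc f -> Cc g -> iota (k *: f + g) = k *: iota f + iota g.
Proof. by case: A_full => h *; exact: h. Qed.

Lemma iotaM f g : Cc f -> Cc g -> iota (convolution f g) = cmul (iota f) (iota g).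
Proof. by case: A_full => _ h *; exact: h. Qed.

Lemma iota_add f g : Cc f -> Cc g -> iota (f + g) = iota f + iota g.
Proof. by move=> fC gC; rewrite -[f]scale1r iota_linear// !scale1r. Qed.

Lemma iota0 : iota 0 = 0.
Proof. by apply: (addIr (iota 0)); rewrite -iota_add ?addr0 ?add0r//; exact: Cc0. Qed.

Lemma iotaB f g : Cc f -> Cc g -> iota (f - g) = iota f - iota g.
Proof. by move=> fC gC; rewrite -scaleN1r addrC iota_linear// scaleN1r addrC. Qed.

Lemma iota_dense (a : A) (e : R) : 0 < e -> exists2 f, Cc f & rnorm (a - iota f) < e.
Proof.
move=> e0; case: A_full => _ _ _ _ /(_ (interior [set b : A | rnorm (a - b) < e])).
have h : (interior [set b : A | rnorm (a - b) < e]) a by apply/nbhs_rnormP; exists e.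
case; [by exists a|exact: open_interior|].
by move=> x [/interior_subset hx [f fC E]]; exists f => //; rewrite E.
Qed.

Lemma cmulBl (a b c : A) : cmul (a - b) c = cmul a c - cmul b c.
Proof. exact: linearBl. Qed.
Lemma cmulBr (a b c : A) : cmul a (b - c) = cmul a b - cmul a c.
Proof. exact: linearBr. Qed.
Lemma rnorm_cmul (a b : A) : rnorm (cmul a b) <= rnorm a * rnorm b.
Proof. by rewrite -lecR rmorphM/= -!rnormE cnormM. Qed.

Lemma rep_le_iota (H : hilbertType R) (pi : (G -> C) -> {linear H -> H}) f v :
  star_representation pi -> Cc f -> rnorm (pi f v) <= rnorm (iota f) * rnorm v.
Proof.
move=> pi_rep fC; have [->|v0] := eqVneq v 0; first by rewrite linear0 !rnorm0 mulr0.
have nv : 0 < rnorm v.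
  by rewrite lt_neqAle rnorm_ge0 andbT eq_sym; apply: contra_neq v0 => /rnorm_eq0.
have h : ((rnorm (pi f ((rnorm v)^-1%:C%C *: v)))%:E <= (rnorm (iota f))%:E)%E.
  case: A_full => _ _ _ /(_ _ fC) E _; rewrite /rnorm in E *; rewrite E.
  apply: (@le_trans _ _ (opnorm (pi f))).
    apply: ereal_sup_ubound; exists ((rnorm v)^-1%:C%C *: v) => //=.
    rewrite rnormE rnormZ rnormC ger0_norm ?invr_ge0 ?rnorm_ge0// mulVf ?gt_eqF//.
  by apply: ereal_sup_ubound; exists H, pi.
move: h; rewrite lee_fin linearZ/= rnormZ rnormC ger0_norm ?invr_ge0 ?rnorm_ge0//.
by rewrite mulrC ler_pdivrMr.
Qed.

Lemma iota_le f (B : R) : Cc f -> 0 <= B ->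
  (forall (H : hilbertType R) (pi : (G -> C) -> {linear H -> H}) v,
     star_representation pi -> rnorm (pi f v) <= B * rnorm v) ->
  rnorm (iota f) <= B.
Proof.
move=> fC B0 h; rewrite -lee_fin; case: A_full => _ _ _ /(_ _ fC) E _.
rewrite {1}/rnorm E; apply: ge_ereal_sup => _ [H [pi [pi_rep ->]]].
apply: ge_ereal_sup => _ [v /= v1 <-]; rewrite lee_fin.
rewrite (le_trans (h _ _ v pi_rep))// -[leRHS]mulr1 ler_wpM2l//.
by move: v1; rewrite rnormE lecR.
Qed.

Lemma iota_bisection_le U f (M : R) : bisection U -> Ccin U f -> 0 <= M ->
  (forall a, rnorm (f a) <= M) -> rnorm (iota f) <= M.
Proof.
move=> bU fU M0 fM; apply: iota_le => //; first exact: Ccin_Cc fU.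
by move=> H pi v pi_rep; exact: (rep_bisection _ _ _ pi_rep _ bU fU).
Qed.

Lemma iota_compact_le (K : set G) : compact K -> exists2 n : R, 0 <= n &
  forall f (M : R), 0 <= M -> Cc f -> (forall a, f a != 0 -> K a) ->
  (forall a, rnorm (f a) <= M) -> rnorm (iota f) <= n * M.
Proof.
move=> cK; have [n n0 h] := rep_compact_bound R G_etale G_hausdorff G_lc cK.
exists n => // f M M0 fC fK fM; apply: iota_le => //; first exact: mulr_ge0.
by move=> H pi v; exact: h.
Qed.

End full_algebra.

Section regular_representation.
Variables (R : realType) (G : topologicalGroupoidType).
Hypothesis G_etale : etale G.
Hypothesis G_hausdorff : hausdorff_space G.
Hypothesis G_lc : locally_compact [set: G].
Local Notation C := R[i].
Implicit Types (f g : G -> C) (a b c x y : G).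

(** Coefficients in an arbitrary [H] are what makes [fibre_matrix_bound] hold for
    vectors of a Hilbert space instead of scalars. *)
Lemma regular_representation (H : hilbertType R) :
  exists pi : (G -> C) -> {linear l2 G H -> l2 G H}, star_representation pi /\
  forall f b v c, Cc f -> pi f (delta b v) c =
    if gsource c == gsource b then f (gmul c (ginv b)) *: v else 0.
Proof.
have [|||pi [pi_rep piE]] := @action_representation R G G_etale G_hausdorff G_lc H (@grange G) (@gmul G).
- by move=> a y; exact: grangeM.
- by move=> a b y ab by_; rewrite gmulgA.
- by move=> a y; exact: gmulKg.
exists pi; split=> // f b v c fC; rewrite piE//.
have [cb|cb] := eqVneq (gsource c) (gsource b); last first.
  apply: fint_eq0 => a ac; rewrite deltaE; case: eqP => [e|]; last by rewrite scaler0.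
  by move/eqP: cb; case; rewrite -e gsource_divl.
rewrite (fint_single (a := gmul c (ginv b))).
- rewrite deltaE; case: eqP => // e; exfalso; apply: e.
  by rewrite ginvM ?ginvK ?grange_inv// gmulgVK.
- by rewrite grangeM ?grange_inv.
- move=> a ac nab; rewrite deltaE; case: eqP => [e|]; last by rewrite scaler0.
  by move/eqP: nab; case; rewrite -e gmul_Vr// gmulVKg.
Qed.

End regular_representation.

(** * Simplicity implies effectiveness and minimality *)

Section kernel_ideals.
Variables (R : realType) (G : topologicalGroupoidType).
Hypothesis G_etale : etale G.
Hypothesis G_hausdorff : hausdorff_space G.
Hypothesis G_lc : locally_compact [set: G].
Variables (A : cstarAlgType R) (iota : (G -> R[i]) -> A).
Hypothesis A_full : is_full_cstar_algebra iota.
Local Notation C := R[i].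
Implicit Types (f g : G -> C) (a b c x y : G) (U : set G).

(** [f c] is a matrix coefficient of the regular representation: it is the
    component at [c] of the image of the point mass at the source of [c]. *)
Lemma sup_le_iota f c : Cc f -> rnorm (f c) <= rnorm (iota f).
Proof.
move=> fC; have [pi [pi_rep piE]] := regular_representation G_etale G_hausdorff G_lc (R[i] : hilbertType R).
have := rep_le_iota A_full (delta (gsource c) (1 : C)) pi_rep fC.
rewrite delta_norm rnorm1 mulr1; apply: le_trans.
have := l2_eval_le (pi f (delta (gsource c) (1 : C))) c.
rewrite piE// gsource_gsource eqxx gunits_inv ?gsourcer; last exact: gunits_source.
by rewrite rnormZ rnorm1 mulr1.
Qed.

Section one_kernel.
Variables (H : hilbertType R) (pi : (G -> C) -> {linear H -> H}).
Hypothesis pi_rep : star_representation pi.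
Variable M : set H.
Hypothesis pi_M : forall f v, Cc f -> M v -> M (pi f v).

(** The elements of [A] that the extension of [pi] maps to an operator vanishing on
    [M], described without the extension: if [a] is such an element, then [pi f v]
    is the value at [v] of the extension at [iota f - a], of norm at most that of
    [a - iota f]; conversely, let [iota f] tend to [a]. *)
Definition kernel_ideal : set A :=
  [set a | forall f v, Cc f -> M v -> rnorm (pi f v) <= rnorm (a - iota f) * rnorm v].

Lemma kernel_iota f : Cc f -> kernel_ideal (iota f) <-> forall v, M v -> pi f v = 0.
Proof.
move=> fC; split=> [h v Mv|h g v gC Mv].
  have := h f v fC Mv; rewrite subrr rnorm0 mul0r => h0.
  by apply: rnorm_eq0; apply/eqP; rewrite eq_le h0 rnorm_ge0.
have := rep_le_iota A_full v pi_rep (CcB G_hausdorff fC gC).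
rewrite (iotaB A_full)// (repB pi_rep)// h// sub0r rnormN//.
Qed.

Lemma kernel_approx (a : A) (e : R) : kernel_ideal a -> 0 < e -> exists f, [/\ Cc f, rnorm (a - iota f) < e &
  forall v, M v -> rnorm (pi f v) <= e * rnorm v].
Proof.
move=> Ia e0; have [f fC af] := iota_dense A_full a e0; exists f; split => // v Mv.
by rewrite (le_trans (Ia f v fC Mv))// ler_wpM2r ?rnorm_ge0// ltW.
Qed.

Lemma kernel_closed : closed kernel_ideal.
Proof.
move=> a clI f v fC Mv; apply/ler_addgt0Pl => e e0.
have v1 : 0 < rnorm v + 1 by rewrite ltr_wpDl ?rnorm_ge0.
have [|b [Ib /= ab]] := clI [set b | rnorm (a - b) < e / (rnorm v + 1)].
  by apply/nbhs_rnormP; exists (e / (rnorm v + 1)) => //; exact: divr_gt0.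
rewrite (le_trans (Ib f v fC Mv))//.
have := rnorm_triangle b a (iota f); rewrite (rnormBC b a) => h.
move: ab; rewrite ltr_pdivlMr// => ab.
have := rnorm_ge0 v; have := rnorm_ge0 (a - b); nra.
Qed.

Lemma kernel_intro (c : A) :
  (forall v e, M v -> 0 < e -> exists u, [/\ Cc u, rnorm (c - iota u) * rnorm v <= e &
     rnorm (pi u v) <= e]) -> kernel_ideal c.
Proof.
move=> h f v fC Mv; apply/ler_addgt0Pl => e e0.
have [u [uC cu pu]] := h v (e / 2) Mv (divr_gt0 e0 (ltr0Sn _ 1)).
have E : pi f v = pi (f - u) v + pi u v by rewrite (repB pi_rep)// subrK.
have := rep_le_iota A_full v pi_rep (CcB G_hausdorff fC uC).
rewrite (iotaB A_full)// => h1.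
have := rnorm_triangle (iota f) c (iota u); rewrite (rnormBC (iota f) c) => h2.
have v0 := rnorm_ge0 v.
have h3 := ler_wpM2r v0 h2; rewrite mulrDl in h3.
rewrite E (le_trans (rnormD _ _))//; lra.
Qed.

Lemma cmul_approx (a b g h : A) (d : R) : 0 <= d -> d <= 1 -> rnorm (a - g) <= d -> rnorm (b - h) <= d ->
  rnorm (cmul a b - cmul g h) <= d * (rnorm a + rnorm b + 1).
Proof.
move=> d0 d1 ag bh.
have -> : cmul a b - cmul g h = cmul a (b - h) + cmul (a - g) h.
  by rewrite cmulBr cmulBl addrA subrK.
have h1 := rnorm_cmul a (b - h); have h2 := rnorm_cmul (a - g) h.
have h3 := rnorm_sub_le h b; rewrite (rnormBC h b) in h3.
have a0 := rnorm_ge0 a; have b0 := rnorm_ge0 b; have hh0 := rnorm_ge0 h.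
have h4 : rnorm a * rnorm (b - h) <= rnorm a * d by rewrite ler_wpM2l.
have h5 : rnorm (a - g) * rnorm h <= d * rnorm h by rewrite ler_wpM2r.
have h6 : d * rnorm h <= d * (1 + rnorm b) by rewrite ler_wpM2l//; lra.
by rewrite (le_trans (rnormD _ _))//; lra.
Qed.

Lemma small_delta (e D : R) : 0 < e -> 0 < D -> exists d, [/\ 0 < d, d <= 1 & d * D <= e].
Proof.
move=> e0 D0; exists (Num.min 1 (e / D)); split.
- by rewrite lt_min ltr01 divr_gt0.
- by rewrite ge_min lexx.
- by rewrite -ler_pdivlMr// ge_min lexx orbT.
Qed.

Lemma kernel_ideal_closed : closed_ideal kernel_ideal.
Proof.
split; first exact: kernel_closed.
- rewrite -(iota0 G_hausdorff A_full); apply/kernel_iota; first exact: Cc0.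
  by move=> v _; exact: (rep0 G_hausdorff pi_rep).
- move=> k a b Ia Ib; apply: kernel_intro => v e Mv e0.
  have k0 := rnorm_ge0 k; have v0 := rnorm_ge0 v.
  have D0 : 0 < (rnorm k + 1) * (rnorm v + 1) by rewrite mulr_gt0// ltr_wpDl.
  have [d [d0 _ dD]] := small_delta e0 D0.
  have [g [gC ag hg]] := kernel_approx Ia d0; have [h [hC bh hh]] := kernel_approx Ib d0.
  have n1 : rnorm k * d + d = (rnorm k + 1) * d by rewrite mulrDl mul1r.
  have n2 : (rnorm k * d + d) * rnorm v <= e.
    by rewrite n1; have := mulr_ge0 k0 (ltW d0); nra.
  exists (k *: g + h); split; first by apply: CcD => //; exact: CcZ.
    rewrite (iota_linear A_full)//; apply: le_trans n2; rewrite ler_wpM2r//.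
    have -> : k *: a + b - (k *: iota g + iota h) = k *: (a - iota g) + (b - iota h).
      by rewrite scalerBr opprD addrACA.
    by rewrite (le_trans (rnormD _ _))// rnormZ lerD ?ler_wpM2l// ltW.
  rewrite (rep_linear pi_rep)// (le_trans (rnormD _ _))// rnormZ.
  apply: le_trans n2; rewrite mulrDl lerD// ?hh// -mulrA ler_wpM2l// hg//.
- move=> a b Ib; apply: kernel_intro => v e Mv e0.
  have a0 := rnorm_ge0 a; have b0 := rnorm_ge0 b; have v0 := rnorm_ge0 v.
  have D0 : 0 < (rnorm a + rnorm b + 1) * (rnorm v + 1) by rewrite mulr_gt0// ltr_wpDl// addr_ge0.
  have [d [d0 d1 dD]] := small_delta e0 D0.
  have [g gC ag] := iota_dense A_full a d0; have [h [hC bh hh]] := kernel_approx Ib d0.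
  exists (convolution g h); split; first exact: convolution_Cc.
    rewrite (iotaM A_full)//; have := cmul_approx (ltW d0) d1 (ltW ag) (ltW bh).
    by move=> h1; have := ler_wpM2r v0 h1; nra.
  rewrite (repM pi_rep)//; have := rep_le_iota A_full (pi h v) pi_rep gC.
  have := hh v Mv; have := rnorm_sub_le (iota g) a; rewrite (rnormBC _ a).
  have := rnorm_ge0 (iota g); have := rnorm_ge0 (pi h v).
  move=> p0 g0 g1 h1 h2.
  have h3 : rnorm (iota g) * rnorm (pi h v) <= rnorm (iota g) * (d * rnorm v) by rewrite ler_wpM2l.
  have h4 : rnorm (iota g) * (d * rnorm v) <= (rnorm a + 1) * (d * rnorm v).
    rewrite ler_wpM2r//; first by rewrite mulr_ge0// ltW.
    by lra.
  have := mulr_ge0 b0 (mulr_ge0 (ltW d0) v0); have := mulr_ge0 b0 (ltW d0); have := mulr_ge0 a0 (ltW d0); nra.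
- move=> a b Ia; apply: kernel_intro => v e Mv e0.
  have a0 := rnorm_ge0 a; have b0 := rnorm_ge0 b; have v0 := rnorm_ge0 v.
  have D0 : 0 < (rnorm a + rnorm b + 1) * (rnorm v + 1) by rewrite mulr_gt0// ltr_wpDl// addr_ge0.
  have [d [d0 d1 dD]] := small_delta e0 D0.
  have [g [gC ag hg]] := kernel_approx Ia d0; have [h hC bh] := iota_dense A_full b d0.
  exists (convolution g h); split; first exact: convolution_Cc.
    rewrite (iotaM A_full)//; have := cmul_approx (ltW d0) d1 (ltW ag) (ltW bh).
    by move=> h1; have := ler_wpM2r v0 h1; nra.
  rewrite (repM pi_rep)//; have := rep_le_iota A_full v pi_rep hC.
  have := hg _ (pi_M hC Mv); have := rnorm_sub_le (iota h) b; rewrite (rnormBC _ b).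
  have := rnorm_ge0 (iota h); have := rnorm_ge0 (pi h v).
  move=> p0 g0 g1 h1 h2.
  have h3 : d * rnorm (pi h v) <= d * (rnorm (iota h) * rnorm v) by rewrite ler_wpM2l// ltW.
  have h4 : d * (rnorm (iota h) * rnorm v) <= d * ((rnorm b + 1) * rnorm v).
    rewrite ler_wpM2l//; first exact: ltW.
    by rewrite ler_wpM2r//; lra.
  have := mulr_ge0 a0 (mulr_ge0 (ltW d0) v0); have := mulr_ge0 b0 (ltW d0); have := mulr_ge0 a0 (ltW d0); nra.
Qed.

(** The kernel is proper because of [g], hence zero; and the values of [f] are
    bounded by the norm of [iota f]. *)
Lemma simple_kernel g v f c : simple_cstar A -> Cc g -> M v -> pi g v <> 0 ->
  Cc f -> (forall w, M w -> pi f w = 0) -> f c = 0.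
Proof.
move=> /(_ _ kernel_ideal_closed)[I0|IT] gC Mv gv fC f0.
  have : kernel_ideal (iota f) by apply/kernel_iota.
  rewrite I0 /= => f1; apply: rnorm_eq0; apply/eqP; rewrite eq_le rnorm_ge0 andbT.
  by rewrite (le_trans (sup_le_iota c fC))// f1 rnorm0.
have : kernel_ideal (iota g) by rewrite IT.
by move=> /(kernel_iota gC)/(_ v Mv).
Qed.

End one_kernel.

Lemma exists_Ccin U x : open U -> U x -> exists f, [/\ Ccin U f, f x = 1,
  forall y, rnorm (f y) <= 1 & forall y, exists2 r : R, f y = r%:C%C & 0 <= r].
Proof.
move=> oU Ux; have [b bU bx] := exists_bump R G_hausdorff G_lc oU Ux.
exists (fun y => (b y)%:C%C); split; [exact: bump_Ccin|by rewrite bx| |].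
  by move=> y; case: bU => _ b0 b1 _; rewrite rnormC ger0_norm.
by move=> y; exists (b y) => //; case: bU.
Qed.

(** [G] permutes its units, mapping the source of [a] to its range. At a point that
    is not a unit the range fibre is empty and every [pi f z] vanishes. *)
Lemma orbit_representation : exists pi : (G -> C) -> {linear l2 G C -> l2 G C},
  star_representation pi /\
  forall f (z : l2 G C) y, Cc f -> pi f z y = fint y f (fun a => z (gsource a)).
Proof.
have [|||pi [pi_rep piE]] := @action_representation R G G_etale G_hausdorff G_lc C id (fun a _ => grange a).
- by [].
- by move=> a b y ab by_; rewrite grangeM.
- by move=> a y ay; rewrite grange_inv.
exists pi; split=> // f z y fC; rewrite piE//.
by apply: eq_fint => a _; rewrite grange_inv.
Qed.

(** A bisection of isotropy acts trivially on the units, so that the representation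
    on the units does not distinguish the pointwise square [g^2], which lives on the
    bisection, from [g * g^*], which lives on the units. *)
Lemma simple_effective : simple_cstar A -> effective G.
Proof.
move=> sA; apply/seteqP; split=> [c ci|x ux]; last first.
  have ou : nbhs x (@gunits G) by apply: open_nbhs_nbhs; split => //; exact: gunits_open.
  by apply: filterS ou => y uy; exact: gunits_grange_gsource.
apply: contrapT => nuc.
pose W := interior [set a : G | grange a = gsource a] `&` ~` (@gunits G).
have oW : open W.
  by apply: openI; [exact: open_interior|apply: closed_openC; exact: gunits_closed].
have [U [bU Uc UW]] := exists_bisection G_etale oW (conj ci nuc).
have [g [gU gc _ greal]] := exists_Ccin (bisection_open bU) Uc.
have gC := Ccin_Cc G_hausdorff gU; have gU0 b : ~ U b -> g b = 0 by exact: Ccin_out.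
have Uiso b : U b -> grange b = gsource b by move=> /UW[/interior_subset].
have [pi [pi_rep piE]] := orbit_representation.
have sgC := fun_star_Cc G_hausdorff gC.
have g2C : Cc (fun x => g x * g x) by apply: CcMl => //; exact: Cc_continuous.
have ggC : Cc (convolution g (fun_star g)) by exact: convolution_Cc.
pose d : G -> C := (fun x => g x * g x) - convolution g (fun_star g).
have dC : Cc d by exact: CcB.
(* [g] moves no unit, so that [pi g] is diagonal and [pi g^2 = pi g (pi g)^*] *)
have g20 a : ~ U a -> (fun x => g x * g x) a = 0 by move=> /gU0 ->; rewrite mul0r.
have sg0 a : ~ (@ginv G @^-1` U) a -> fun_star g a = 0.
  by move=> /gU0 ga; rewrite /fun_star ga rmorph0.
have d0 (w : l2 G C) : [set: l2 G C] w -> pi d w = 0.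
  move=> _; apply: l2_ext => y; rewrite (repB pi_rep)// (repM pi_rep)//.
  have E : (pi (fun x => g x * g x) w - pi g (pi (fun_star g) w)) y =
    fint y (fun x => g x * g x) (fun a => w (gsource a)) -
    fint y g (fun a => fint (gsource a) (fun_star g) (fun b => w (gsource b))).
    have -> : (pi (fun x => g x * g x) w - pi g (pi (fun_star g) w)) y =
      pi (fun x => g x * g x) w y - pi g (pi (fun_star g) w) y by [].
    rewrite !piE//; congr (_ - _); apply: eq_fint => a _; by rewrite piE.
  rewrite {}E; have [[a [Ua ay]]|nex] := pselect (exists a, U a /\ grange a = y); last first.
    rewrite !fint_eq0 ?subrr// => a ay.
      by rewrite gU0 ?scale0r// => Ua; apply: nex; exists a.
    by rewrite gU0 ?mul0r ?scale0r// => Ua; apply: nex; exists a.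
  rewrite (fint_bisection _ bU g20 Ua ay) (fint_bisection _ bU gU0 Ua ay).
  rewrite (fint_bisection _ (bisection_inv bU) sg0 (a := ginv a)) ?grange_inv//; last by rewrite /= ginvK.
  rewrite gsource_inv (Uiso _ Ua) /fun_star ginvK.
  by have [r -> _] := greal a; rewrite conjC_realc scalerA subrr.
have dc : d c = 1.
  rewrite /d !fctE gc mulr1 (convolution_star_off bU gU0 gU0 nuc) subr0//.
pose e : l2 G C := delta (gsource c) (1 : C).
have ge : pi g e <> 0.
  move=> /(congr1 (fun z : l2 G C => z (grange c))).
  rewrite piE// (fint_bisection _ bU gU0 Uc)// gc deltaE eqxx scale1r => /eqP.
  by rewrite oner_eq0.
have := simple_kernel pi_rep (M := setT) (fun _ _ _ _ => I) c sA gC (v := e) I ge dC d0.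
by rewrite dc => /eqP; rewrite oner_eq0.
Qed.

(** Vectors supported on an orbit form an invariant set. A function on the units
    supported off the closure of the orbit kills all of them, which a function that
    does not vanish on the orbit does not. *)
Lemma simple_minimal : simple_cstar A -> minimal_groupoid G.
Proof.
move=> sA x ux y uy; apply: contrapT => nyc.
pose U := ~` (closure (gorbit x)) `&` @gunits G.
have oU : open U.
  by apply: openI; [apply: closed_openC; exact: closed_closure|exact: gunits_open].
have [f [fU fy _ _]] := exists_Ccin oU (conj nyc uy).
have [g [gU gx _ _]] := exists_Ccin (gunits_open G_etale) ux.
have fC := Ccin_Cc G_hausdorff fU; have gC := Ccin_Cc G_hausdorff gU.
have [pi [pi_rep piE]] := orbit_representation.
pose M : set (l2 G C) := [set z | forall y, z y != 0 -> gorbit x y].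
have MM (h : G -> C) (z : l2 G C) : Cc h -> M z -> M (pi h z).
  move=> hC Mz b; rewrite piE// => nb; apply: contrapT => nob; move/eqP: nb; apply.
  apply: fint_eq0 => a ab; have [->|/Mz[c cx ca]] := eqVneq (z (gsource a)) 0; first by rewrite scaler0.
  exfalso; apply: nob; exists (gmul a c); last by rewrite grangeM.
  by rewrite /= gsourceM.
pose e : l2 G C := delta x (1 : C).
have Md : M e.
  move=> b; rewrite deltaE; case: (eqVneq b x) => [-> _|]; last by rewrite eqxx.
  by exists x; rewrite /= ?gunits_gsource ?gunits_grange.
have gd : pi g e <> 0.
  move=> /(congr1 (fun z : l2 G C => z x)); rewrite piE//.
  have gu b : ~ gunits b -> g b = 0 by exact: Ccin_out.
  rewrite (fint_bisection _ (bisection_units G_etale) gu ux) ?gunits_grange//.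
  rewrite gx deltaE gunits_gsource// eqxx scale1r => /eqP.
  by rewrite oner_eq0.
have f0 (z : l2 G C) : M z -> pi f z = 0.
  move=> Mz; apply: l2_ext => b; rewrite piE//; apply: fint_eq0 => a ab.
  have [[nca ua]|/(Ccin_out fU) ->] := pselect (U a); last by rewrite scale0r.
  have [->|/Mz oa] := eqVneq (z (gsource a)) 0; first by rewrite scaler0.
  by exfalso; apply: nca; apply: subset_closure; rewrite gunits_gsource// in oa.
have := simple_kernel pi_rep MM y sA gC Md gd fC f0.
by rewrite fy => /eqP; rewrite oner_eq0.
Qed.

End kernel_ideals.

(** * Amenability and almost invariant unit vectors *)

Section esum_fset_sums.
Variables (R : realType) (T : choiceType).
Implicit Types (S : set T) (a : T -> R).

Lemma esum_ge_fset S a (F : {fset T}) : (forall x, x \in F -> S x) ->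
  ((\sum_(x <- F) a x)%:E <= \esum_(x in S) (a x)%:E)%E.
Proof.
move=> FS; apply: esum_ge; exists [set` F]; first by split => //; exact: finite_fset.
by rewrite fsbig_finite// set_fsetK sumEFin.
Qed.

Lemma esum_gt_fset S a (r : R) : (r%:E < \esum_(x in S) (a x)%:E)%E ->
  exists F : {fset T}, (forall x, x \in F -> S x) /\ r < \sum_(x <- F) a x.
Proof.
move=> /ereal_sup_gt[_ [D [finD DS] <-]]; rewrite fsbig_finite// sumEFin lte_fin => h.
by exists (fset_set D); split => // x; rewrite in_fset_set// inE => /DS.
Qed.

End esum_fset_sums.

Section fint_fsets.
Variables (R : realType) (G : topologicalGroupoidType).
Local Notation C := R[i].
Implicit Types (f : G -> C) (a b c x : G).

Lemma fint_sub_fset (V : lmodType C) x f (F : G -> V) (S : {fset G}) :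
  (forall a, a \in S -> grange a = x) ->
  (forall a, grange a = x -> f a != 0 -> a \in S) ->
  fint x f F = \sum_(a <- S) f a *: F a.
Proof.
move=> Sx fS; rewrite (@fint_finite _ _ _ x f F [set` S])//; by rewrite set_fsetK.
Qed.

End fint_fsets.

Section sqrt_estimate.
Variables (R : realType) (T : choiceType).

(** Termwise [2 sqrt p sqrt q >= p + q - |p - q|], and [|p - q|] is at most
    [|P - Q| + (P - p) + (Q - q)]. *)
Lemma sqrt_overlap (S : {fset T}) (P Q p q : T -> R) (e : R) :
  (forall b, 0 <= p b <= P b) -> (forall b, 0 <= q b <= Q b) ->
  \sum_(b <- S) P b <= 1 -> \sum_(b <- S) Q b <= 1 ->
  1 - e <= \sum_(b <- S) p b -> 1 - e <= \sum_(b <- S) q b ->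
  \sum_(b <- S) `|P b - Q b| <= e ->
  1 - 3 * e <= \sum_(b <- S) Num.sqrt (p b) * Num.sqrt (q b).
Proof.
move=> pP qQ SP SQ Sp Sq SPQ.
have : \sum_(b <- S) (p b + q b - `|P b - Q b| - (P b - p b) - (Q b - q b)) <=
    \sum_(b <- S) 2 * (Num.sqrt (p b) * Num.sqrt (q b)).
  apply: ler_sum => b _; have /andP[p0 pPb] := pP b; have /andP[q0 qQb] := qQ b.
  have := sqr_sqrtr p0; have := sqr_sqrtr q0; rewrite !expr2.
  have := sqrtr_ge0 (p b); have := sqrtr_ge0 (q b).
  set u := Num.sqrt (p b); set v := Num.sqrt (q b) => v0 u0 vv uu.
  have h1 : P b - Q b <= `|P b - Q b| by exact: ler_norm.
  have h2 : Q b - P b <= `|P b - Q b| by rewrite distrC ler_norm.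
  have [uv|uv] := leP u v.
    have : u * (v - u) >= 0 by rewrite mulr_ge0// subr_ge0.
    have : 0 <= (v - u) * v by rewrite mulr_ge0// subr_ge0.
    lra.
  have : v * (u - v) >= 0 by rewrite mulr_ge0// subr_ge0 ltW.
  have : 0 <= (u - v) * u by rewrite mulr_ge0// subr_ge0 ltW.
  lra.
have e0 : 0 <= e by apply: le_trans SPQ; rewrite sumr_ge0.
rewrite -mulr_sumr !sumrB big_split/=; lra.
Qed.

Lemma sqrt_overlap_le (S : {fset T}) (p q : T -> R) :
  (forall b, 0 <= p b) -> (forall b, 0 <= q b) ->
  \sum_(b <- S) p b <= 1 -> \sum_(b <- S) q b <= 1 ->
  \sum_(b <- S) Num.sqrt (p b) * Num.sqrt (q b) <= 1.
Proof.
move=> p0 q0 Sp Sq; apply: (@le_trans _ _ (\sum_(b <- S) (2^-1 * p b + 2^-1 * q b))).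
  apply: ler_sum => b _; have := sqr_sqrtr (p0 b); have := sqr_sqrtr (q0 b); rewrite !expr2.
  have := sqr_ge0 (Num.sqrt (p b) - Num.sqrt (q b)); rewrite expr2; lra.
rewrite big_split/= -!mulr_sumr; lra.
Qed.

End sqrt_estimate.

Section amenability.
Variables (R : realType) (G : topologicalGroupoidType).
Hypothesis G_etale : etale G.
Hypothesis G_hausdorff : hausdorff_space G.
Hypothesis G_lc : locally_compact [set: G].
Local Notation C := R[i].
Local Notation toC p := (fun x => (p x)%:C%C : C).
Implicit Types (f : G -> C) (a b c x y : G).

Lemma exists_cutoff (K : set G) : compact K ->
  exists2 t : G -> R, bump_in setT t & forall x, K x -> t x = 1.
Proof.
move=> cK; have [|s [p [h1 h2 h3]]] := partition_of_unity R G_hausdorff G_lc (U := fun=> setT) cK.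
  by move=> x _; split => //; exact: openT.
exists (fun x => \sum_(i <- s) p i x) => //; split.
- by apply: continuous_sum_seq => i /h1[_ []].
- by move=> x; rewrite big_seq sumr_ge0// => i /h1[_ []].
- exact: h2.
- have key (t : seq G) : {subset t <= s} -> supported_in setT (fun x => \sum_(i <- t) p i x).
    elim: t => [_|i t ih ts]; first by under eq_fun do rewrite big_nil; exact: supported_in0.
    under eq_fun do rewrite big_cons; apply: supported_inD.
      by have [_ []] := h1 i (ts _ (mem_head _ _)).
    by apply: ih => j jt; apply: ts; rewrite inE jt orbT.
  exact: key.
Qed.

Section one_system.
Variable lam : G -> G -> R.
Hypothesis lam_system : continuous_probability_system lam.

(** The measures live on disjoint fibres, hence make up one function on [G]. *)
Definition weight a := lam (grange a) a.

Lemma weight_ge0 a : 0 <= weight a.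
Proof. by have [h _] := lam_system; have [h1 _ _] := h _ (gunits_range a); exact: h1. Qed.

Lemma weight_sum_le x (S : {fset G}) : (forall a, a \in S -> grange a = x) ->
  \sum_(a <- S) weight a <= 1.
Proof.
move=> Sx; have [->|/fset0Pn[a aS]] := eqVneq S fset0; first by rewrite big_seq_fset0 ler01.
have ux : gunits x by rewrite -(Sx _ aS); exact: gunits_range.
have [/(_ _ ux)[_ _ h] _] := lam_system.
rewrite -lee_fin -h; have := @esum_ge_fset R G (grange_fiber x) (lam x) S Sx.
by rewrite (eq_big_seq weight)// => b bS; rewrite /weight (Sx _ bS).
Qed.

Lemma weight_sum_gt x (e : R) : gunits x -> 0 < e ->
  exists S : {fset G}, (forall a, a \in S -> grange a = x) /\ 1 - e < \sum_(a <- S) weight a.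
Proof.
move=> ux e0; have [/(_ _ ux)[_ _ h] _] := lam_system.
have [|F [Fx hF]] := @esum_gt_fset R G (grange_fiber x) (lam x) (1 - e).
  by rewrite h lte_fin; lra.
exists F; split => //; rewrite (eq_big_seq (lam x))// => b bS.
by rewrite /weight (Fx _ bS).
Qed.

Lemma fibre_weight_continuous f x : gunits x -> Cc f ->
  {for x, continuous (fun x => fint x f (toC weight))}.
Proof.
move=> ux fC; have [_ /(_ f fC) fc] := lam_system.
move=> N; rewrite /= => Nx; suff : nbhs x [set y | N (fint y f (toC weight))] by [].
have E y : fint y f (toC weight) = \sum_(a \in grange_fiber y) f a * (lam y a)%:C%C.
  by apply: eq_fsbigr => a; rewrite inE => <-.
rewrite E in Nx; have h := within_continuous_nbhs fc ux Nx.
have ou : nbhs x (@gunits G) by apply: open_nbhs_nbhs; split => //; exact: gunits_open.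
by apply: filterS2 ou h => y uy /(_ uy); rewrite /= E.
Qed.

(** The integrals of a bump on a bisection are the products of the bump with the
    weight, read along the range map. *)
Lemma weight_continuous : continuous weight.
Proof.
move=> a; have [U [bU Ua _]] := exists_bisection G_etale openT (I : setT a).
have [b bb ba] := exists_bump R G_hausdorff G_lc (bisection_open bU) Ua.
have bC := bump_Ccin bb; have [bc _ _ _] := bb.
have bU0 c : ~ U c -> toC b c = 0 by move=> nU; exact: (Ccin_out bC nU).
pose F c := complex.Re (fint (grange c) (toC b) (toC weight)) / b c.
apply: (@continuous_near _ _ _ F).
  have n1 : nbhs a U by apply: open_nbhs_nbhs; split => //; exact: bisection_open bU.
  have n2 : nbhs a (b @^-1` [set r | 0 < r]).
    apply: (nbhs_preimage (bc a)); rewrite ba.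
    apply: (@open_nbhs_nbhs _ (1 : R) [set r | 0 < r]).
    by split; [exact: open_gt|rewrite /= ltr01].
  apply: filterS2 n1 n2 => c Uc /= bc0; rewrite /F (fint_bisection _ bU bU0 Uc)//=.
  by rewrite !mul0r subr0 mulrC mulKf// gt_eqF.
have h1 : {for a, continuous (fun c => fint (grange c) (toC b) (toC weight))}.
  apply: (@continuous_at_comp _ _ _ (@grange G) (fun x => fint x (toC b) (toC weight))).
    exact: grange_continuous.
  by apply: fibre_weight_continuous; [exact: gunits_range|exact: Ccin_Cc bC].
apply: continuousM.
  apply: (continuous_at_comp h1 (g := fun z : C => complex.Re z)); exact: continuous_Re.
by apply: continuousV; [rewrite ba oner_eq0|exact: bc].
Qed.

(** At each unit a finite set carries most of the mass; by continuity, a cutoff that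
    is [1] on this set still captures it at nearby units. *)
Lemma weight_tight (K : set G) (e : R) : compact K -> K `<=` @gunits G -> 0 < e ->
  exists2 t : G -> R, bump_in setT t & forall x (S : {fset G}), K x ->
    (forall a, a \in S -> grange a = x) ->
    (forall a, grange a = x -> t a != 0 -> a \in S) ->
    1 - e <= \sum_(a <- S) t a * weight a.
Proof.
move=> cK Ku e0.
have tsum (t : G -> R) x (S : {fset G}) : (forall a, a \in S -> grange a = x) ->
    (forall a, grange a = x -> t a != 0 -> a \in S) ->
    complex.Re (fint x (toC t) (toC weight)) = \sum_(a <- S) t a * weight a.
  move=> Sx tS; rewrite (@fint_sub_fset _ _ _ x (toC t) _ S)//.
    have -> : \sum_(a <- S) (t a)%:C%C *: ((weight a)%:C%C : C) = (\sum_(a <- S) t a * weight a)%:C%C.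
      by rewrite rmorph_sum; apply: eq_bigr => a _; rewrite rmorphM.
    by [].
  by move=> a ax ta; apply: tS => //; apply: contra_neq ta => ->.
have /choice[T hT] : forall x, exists t : G -> R, K x -> bump_in setT t /\
    nbhs x [set y | 1 - e < complex.Re (fint y (toC t) (toC weight))].
  move=> x; have [Kx|nK] := pselect (K x); last by exists (fun=> 0).
  have [S [Sx hS]] := weight_sum_gt (Ku _ Kx) e0.
  have [t tb t1] := exists_cutoff (finite_compact (finite_fset S)).
  exists t => _; split => //.
  have tC := Ccin_Cc G_hausdorff (bump_Ccin tb).
  have hc := fibre_weight_continuous (Ku _ Kx) tC.
  have h : {for x, continuous (fun y => complex.Re (fint y (toC t) (toC weight)))}.
    by apply: (continuous_at_comp hc (g := fun z : C => complex.Re z)); exact: continuous_Re.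
  suff lt : 1 - e < complex.Re (fint x (toC t) (toC weight)).
    apply: (h [set r | 1 - e < r]); apply: open_nbhs_nbhs; split => //; exact: open_gt.
  have [s [hs _]] := fint_fset C x (Cc_fibre_finite G_etale G_hausdorff G_lc tC).
  have t0 a : 0 <= t a by case: tb.
  rewrite (tsum t x (S `|` s)%fset); last 2 first.
  - by move=> a; rewrite inE => /orP[/Sx//|]; rewrite hs => /andP[/eqP].
  - move=> a ax ta; rewrite inE hs ax eqxx/=; apply/orP; right.
    by apply: contra_neq ta => /complexI.
  apply: (lt_le_trans hS).
  apply: (@le_trans _ _ (\sum_(a <- S) t a * weight a)).
    by rewrite big_seq [leRHS]big_seq; apply: ler_sum => a aS; rewrite t1// mul1r.
  apply: sum_fset_le; first by move=> a; rewrite mulr_ge0 ?weight_ge0.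
  by apply/fsubsetP => a aS; rewrite inE aS.
have [x Kx|s [sK hs]] := compact_finite_cover
    (f := fun x => [set y | 1 - e < complex.Re (fint y (toC (T x)) (toC weight))]) cK.
  by have [] := hT x Kx.
have [L [cL _ hL]] : supported_in setT (fun a => \sum_(i <- s) T i a).
  have key (u : seq G) : {subset u <= s} -> supported_in setT (fun x => \sum_(i <- u) T i x).
    elim: u => [_|i u ih us]; first by under eq_fun do rewrite big_nil; exact: supported_in0.
    under eq_fun do rewrite big_cons; apply: supported_inD.
      by have [[]] := hT i (sK _ (us _ (mem_head _ _))).
    by apply: ih => j jt; apply: us; rewrite inE jt orbT.
  exact: key.
have [t tb t1] := exists_cutoff cL; exists t => // x S Kx Sx tS.
have [i iS hi] := hs x Kx; have [[_ Ti0 Ti1 _] _] := hT i (sK _ iS).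
have TL a : T i a != 0 -> t a = 1.
  move=> Ta; apply: t1; apply: hL; rewrite gt_eqF// (big_rem i)//= ltr_pwDl//.
    by rewrite lt_neqAle eq_sym Ta Ti0.
  rewrite big_seq sumr_ge0// => j /mem_rem js; by have [[_ h _ _] _] := hT j (sK _ js).
have t0 a : 0 <= t a by case: tb.
rewrite (le_trans (ltW hi))// (tsum (T i) x S)//.
  apply: ler_sum => a _; rewrite ler_wpM2r ?weight_ge0//.
  by have [->|/TL ->] := eqVneq (T i a) 0.
by move=> a ax /TL ta; apply: tS => //; rewrite ta oner_eq0.
Qed.

End one_system.

Definition subunital (xi : G -> R) := forall x (S : {fset G}),
  (forall a, a \in S -> grange a = x) -> \sum_(a <- S) xi a ^+ 2 <= 1.

(** The value of [xi * xi^*] at [c] is the inner product of [xi] on one fibre with the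
    translate by [c] of [xi] on another; [S] contains the support of both. *)
Lemma overlap_fset (xi : G -> R) c : Ccin setT (toC xi) -> exists S : {fset G}, [/\
  forall b, b \in S -> grange b = gsource c,
  forall b, grange b = gsource c -> (xi b != 0) || (xi (gmul c b) != 0) -> b \in S &
  convolution (toC xi) (fun_star (toC xi)) c = (\sum_(b <- S) xi (gmul c b) * xi b)%:C%C].
Proof.
move=> xC; have ff := Cc_fibre_finite G_etale G_hausdorff G_lc (Ccin_Cc G_hausdorff xC).
have [s1 [h1 _]] := fint_fset C (gsource c) ff; have [s2 [h2 _]] := fint_fset C (grange c) ff.
pose S := (s1 `|` [fset gmul (ginv c) a | a in s2])%fset.
have Sr b : b \in S -> grange b = gsource c.
  rewrite inE h1 => /orP[/andP[/eqP//]|/imfsetP[/= a]].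
  by rewrite h2 => /andP[/eqP ac _] ->; rewrite grange_divl.
have S_supp b : grange b = gsource c -> (xi b != 0) || (xi (gmul c b) != 0) -> b \in S.
  move=> bc /orP[xb|xcb]; rewrite inE.
    by rewrite h1 bc eqxx/=; apply/orP; left; apply: contra_neq xb => /complexI.
  apply/orP; right; apply/imfsetP; exists (gmul c b); last by rewrite /= gmulKg.
  by rewrite /= h2 grangeM// eqxx/=; apply: contra_neq xcb => /complexI.
exists S; split => //.
rewrite convolution_starE fint_shift (fint_sub_fset _ (S := S))//; last first.
  move=> b bc nb; apply: S_supp => //; apply/orP; right; apply: contra_neq nb => xb.
  by rewrite xb.
rewrite rmorph_sum big_seq [RHS]big_seq; apply: eq_bigr => b bS.
by rewrite gmulKg ?(Sr _ bS)// conjC_realc rmorphM.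
Qed.

Lemma sum_fset_translate (F : G -> R) c (S : {fset G}) : (forall b, b \in S -> grange b = gsource c) ->
  \sum_(b <- S) F (gmul c b) = \sum_(a <- [fset gmul c b | b in S]%fset) F a.
Proof.
move=> Sc; rewrite big_imfset//= => a b aS bS; apply: gmulgI.
  by rewrite (Sc _ aS).
by rewrite (Sc _ bS).
Qed.

Lemma fset_translate_range c (S : {fset G}) : (forall b, b \in S -> grange b = gsource c) ->
  forall a, a \in [fset gmul c b | b in S]%fset -> grange a = grange c.
Proof. by move=> Sc a /imfsetP[/= b bS ->]; rewrite grangeM// (Sc _ bS). Qed.

Lemma overlap_le1 (xi : G -> R) c : Ccin setT (toC xi) -> (forall a, 0 <= xi a) -> subunital xi ->
  exists2 r : R, convolution (toC xi) (fun_star (toC xi)) c = r%:C%C & 0 <= r <= 1.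
Proof.
move=> xC x0 xs; have [S [Sc _ ->]] := overlap_fset c xC.
exists (\sum_(b <- S) xi (gmul c b) * xi b) => //.
rewrite sumr_ge0/=; last by move=> b _; rewrite mulr_ge0.
have E a : xi a = Num.sqrt (xi a ^+ 2) by rewrite sqrtr_sqr ger0_norm.
under eq_bigr => b _ do rewrite [xi (gmul c b)]E [xi b]E.
apply: sqrt_overlap_le => [b|b||]; rewrite ?sqr_ge0//; last exact: xs Sc.
rewrite (sum_fset_translate (fun a => xi a ^+ 2) Sc).
exact: xs (fset_translate_range Sc).
Qed.

(** Square roots turn measures that are close in [l^1] norm into vectors of overlap
    close to [1], by [sqrt_overlap]; the cutoff [t], chosen by tightness, makes them
    compactly supported at the cost of a little mass. *)
Theorem amenable_overlap : amenable R G -> forall (K : set G) (e : R), compact K -> 0 < e ->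
  exists xi : G -> R, [/\ Ccin setT (toC xi), forall a, 0 <= xi a, subunital xi &
    forall c, K c -> rnorm (1 - convolution (toC xi) (fun_star (toC xi)) c) <= e].
Proof.
move=> [I [le [lam [dir lam_sys lam_inv]]]] K e cK e0.
have e3 : 0 < e / 3 by rewrite divr_gt0.
have [i0 hi0] := lam_inv K cK (e / 3) e3.
have /hi0 hc : le i0 i0 by case: dir.
move: (lam i0) (lam_sys i0) hc => mu mu_sys mu_inv {lam lam_sys lam_inv hi0 dir}.
pose KU := (@grange G @` K) `|` (@gsource G @` K).
have cKU : compact KU.
  by apply: compactU; apply: compact_image => //; [exact: grange_continuous|exact: gsource_continuous].
have [|t tb ht] := weight_tight mu_sys cKU _ e3.
  by move=> _ [[a _ <-]|[a _ <-]]; [exact: gunits_range|exact: gunits_source].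
have [tc t0 t1 tsup] := tb.
pose m a := t a * weight mu a; pose xi a := Num.sqrt (m a).
have w0 a : 0 <= weight mu a by exact: weight_ge0.
have m0 a : 0 <= m a by rewrite mulr_ge0.
have mw a : m a <= weight mu a by rewrite -[leRHS]mul1r ler_wpM2r.
have wc := weight_continuous mu_sys.
have xic : continuous xi.
  move=> a; have mc : {for a, continuous m} by apply: continuousM; [exact: tc|exact: wc].
  by apply: (continuous_at_comp mc); exact: sqrt_continuous.
have xi_t a : xi a != 0 -> t a != 0.
  by apply: contra_neq => ta; rewrite /xi /m ta mul0r sqrtr0.
have xC : Ccin setT (toC xi).
  split; first exact: realC_continuous.
  by apply: supported_in_sub tsup => a nx; apply: xi_t; apply: contra_neq nx => ->.
have xs : subunital xi.
  move=> x S Sx; rewrite (le_trans _ (weight_sum_le mu_sys Sx))//.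
  by apply: ler_sum => a _; rewrite sqr_sqrtr.
exists xi; split => // [a|c Kc]; first exact: sqrtr_ge0.
have tC := bump_Ccin tb.
have [S [Sc Ssupp _]] := overlap_fset c tC.
have [r Er /andP[r0 r1]] := overlap_le1 c xC (fun a => sqrtr_ge0 _) xs.
have ES : r = \sum_(b <- S) xi (gmul c b) * xi b.
  apply: complexI; rewrite -Er convolution_starE fint_shift (fint_sub_fset _ (S := S))//.
    rewrite rmorph_sum big_seq [RHS]big_seq; apply: eq_bigr => b bS.
    by rewrite gmulKg ?(Sc _ bS)// conjC_realc rmorphM.
  move=> b bc nb; apply: Ssupp => //; apply/orP; right; apply: xi_t.
  by apply: contra_neq nb => ->.
have rc := fset_translate_range Sc.
have h : 1 - 3 * (e / 3) <= r.
  rewrite ES; apply: (@sqrt_overlap _ _ _ (fun b => weight mu (gmul c b)) (weight mu)).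
  - by move=> b; rewrite m0 mw.
  - by move=> b; rewrite m0 mw.
  - by rewrite sum_fset_translate//; exact: (weight_sum_le mu_sys rc).
  - exact: (weight_sum_le mu_sys Sc).
  - rewrite (sum_fset_translate m Sc); apply: (ht (grange c)) => //; first by left; exists c.
    move=> a ac ta; apply/imfsetP; exists (gmul (ginv c) a); last by rewrite /= gmulVKg.
    by apply: Ssupp; [rewrite grange_divl|rewrite gmulVKg// ta orbT].
  - apply: (ht (gsource c)) => //; first by right; exists c.
    by move=> a ac ta; apply: Ssupp => //; rewrite ta.
  - rewrite -lee_fin; apply: le_trans (ltW (mu_inv c Kc)).
    rewrite (eq_big_seq (fun b => `|mu (grange c) (gmul c b) - mu (gsource c) b|)).
      exact: (@esum_ge_fset R G (grange_fiber (gsource c)) (fun a => `|mu (grange c) (gmul c a) - mu (gsource c) a|)).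
    by move=> b bS; rewrite /weight grangeM ?(Sc _ bS).
rewrite Er -(rmorphB (real_complex R) 1) rnormC ger0_norm ?subr_ge0//; lra.
Qed.

End amenability.

(** * Decomposing an overlap along bisections *)

Lemma sum_single (V : nmodType) (T : choiceType) (J : {fset T}) (F : T -> V) t : t \in J ->
  (forall u, u \in J -> u != t -> F u = 0) -> \sum_(u <- J) F u = F t.
Proof.
move=> tJ h; rewrite (bigD1_seq t)//= big1_seq ?addr0// => u /andP[ut uJ]; exact: h.
Qed.

Lemma hausdorff_separate_fset (X : topologicalType) (J : {fset X}) : hausdorff_space X ->
  exists V : X -> set X, (forall a, nbhs a (V a)) /\
    forall a b, a \in J -> b \in J -> a != b -> forall z, V a z -> ~ V b z.
Proof.
move=> hX.
have /choice[P hP] : forall p : X * X, exists AB : set X * set X, p.1 <> p.2 ->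
    [/\ nbhs p.1 AB.1, nbhs p.2 AB.2 & forall z, AB.1 z -> ~ AB.2 z].
  move=> [a b]; have [ab|ab] := pselect (a = b); first by exists (setT, setT).
  have [A [B [oA oB Aa Bb AB]]] := hausdorff_separate hX ab.
  by exists (A, B) => _; split => //; apply: open_nbhs_nbhs.
exists (fun a => \bigcap_(b in [set` J]) [set z | a <> b -> (P (a, b)).1 z /\ (P (b, a)).2 z]); split.
  move=> a; apply: filter_bigI => b bJ.
  have [ab|ab] := pselect (a = b); first by apply: filterE => z.
  have [h1 _ _] := hP (a, b) ab; have ba : b <> a by move=> e; apply: ab.
  have [_ h2 _] := hP (b, a) ba.
  by apply: filterS2 h1 h2 => z z1 z2 _.
move=> a b aJ bJ /eqP ab z Va Vb; have ba : b <> a by move=> e; apply: ab.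
have [za _] := Va b bJ ab; have [_ zb] := Vb a aJ ba.
by have [_ _ h] := hP (a, b) ab; exact: (h z).
Qed.

Section local_decomposition.
Variables (R : realType) (G : topologicalGroupoidType).
Hypothesis G_etale : etale G.
Hypothesis G_hausdorff : hausdorff_space G.
Hypothesis G_lc : locally_compact [set: G].
Local Notation C := R[i].
Local Notation toC p := (fun x => (p x)%:C%C : C).
Implicit Types (f : G -> C) (a b c x y u : G).

Lemma compact_source_fibre_finite (K : set G) u : compact K ->
  finite_set [set a | K a /\ gsource a = u].
Proof.
move=> cK; have cK' : compact (@ginv G @` K) by apply: compact_image => //; exact: ginv_continuous.
have [t tb t1] := exists_cutoff R G_hausdorff G_lc cK'.
have tC := Ccin_Cc G_hausdorff (bump_Ccin tb).
have ff := Cc_fibre_finite G_etale G_hausdorff G_lc tC u.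
apply: (@sub_finite_set _ _ (@ginv G @` [set a | grange a = u /\ (t a)%:C%C != 0 :> C])).
  move=> a [Ka au]; exists (ginv a); last by rewrite ginvK.
  split; first by rewrite grange_inv.
  by rewrite t1 ?oner_eq0//; exists a.
exact: finite_image.
Qed.

(** The finitely many points of [K] above [u] lie in disjoint bisections, on pairs of
    which [f (a b^-1)] is nearly constant; the rest of [K] is compact, and so is its
    image by the source map, which avoids [u]. *)
Lemma local_sheets (K : set G) f (e : R) u : compact K -> continuous f -> 0 < e ->
  exists (W : set G) (J : {fset G}) (B : G -> set G), [/\
    open W /\ W u,
    forall a, a \in J -> gsource a = u /\ bisection (B a),
    forall a b, a \in J -> b \in J -> a != b -> forall z, B a z -> ~ B b z,
    forall a, K a -> W (gsource a) -> exists2 b, b \in J & B b a &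
    forall a b, a \in J -> b \in J -> forall a' b', B a a' -> B b b' ->
      gsource a' = gsource b' -> rnorm (f (gmul a' (ginv b')) - f (gmul a (ginv b))) <= e].
Proof.
move=> cK fc e0.
have fin := compact_source_fibre_finite u cK.
pose J := fset_set [set a | K a /\ gsource a = u].
have Ju a : a \in J -> gsource a = u by rewrite in_fset_set// inE => -[].
have JK a : K a -> gsource a = u -> a \in J by move=> Ka au; rewrite in_fset_set// inE.
have [V [nV dV]] := hausdorff_separate_fset J G_hausdorff.
have /choice[P hP] : forall p : G * G, exists AB : set G * set G, gsource p.1 = gsource p.2 ->
    [/\ nbhs p.1 AB.1, nbhs p.2 AB.2 & forall a' b', AB.1 a' -> AB.2 b' ->
      gsource a' = gsource b' -> rnorm (f (gmul a' (ginv b')) - f (gmul p.1 (ginv p.2))) <= e].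
  move=> [a b]; have [ab|ab] := pselect (gsource a = gsource b); last by exists (setT, setT).
  have ab' : gsource a = grange (ginv b) by rewrite grange_inv.
  have nf : nbhs (gmul a (ginv b)) [set c | rnorm (f c - f (gmul a (ginv b))) <= e].
    have := (iffLR (continuous_rnormP f (gmul a (ginv b))) (fc _)) e e0.
    by apply: filterS => c h; rewrite /= rnormBC ltW.
  have [A [B [nA nB AB]]] := gmul_cont_at ab' nf.
  exists (A, @ginv G @^-1` B) => _; split => //.
    by apply: nbhs_preimage nB; exact: ginv_continuous.
  by move=> a' b' Aa Bb ss; apply: AB => //; rewrite grange_inv.
pose N a := V a `&` \bigcap_(b in [set` J]) ((P (a, b)).1 `&` (P (b, a)).2).
have nN a : a \in J -> nbhs a (N a).
  move=> aJ; apply: filterI => //; apply: filter_bigI => b bJ.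
  have [h1 _ _] := hP (a, b) (etrans (Ju _ aJ) (esym (Ju _ bJ))).
  have [_ h2 _] := hP (b, a) (etrans (Ju _ bJ) (esym (Ju _ aJ))).
  exact: filterI.
have /choice[B hB] : forall a, exists B, a \in J -> [/\ bisection B, B a & B `<=` N a].
  move=> a; have [aJ|aJ] := boolP (a \in J); last by exists set0.
  have [B [bB Ba BN]] := exists_bisection G_etale (@open_interior _ (N a)) (nN a aJ).
  by exists B => _; split => //; exact: subset_trans BN (@interior_subset _ _).
pose O := \bigcup_(a in [set` J]) B a.
have oO : open O by apply: bigcup_open => a /= aJ; have [[]] := hB a aJ.
have cKO : compact (@gsource G @` (K `&` ~` O)).
  apply: compact_image; first exact: gsource_continuous.
  by apply: compact_closedI => //; exact: open_closedC.
exists (~` (@gsource G @` (K `&` ~` O))), J, B; split.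
- split; first by apply: closed_openC; exact: (compact_closed G_hausdorff cKO).
  move=> [a [Ka nO] au]; apply: nO; have aJ := JK _ Ka au.
  by exists a => //; have [] := hB a aJ.
- by move=> a aJ; split; [exact: Ju|have [] := hB a aJ].
- move=> a b aJ bJ ab z Bz Bz'; have [_ _ h1] := hB a aJ; have [_ _ h2] := hB b bJ.
  by have [Vz _] := h1 z Bz; have [Vz' _] := h2 z Bz'; exact: (dV a b aJ bJ ab z).
- move=> a Ka nW; have [[b /= bJ Bb]|nO] := pselect (O a); first by exists b.
  by exfalso; apply: nW; exists a.
- move=> a b aJ bJ a' b' Ba Bb ss; have [_ _ h1] := hB a aJ; have [_ _ h2] := hB b bJ.
  have [_ /(_ b bJ)[p1 _]] := h1 a' Ba; have [_ /(_ a aJ)[_ p2]] := h2 b' Bb.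
  have [_ _ h] := hP (a, b) (etrans (Ju _ aJ) (esym (Ju _ bJ))).
  exact: h.
Qed.

(** [V] and [V'] are open and disjoint, so that cutting to [V] creates no
    discontinuity on their union. *)
Lemma Ccin_cut (V V' : set G) f : open V -> open V' -> (forall z, V z -> ~ V' z) ->
  Ccin (V `|` V') f -> Ccin V (fun a => if `[< V a >] then f a else 0).
Proof.
move=> oV oV' VV' [fc [K [cK KV fK]]].
apply: (Ccin_intro (K := K `&` ~` V')).
- suff key (a : G) : {for a, continuous (fun a => if `[< V a >] then f a else 0 : C)} by move=> a; exact: key.
  have [Va|nVa] := pselect (V a).
    apply: (@continuous_near _ _ _ f); last exact: fc.
    have : nbhs a V by apply: open_nbhs_nbhs.
    by apply: filterS => b Vb; rewrite asboolT.
  apply: (@continuous_near _ _ _ (fun=> 0)); last exact: cst_continuous.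
  have [V'a|nV'a] := pselect (V' a).
    have : nbhs a V' by apply: open_nbhs_nbhs.
    by apply: filterS => b V'b; rewrite asboolF// => Vb; exact: (VV' b).
  have : \forall b \near a, f b = 0.
    by apply: (supported_in_near G_hausdorff (U := V `|` V')); [exists K|move=> []].
  by apply: filterS => b ->; rewrite if_same.
- by apply: compact_closedI => //; exact: open_closedC.
- by move=> a [/KV[]].
- move=> a; case: asboolP => [Va fa|]; last by rewrite eqxx.
  by split; [exact: fK|exact: VV'].
Qed.

(** A partition of unity by small sets of units, near each of which the support of
    [xi] splits into sheets, writes [xi (x) xi] as a finite sum of rank-one pieces
    carried by pairs of sheets. *)
Lemma overlap_decomposition (xi : G -> R) f (e : R) : Ccin setT (toC xi) -> (forall a, 0 <= xi a) ->
  continuous f -> 0 < e ->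
  exists (s : seq G) (J : G -> {fset G}) (B : G -> G -> set G) (X : G -> G -> G -> R), [/\
    forall t a, t \in s -> a \in J t ->
      [/\ gsource a = t, bisection (B t a), Ccin (B t a) (toC (X t a)) & forall b, 0 <= X t a b],
    forall a b, gsource a = gsource b ->
      \sum_(t <- s) \sum_(j <- J t) \sum_(k <- J t) X t j a * X t k b = xi a * xi b,
    forall a, \sum_(t <- s) \sum_(j <- J t) X t j a * X t j a = xi a * xi a,
    forall t j a, X t j a != 0 -> xi a != 0 &
    forall t j k a b, t \in s -> j \in J t -> k \in J t -> gsource a = gsource b ->
      X t j a != 0 -> X t k b != 0 ->
      rnorm (f (gmul a (ginv b)) - f (gmul j (ginv k))) <= e].
Proof.
move=> xC x0 fc e0; have [K cK xK'] := Cc_support G_hausdorff (Ccin_Cc G_hausdorff xC).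
have xK a : xi a != 0 -> K a.
  by move=> xa; apply: xK'; apply: contra_neq xa => /complexI.
have /choice[D hD] : forall u, exists D : set G * {fset G} * (G -> set G), [/\
    open D.1.1 /\ D.1.1 u,
    forall a, a \in D.1.2 -> gsource a = u /\ bisection (D.2 a),
    forall a b, a \in D.1.2 -> b \in D.1.2 -> a != b -> forall z, D.2 a z -> ~ D.2 b z,
    forall a, K a -> D.1.1 (gsource a) -> exists2 b, b \in D.1.2 & D.2 b a &
    forall a b, a \in D.1.2 -> b \in D.1.2 -> forall a' b', D.2 a a' -> D.2 b b' ->
      gsource a' = gsource b' -> rnorm (f (gmul a' (ginv b')) - f (gmul a (ginv b))) <= e].
  by move=> u; have [W [J [B h]]] := local_sheets u cK fc e0; exists (W, J, B).
pose W u := (D u).1.1; pose J u := (D u).1.2; pose B u := (D u).2.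
have csK : compact (@gsource G @` K) by apply: compact_image => //; exact: gsource_continuous.
have [|s [p [hp _ p1]]] := partition_of_unity R G_hausdorff G_lc (U := W) csK.
  by move=> u _; have [] := hD u.
(* square roots, so that the products [g t a * g t b] add up to [xi a * xi b] *)
pose g t a := Num.sqrt (p t (gsource a)) * xi a.
pose X t j a := if `[< B t j a >] then g t a else 0.
have p0 t u : t \in s -> 0 <= p t u by move=> /hp[_ []].
have pick t a : t \in s -> g t a != 0 ->
    exists2 j, j \in J t & forall k, k \in J t -> `[< B t k a >] = (k == j).
  move=> ts ga; have xa : xi a != 0 by apply: contra_neq ga => xa; rewrite /g xa mulr0.
  have pa : p t (gsource a) != 0.
    by apply: contra_neq ga => pa; rewrite /g pa sqrtr0 mul0r.
  have Wa : W t (gsource a).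
    have [_ [_ _ _ [L [_ LW pL]]]] := hp t ts; exact/LW/pL.
  have [_ _ dB cov _] := hD t.
  have [j jJ Bj] := cov a (xK _ xa) Wa; exists j => // k kJ.
  have [->|kj] := eqVneq k j; first by rewrite asboolT.
  by rewrite asboolF// => Bk; exact: (dB k j kJ jJ kj a).
have sumX t a : t \in s -> \sum_(j <- J t) X t j a = g t a.
  move=> ts; have [ga|ga] := eqVneq (g t a) 0.
    by rewrite big1// => j _; rewrite /X ga if_same.
  have [j jJ hj] := pick t a ts ga.
  rewrite (sum_single jJ); first by rewrite /X hj// eqxx.
  by move=> k kJ kj; rewrite /X hj// (negbTE kj).
have sumXX t a : t \in s -> \sum_(j <- J t) X t j a * X t j a = g t a * g t a.
  move=> ts; have [ga|ga] := eqVneq (g t a) 0.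
    by rewrite big1 ?ga ?mul0r// => j _; rewrite /X ga if_same mul0r.
  have [j jJ hj] := pick t a ts ga.
  rewrite (sum_single jJ); first by rewrite /X hj// eqxx.
  by move=> k kJ kj; rewrite /X hj// (negbTE kj) mul0r.
have sumg a b : gsource a = gsource b -> \sum_(t <- s) g t a * g t b = xi a * xi b.
  move=> ab; have [xa|xa] := eqVneq (xi a) 0.
    by rewrite xa mul0r big1// => t _; rewrite /g xa mulr0 mul0r.
  rewrite (eq_big_seq (fun t => p t (gsource a) * (xi a * xi b))); last first.
    move=> t ts; rewrite /g -ab mulrACA -expr2 sqr_sqrtr//; exact: p0.
  by rewrite -mulr_suml p1 ?mul1r//; exists a => //; exact: xK.
exists s, J, B, X; split.
- move=> t j ts jJ; have [_ hJ dB cov _] := hD t; have [js bB] := hJ j jJ.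
  split; [exact: js|exact: bB| |]; last first.
    by move=> b; rewrite /X; case: asboolP => // _; rewrite mulr_ge0// sqrtr_ge0.
  pose V' := \bigcup_(k in [set k | k \in J t /\ k != j]) B t k.
  have [_ pb] := hp t ts; have [pc _ _ [L [cL LW pL]]] := pb.
  have gC : Ccin (B t j `|` V') (toC (g t)).
    apply: (Ccin_intro (K := K `&` @gsource G @^-1` L)).
    + apply: realC_continuous => a.
      apply: (@continuousM R G (fun y => Num.sqrt (p t (gsource y))) xi); last first.
        by have xc := continuous_realC_inv (Ccin_continuous xC); exact: xc.
      have h1 : {for a, continuous (fun y => p t (gsource y))}.
        by apply: (continuous_at_comp (@gsource_continuous G a)); exact: pc.
      by apply: (continuous_at_comp h1); exact: sqrt_continuous.
    + apply: compact_closedI => //; apply: closed_preimage; first exact: gsource_continuous.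
      exact: (compact_closed G_hausdorff cL).
    + move=> a [Ka /LW Wa]; have [k kJ Bk] := cov a Ka Wa.
      have [kj|kj] := eqVneq k j; [left; rewrite -kj|right; exists k] => //.
    + move=> a ga; split.
        by apply: xK; apply: contra_neq ga => xa; rewrite /g xa mulr0.
      by apply: pL; apply: contra_neq ga => pa; rewrite /g pa sqrtr0 mul0r.
  have := @Ccin_cut (B t j) V' (toC (g t)) (bisection_open bB) _ _ gC.
  have -> : (fun a => if `[< B t j a >] then (g t a)%:C%C else 0) = toC (X t j).
    by apply/funext => a; rewrite /X; case: asboolP.
  apply.
    by apply: bigcup_open => k [kJ _]; have [_ bk] := hJ k kJ; exact: bisection_open bk.
  by move=> z Bz [k [kJ kj] Bk]; exact: (dB k j kJ jJ kj z).
- move=> a b ab; rewrite -sumg//; apply: eq_big_seq => t ts.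
  under eq_bigr do rewrite -mulr_sumr.
  by rewrite -mulr_suml !sumX.
- by move=> a; rewrite -sumg//; apply: eq_big_seq => t ts; exact: sumXX.
- move=> t j a; rewrite /X; case: asboolP => [_|]; last by rewrite eqxx.
  by apply: contra_neq => xa; rewrite /g xa mulr0.
- move=> t j k a b ts jJ kJ ab; rewrite /X.
  case: asboolP => [Ba _|]; last by rewrite eqxx.
  case: asboolP => [Bb _|]; last by rewrite eqxx.
  by have [_ _ _ _ h] := hD t; exact: h.
Qed.

End local_decomposition.

(** * Positive definite multipliers *)

Section multiplier.
Variables (R : realType) (G : topologicalGroupoidType).
Hypothesis G_etale : etale G.
Hypothesis G_hausdorff : hausdorff_space G.
Hypothesis G_lc : locally_compact [set: G].
Local Notation C := R[i].
Local Notation toC p := (fun x => (p x)%:C%C : C).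
Implicit Types (f : G -> C) (a b c x y u : G).

Lemma overlap_sum (c : G) (S : {fset G}) (p q : G -> R) :
  (forall b, b \in S -> grange b = gsource c) ->
  (forall b, grange b = gsource c -> p (gmul c b) != 0 -> b \in S) ->
  convolution (toC p) (fun_star (toC q)) c = (\sum_(b <- S) p (gmul c b) * q b)%:C%C.
Proof.
move=> Sc Sp; rewrite convolution_starE fint_shift (fint_sub_fset _ (S := S))//; last first.
  by move=> b bc nb; apply: Sp => //; apply: contra_neq nb => ->.
rewrite rmorph_sum big_seq [RHS]big_seq; apply: eq_bigr => b bS.
by rewrite gmulKg ?(Sc _ bS)// conjC_realc rmorphM.
Qed.

Section matrix_estimate.
Variables (H : hilbertType R) (pi : (G -> C) -> {linear H -> H}) (f : G -> C) (M : R).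
Hypothesis pi_rep : star_representation pi.
Hypothesis fC : Cc f.
Hypothesis M0 : 0 <= M.
Hypothesis fM : forall (L : hilbertType R) (la : (G -> C) -> {linear L -> L}) z,
  star_representation la -> rnorm (la f z) <= M * rnorm z.

Lemma delta_sum_norm (J : {fset G}) (v : G -> H) :
  rnorm (\sum_(k <- J) delta k (v k)) ^+ 2 = \sum_(k <- J) rnorm (v k) ^+ 2.
Proof.
apply: complexI; rewrite -hdotE hdot_sumr rmorph_sum big_seq [RHS]big_seq.
apply: eq_bigr => k kJ; rewrite hdot_delta l2_sum (sum_single kJ); last first.
  by move=> j jJ jk; rewrite deltaE eq_sym (negbTE jk).
by rewrite deltaE eqxx hdotE.
Qed.

(** The matrix [f (j k^-1)] on one source fibre is a corner of the regular
    representation on [H]-valued functions, so that it is bounded by [M] also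
    when its entries act on a Hilbert space. *)
Lemma fibre_matrix_bound (u : G) (J : {fset G}) (v w : G -> H) :
  (forall j, j \in J -> gsource j = u) ->
  rnorm (\sum_(j <- J) \sum_(k <- J) f (gmul j (ginv k)) * hdot (v k) (w j)) <=
  M * ((\sum_(k <- J) rnorm (v k) ^+ 2 + \sum_(j <- J) rnorm (w j) ^+ 2) / 2).
Proof.
move=> Ju; have [la [la_rep laE]] := regular_representation G_etale G_hausdorff G_lc H.
pose zv := \sum_(k <- J) delta k (v k); pose zw := \sum_(j <- J) delta j (w j).
have -> : \sum_(j <- J) \sum_(k <- J) f (gmul j (ginv k)) * hdot (v k) (w j) =
    hdot (la f zv) zw.
  rewrite hdot_sumr big_seq [RHS]big_seq; apply: eq_bigr => j jJ.
  rewrite hdot_delta /zv linear_sum l2_sum hdot_suml.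
  rewrite big_seq [RHS]big_seq; apply: eq_bigr => k kJ.
  by rewrite laE// (Ju _ jJ) (Ju _ kJ) eqxx hdotZl.
have := cauchy_schwarz (la f zv) zw; have := fM zv la_rep.
have := delta_sum_norm J v; have := delta_sum_norm J w; rewrite -/zv -/zw => <- <-.
have := rnorm_ge0 zv; have := rnorm_ge0 zw; have := rnorm_ge0 (la f zv).
set x := rnorm zv; set y := rnorm zw; set z := rnorm (la f zv) => z0 y0 x0 h1 h2.
have h3 : z * y <= M * x * y by rewrite ler_wpM2r.
have h4 : 0 <= M * ((x - y) ^+ 2) by rewrite mulr_ge0// sqr_ge0.
by rewrite !expr2 in h4 *; apply: le_trans h2 _; lra.
Qed.

Variables (xi : G -> R) (s : seq G) (J : G -> {fset G}) (B : G -> G -> set G).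
Variable X : G -> G -> G -> R.
Hypothesis xiC : Ccin setT (toC xi).
Hypothesis xi1 : subunital xi.
Hypothesis XB : forall t a, t \in s -> a \in J t ->
  [/\ gsource a = t, bisection (B t a), Ccin (B t a) (toC (X t a)) & forall b, 0 <= X t a b].
Hypothesis XX : forall a, \sum_(t <- s) \sum_(j <- J t) X t j a * X t j a = xi a * xi a.
Hypothesis Xxi : forall t j a, X t j a != 0 -> xi a != 0.

Let XC t k : t \in s -> k \in J t -> Cc (toC (X t k)).
Proof. by move=> ts kJ; have [_ _ h _] := XB ts kJ; exact: Ccin_Cc h. Qed.

Let piece t j k : G -> C := convolution (toC (X t j)) (fun_star (toC (X t k))).

Let pieceC t j k : t \in s -> j \in J t -> k \in J t -> Cc (piece t j k).
Proof.
move=> ts jJ kJ; apply: convolution_Cc => //; first exact: XC.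
by apply: fun_star_Cc => //; exact: XC.
Qed.

(** The functions [X * X^*] live on the units and add up to the fibrewise square
    norm of [xi], which is at most 1. *)
Lemma sheet_norm_le v : \sum_(t <- s) \sum_(k <- J t) rnorm (pi (fun_star (toC (X t k))) v) ^+ 2
  <= rnorm v ^+ 2.
Proof.
pose phi : G -> C := \sum_(t <- s | t \in s) \sum_(k <- J t | k \in J t) piece t k k.
have phiC : Cc phi.
  by apply: Cc_sum => // t ts; apply: Cc_sum => // k kJ; exact: pieceC.
have E : hdot (pi phi v) v =
    (\sum_(t <- s) \sum_(k <- J t) rnorm (pi (fun_star (toC (X t k))) v) ^+ 2)%:C%C.
  rewrite /phi (rep_sum G_hausdorff pi_rep); last first.
    by move=> t ts; apply: Cc_sum => // k kJ; exact: pieceC.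
  rewrite hdot_suml rmorph_sum [RHS]big_seq; apply: eq_bigr => t ts.
  rewrite (rep_sum G_hausdorff pi_rep); last by move=> k kJ; exact: pieceC.
  rewrite hdot_suml rmorph_sum [RHS]big_seq; apply: eq_bigr => k kJ.
  have h := rep_star_norm G_hausdorff pi_rep v (fun_star_Cc G_hausdorff (XC ts kJ)).
  by rewrite fun_starK in h; exact: h.
have phi_val c : exists2 r : R, phi c = r%:C%C & 0 <= r <= 1 /\ (~ gunits c -> r = 0).
  have [uc|nuc] := pselect (gunits c); last first.
    exists 0; last by rewrite lexx ler01.
    rewrite /phi fct_sumE big1// => t ts; rewrite fct_sumE big1// => k kJ.
    have [_ bB XBk _] := XB ts kJ.
    by apply: (convolution_star_off bB) => // a nB; exact: (Ccin_out XBk nB).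
  have [S [Sc Ss _]] := overlap_fset G_etale G_hausdorff G_lc c xiC.
  exists (\sum_(b <- S) xi b * xi b).
    rewrite /phi fct_sumE.
    have -> : \sum_(b <- S) xi b * xi b =
        \sum_(t <- s | t \in s) \sum_(k <- J t | k \in J t) \sum_(b <- S) X t k b * X t k b.
      under eq_bigr => b _ do rewrite -XX.
      rewrite exchange_big big_seq/=; apply: eq_bigr => t ts.
      by rewrite exchange_big big_seq.
    rewrite rmorph_sum; apply: eq_bigr => t ts; rewrite fct_sumE rmorph_sum; apply: eq_bigr => k kJ.
    rewrite /piece (overlap_sum (S := S))//; last first.
      by move=> b bc Xb; apply: Ss => //; rewrite (Xxi Xb) orbT.
    congr (_%:C)%C; rewrite big_seq [RHS]big_seq; apply: eq_bigr => b bS.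
    by rewrite -{1}(gunits_gsource uc) -(Sc _ bS) grangel.
  split => //; rewrite sumr_ge0/=; last by move=> b _; rewrite -expr2 sqr_ge0.
  by apply: (xi1 (x := gsource c)).
have /choice[p hp] : forall c, exists r : R, phi c = r%:C%C /\ (0 <= r <= 1 /\ (~ gunits c -> r = 0)).
  by move=> c; have [r ? ?] := phi_val c; exists r.
have phip : phi = toC p by apply/funext => c; have [] := hp c.
have pC : Ccin (@gunits G) (toC p).
  rewrite -phip; apply: Ccin_units => // x nu.
  by have [-> [_ /(_ nu) ->]] := hp x.
have p1 c : 0 <= p c <= 1 by have [_ []] := hp c.
have := rep_unit_dot G_etale G_hausdorff G_lc pi_rep v pC p1.
by rewrite -phip E.
Qed.

(** In the representation the sum is made of the matrices [f (j k^-1)] applied to the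
    vectors [pi(X_k)^* v]; by [sheet_norm_le] the squares of their norms add up to at
    most [|v|^2]. *)
Lemma main_term_bound v w :
  rnorm (hdot (pi (\sum_(t <- s | t \in s) \sum_(j <- J t | j \in J t) \sum_(k <- J t | k \in J t)
    f (gmul j (ginv k)) *: piece t j k) v) w) <= M * ((rnorm v ^+ 2 + rnorm w ^+ 2) / 2).
Proof.
have sC t k : t \in s -> k \in J t -> Cc (fun_star (toC (X t k))).
  by move=> ts kJ; apply: fun_star_Cc => //; exact: XC.
pose vv t k := pi (fun_star (toC (X t k))) v; pose ww t j := pi (fun_star (toC (X t j))) w.
have C3 t j k : t \in s -> j \in J t -> k \in J t -> Cc (f (gmul j (ginv k)) *: piece t j k).
  by move=> ts jJ kJ; apply: CcZ => //; exact: pieceC.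
have C2 t j : t \in s -> j \in J t ->
    Cc (\sum_(k <- J t | k \in J t) f (gmul j (ginv k)) *: piece t j k).
  by move=> ts jJ; apply: Cc_sum => // k kJ; exact: C3.
have -> : hdot (pi (\sum_(t <- s | t \in s) \sum_(j <- J t | j \in J t) \sum_(k <- J t | k \in J t)
    f (gmul j (ginv k)) *: piece t j k) v) w =
    \sum_(t <- s | t \in s) \sum_(j <- J t) \sum_(k <- J t) f (gmul j (ginv k)) * hdot (vv t k) (ww t j).
  rewrite (rep_sum G_hausdorff pi_rep); last first.
    by move=> t ts; apply: Cc_sum => // j jJ; exact: C2.
  rewrite hdot_suml; apply: eq_bigr => t ts.
  rewrite (rep_sum G_hausdorff pi_rep); last by move=> j jJ; exact: C2.
  rewrite hdot_suml [RHS]big_seq; apply: eq_bigr => j jJ.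
  rewrite (rep_sum G_hausdorff pi_rep); last by move=> k kJ; exact: C3.
  rewrite hdot_suml [RHS]big_seq; apply: eq_bigr => k kJ.
  rewrite (repZ G_hausdorff pi_rep); last exact: pieceC.
  rewrite hdotZl /piece (repM pi_rep); [|exact: XC|exact: sC].
  by rewrite (rep_star pi_rep)//; exact: XC.
rewrite (le_trans (rnorm_sum _ _ _))//.
apply: (@le_trans _ _ (\sum_(t <- s | t \in s) M * ((\sum_(k <- J t) rnorm (vv t k) ^+ 2 +
    \sum_(j <- J t) rnorm (ww t j) ^+ 2) / 2))).
  apply: ler_sum => t ts; apply: (@fibre_matrix_bound t) => j jJ.
  by have [] := XB ts jJ.
rewrite -big_seq -mulr_sumr -mulr_suml ler_wpM2l// ler_pM2r// big_split/=.
by rewrite lerD// sheet_norm_le.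
Qed.

End matrix_estimate.

(** [h f], with [h = xi * xi^*], differs from the sum bounded in [main_term_bound] by
    a function that is uniformly small and supported in a compact set depending only
    on [xi], hence of small norm. *)
Theorem multiplier_le (A : cstarAlgType R) (iota : (G -> C) -> A) (xi : G -> R) f :
  is_full_cstar_algebra iota -> Ccin setT (toC xi) -> (forall a, 0 <= xi a) -> subunital xi ->
  Cc f -> rnorm (iota (fun c => convolution (toC xi) (fun_star (toC xi)) c * f c)) <= rnorm (iota f).
Proof.
move=> A_full xC x0 x1 fC.
set h := convolution (toC xi) (fun_star (toC xi)).
have xCc := Ccin_Cc G_hausdorff xC.
have hC : Cc h by apply: convolution_Cc => //; exact: fun_star_Cc.
have hfC : Cc (fun c => h c * f c) by apply: CcMl => //; exact: Cc_continuous.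
have [K cK xK] := Cc_support G_hausdorff xCc.
have cKi : compact (@ginv G @` K) by apply: compact_image => //; exact: ginv_continuous.
have [n n0 hn] := rep_compact_bound R G_etale G_hausdorff G_lc (compact_gmul G_hausdorff cK cKi).
apply: (iota_le A_full) => // [|H pi v pi_rep]; first exact: rnorm_ge0.
set M := rnorm (iota f).
have M0 : 0 <= M by exact: rnorm_ge0.
have fM (L : hilbertType R) (la : (G -> C) -> {linear L -> L}) z :
    star_representation la -> rnorm (la f z) <= M * rnorm z.
  by move=> la_rep; exact: (rep_le_iota A_full).
have key w : rnorm (hdot (pi (fun c => h c * f c) v) w) <= M * ((rnorm v ^+ 2 + rnorm w ^+ 2) / 2).
  apply/ler_addgt0Pl => e e0.
  have D0 : 0 < n * rnorm v * rnorm w + 1 by rewrite ltr_wpDl// !mulr_ge0// rnorm_ge0.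
  pose d := e / (n * rnorm v * rnorm w + 1); have d0 : 0 < d by exact: divr_gt0.
  have [s [J [B [X [XB XXab XX Xxi Xf]]]]] :=
    overlap_decomposition G_etale G_hausdorff G_lc xC x0 (Cc_continuous fC) d0.
  pose piece t j k : G -> C := convolution (toC (X t j)) (fun_star (toC (X t k))).
  pose mn : G -> C := \sum_(t <- s | t \in s) \sum_(j <- J t | j \in J t) \sum_(k <- J t | k \in J t)
    f (gmul j (ginv k)) *: piece t j k.
  have XC t k : t \in s -> k \in J t -> Cc (toC (X t k)).
    by move=> ts kJ; have [_ _ hh _] := XB _ _ ts kJ; exact: Ccin_Cc hh.
  have mnC : Cc mn.
    apply: Cc_sum => // t ts; apply: Cc_sum => // j jJ; apply: Cc_sum => // k kJ.
    apply: CcZ => //; apply: convolution_Cc => //; first exact: XC.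
    by apply: fun_star_Cc => //; exact: XC.
  have errC : Cc ((fun c => h c * f c) - mn) by exact: CcB.
  have X0 t k b : t \in s -> k \in J t -> 0 <= X t k b.
    by move=> ts kJ; have [_ _ _ hh] := XB _ _ ts kJ; exact: hh.
  have err_formula c : exists S : {fset G}, [/\
      forall b, b \in S -> grange b = gsource c,
      \sum_(t <- s | t \in s) \sum_(j <- J t | j \in J t) \sum_(k <- J t | k \in J t)
        \sum_(b <- S) X t j (gmul c b) * X t k b = \sum_(b <- S) xi (gmul c b) * xi b,
      h c = (\sum_(b <- S) xi (gmul c b) * xi b)%:C%C &
      ((fun c => h c * f c) - mn) c =
      \sum_(t <- s | t \in s) \sum_(j <- J t | j \in J t) \sum_(k <- J t | k \in J t)
        (\sum_(b <- S) X t j (gmul c b) * X t k b)%:C%C * (f c - f (gmul j (ginv k)))].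
    have [S [Sc Ss hS]] := overlap_fset G_etale G_hausdorff G_lc c xC.
    have EQ : \sum_(t <- s | t \in s) \sum_(j <- J t | j \in J t) \sum_(k <- J t | k \in J t)
        \sum_(b <- S) X t j (gmul c b) * X t k b = \sum_(b <- S) xi (gmul c b) * xi b.
      rewrite [RHS](eq_big_seq (fun b => \sum_(t <- s) \sum_(j <- J t) \sum_(k <- J t)
          X t j (gmul c b) * X t k b)); last first.
        by move=> b bS; rewrite XXab// gsourceM// (Sc _ bS).
      rewrite [RHS]exchange_big/= [RHS]big_seq; apply: eq_bigr => t ts.
      rewrite [RHS]exchange_big/= [RHS]big_seq; apply: eq_bigr => j jJ.
      by rewrite [RHS]exchange_big/= [RHS]big_seq.
    exists S; split => //.
    have -> : ((fun c => h c * f c) - mn) c = h c * f c - mn c by [].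
    rewrite {1}/h hS -EQ /mn fct_sumE !rmorph_sum mulr_suml -sumrB; apply: eq_bigr => t ts.
    rewrite fct_sumE rmorph_sum mulr_suml -sumrB; apply: eq_bigr => j jJ.
    rewrite fct_sumE rmorph_sum mulr_suml -sumrB; apply: eq_bigr => k kJ.
    have -> : (f (gmul j (ginv k)) *: piece t j k) c = f (gmul j (ginv k)) * piece t j k c by [].
    rewrite /piece (overlap_sum (S := S))//; last first.
      by move=> b bc Xb; apply: Ss => //; rewrite (Xxi _ _ _ Xb) orbT.
    by rewrite mulrBr [X in _ - X]mulrC.
  have err_le c : rnorm (((fun c => h c * f c) - mn) c) <= d.
    have [S [Sc EQ hS ->]] := err_formula c.
    have [r Er /andP[r0 r1]] := overlap_le1 G_etale G_hausdorff G_lc c xC x0 x1.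
    have rS : \sum_(b <- S) xi (gmul c b) * xi b <= 1.
      by rewrite -/h hS in Er; move: Er => /complexI ->.
    apply: (@le_trans _ _ (d * \sum_(b <- S) xi (gmul c b) * xi b)); last first.
      by rewrite -[leRHS]mulr1 ler_wpM2l// ltW.
    rewrite -EQ mulr_sumr (le_trans (rnorm_sum _ _ _))//; apply: ler_sum => t ts.
    rewrite mulr_sumr (le_trans (rnorm_sum _ _ _))//; apply: ler_sum => j jJ.
    rewrite mulr_sumr (le_trans (rnorm_sum _ _ _))//; apply: ler_sum => k kJ.
    set Q := \sum_(b <- S) _.
    have Q0 : 0 <= Q by rewrite /Q sumr_ge0// => b _; rewrite mulr_ge0 ?X0.
    rewrite rnormM rnormC ger0_norm// mulrC.
    have [[b [bS Xcb Xb]]|nex] := pselect (exists b, [/\ b \in S, X t j (gmul c b) != 0 & X t k b != 0]).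
      rewrite ler_wpM2r//.
      have sb : gsource c = grange b by rewrite (Sc _ bS).
      have := Xf t j k (gmul c b) b ts jJ kJ (gsourceM sb) Xcb Xb.
      by rewrite gmulgK.
    have -> : Q = 0; last by rewrite !mulr0.
    rewrite /Q big_seq big1// => b bS.
    have [->|Xcb] := eqVneq (X t j (gmul c b)) 0; first by rewrite mul0r.
    have [->|Xb] := eqVneq (X t k b) 0; first by rewrite mulr0.
    by exfalso; apply: nex; exists b.
  have err_supp c : ((fun c => h c * f c) - mn) c != 0 ->
      [set gmul p.1 p.2 | p in (K `*` (@ginv G @` K)) `&` @gcomposable G] c.
    have [S [Sc EQ hS ->]] := err_formula c.
    move=> nz; apply: contrapT => nc; move/eqP: nz; apply.
    rewrite big1// => t ts; rewrite big1// => j jJ; rewrite big1// => k kJ.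
    rewrite big_seq big1 ?mul0r// => b bS.
    have [->|Xcb] := eqVneq (X t j (gmul c b)) 0; first by rewrite mul0r.
    have [->|Xb] := eqVneq (X t k b) 0; first by rewrite mulr0.
    exfalso; apply: nc; have sb : gsource c = grange b by rewrite (Sc _ bS).
    have toK a : xi a != 0 -> K a by move=> xa; apply: xK; apply: contra_neq xa => /complexI.
    exists (gmul c b, ginv b) => /=; last by rewrite gmulgK.
    split; last by rewrite /gcomposable/= grange_inv gsourceM.
    by split => /=; [apply: toK; exact: Xxi Xcb|exists b => //; apply: toK; exact: Xxi Xb].
  have Esplit : pi (fun c => h c * f c) v = pi ((fun c => h c * f c) - mn) v + pi mn v.
    by rewrite (repB pi_rep)// subrK.
  have b1 := hn _ d (ltW d0) errC err_supp err_le H pi v pi_rep.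
  have b2 := main_term_bound pi_rep fC M0 fM xC x1 XB XX Xxi v w.
  rewrite Esplit hdotDl (le_trans (rnormD _ _))// lerD//.
  rewrite (le_trans (cauchy_schwarz _ _))//.
  have b3 : rnorm (pi ((fun c => h c * f c) - mn) v) * rnorm w <= n * d * rnorm v * rnorm w.
    by rewrite ler_wpM2r ?rnorm_ge0.
  have b4 : d * (n * rnorm v * rnorm w + 1) = e by rewrite divfK ?gt_eqF.
  apply: le_trans b3 _; lra.
set z := pi _ v in key *.
have [z0|z0] := eqVneq (rnorm z) 0; first by rewrite z0 mulr_ge0// rnorm_ge0.
have zp : 0 < rnorm z by rewrite lt_neqAle eq_sym z0 rnorm_ge0.
(* the multiple of [z] with the norm of [v] turns the mean of squares into a product *)
have := key ((rnorm v / rnorm z)%:C%C *: z).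
rewrite hdotZr conjC_realc hdotE -rmorphM/= rnormC rnormZ rnormC.
rewrite !ger0_norm ?mulr_ge0 ?sqr_ge0 ?invr_ge0 ?rnorm_ge0//.
have -> : rnorm v / rnorm z * rnorm z ^+ 2 = rnorm v * rnorm z by rewrite expr2 mulrA divfK.
rewrite divfK// => h1.
have [v0|v0] := eqVneq (rnorm v) 0.
  have hv : v = 0 by exact: rnorm_eq0.
  by move: z0; rewrite /z hv linear0 rnorm0 eqxx.
have vp : 0 < rnorm v by rewrite lt_neqAle eq_sym v0 rnorm_ge0.
rewrite -(ler_pM2l vp); rewrite expr2 in h1; lra.
Qed.

End multiplier.

(** * Effectiveness and minimality imply simplicity *)

Section simplicity.
Variables (R : realType) (G : topologicalGroupoidType).
Hypothesis G_etale : etale G.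
Hypothesis G_hausdorff : hausdorff_space G.
Hypothesis G_lc : locally_compact [set: G].
Variables (A : cstarAlgType R) (iota : (G -> R[i]) -> A).
Hypothesis A_full : is_full_cstar_algebra iota.
Local Notation C := R[i].
Local Notation toC p := (fun x => (p x)%:C%C : C).
Implicit Types (f g k : G -> C) (U V : set G).

(** With [h] close to [1] on the support of one approximant [f], the products [h g] with
    the other approximants [g] have supports in one compact set, so that their norms
    tend to [0] with the supremum norm of [g]; and multiplication by [h] is a
    contraction. *)
Lemma faithful_on_functions (a : A) : amenable R G ->
  (forall e : R, 0 < e -> exists f, [/\ Cc f, rnorm (a - iota f) < e &
     forall c, rnorm (f c) <= e]) -> a = 0.
Proof.
move=> am ha; apply: rnorm_eq0; apply/eqP; rewrite eq_le rnorm_ge0 andbT.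
apply/ler_addgt0Pl => e e0; rewrite addr0.
have e5 : 0 < e / 6 by rewrite divr_gt0.
have [f [fC af _]] := ha _ e5.
have [K cK fK] := Cc_support G_hausdorff fC.
have [n n0 hn] := iota_compact_le G_etale G_hausdorff G_lc A_full cK.
have [M M0 fM] := Cc_bounded G_hausdorff fC.
have D0 : 0 < n * M + 1 by rewrite ltr_wpDl// mulr_ge0.
have [xi [xC x0 x1 hK]] := amenable_overlap G_etale G_hausdorff G_lc am cK (divr_gt0 e5 D0).
have xCc := Ccin_Cc G_hausdorff xC.
set h := convolution _ _ in hK.
have hC : Cc h by apply: convolution_Cc => //; exact: fun_star_Cc.
have hgC g : Cc g -> Cc (fun c => h c * g c) by move=> gC; apply: CcMl => //; exact: Cc_continuous.
have [K' cK' hK'] := Cc_support G_hausdorff hC.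
have [n' n'0 hn'] := iota_compact_le G_etale G_hausdorff G_lc A_full cK'.
have D'0 : 0 < n' + 1 by rewrite ltr_wpDl.
have d0 : 0 < Num.min (e / 6) (e / 6 / (n' + 1)) by rewrite lt_min e5 divr_gt0.
have [g [gC ag gsmall]] := ha _ d0.
have ag' : rnorm (a - iota g) < e / 6 by apply: lt_le_trans ag _; rewrite ge_min lexx.
(* the four distances along a, iota f, iota (h f), iota (h g), 0 *)
have b1 : rnorm (iota f - iota (fun c => h c * f c)) <= e / 6.
  rewrite -(iotaB A_full)//; last exact: hgC.
  have q0 : 0 <= e / 6 / (n * M + 1) * M by rewrite mulr_ge0// divr_ge0// ltW.
  apply: (@le_trans _ _ (n * (e / 6 / (n * M + 1) * M))).
    apply: hn => //; first by apply: CcB => //; exact: hgC.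
      move=> c; have -> : (f - (fun c => h c * f c)) c = f c - h c * f c by [].
      by move=> nz; apply: fK; apply: contra_neq nz => ->; rewrite mulr0 subrr.
    move=> c; have -> : (f - (fun c => h c * f c)) c = (1 - h c) * f c by rewrite mulrBl mul1r.
    rewrite rnormM; have [->|/fK Kc] := eqVneq (f c) 0; first by rewrite rnorm0 mulr0.
    apply: ler_pM; rewrite ?rnorm_ge0//; exact: hK.
  have -> : n * (e / 6 / (n * M + 1) * M) = e / 6 / (n * M + 1) * (n * M) by ring.
  have : e / 6 / (n * M + 1) * (n * M + 1) = e / 6 by rewrite divfK ?gt_eqF.
  have : 0 <= e / 6 / (n * M + 1) by rewrite divr_ge0// ltW.
  lra.
have b2 : rnorm (iota (fun c => h c * f c) - iota (fun c => h c * g c)) <= e / 6 + e / 6.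
  rewrite -(iotaB A_full); [|exact: hgC|exact: hgC].
  have -> : (fun c => h c * f c) - (fun c => h c * g c) = (fun c => h c * (f - g) c).
    by apply/funext => c; rewrite mulrBr.
  rewrite (le_trans (multiplier_le G_etale G_hausdorff G_lc A_full xC x0 x1 (CcB G_hausdorff fC gC)))//.
  rewrite (iotaB A_full)// (le_trans (rnorm_triangle _ a _))// lerD// ?(ltW ag')//.
  by rewrite rnormBC ltW.
have b3 : rnorm (iota (fun c => h c * g c)) <= e / 6.
  have q0 : 0 <= e / 6 / (n' + 1) by rewrite divr_ge0// ltW.
  apply: (@le_trans _ _ (n' * (e / 6 / (n' + 1)))).
    apply: hn' => //; first exact: hgC.
      by move=> c nz; apply: hK'; apply: contra_neq nz => ->; rewrite mul0r.
    move=> c; have [r Er /andP[r0 r1]] := overlap_le1 G_etale G_hausdorff G_lc c xC x0 x1.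
    rewrite rnormM /h Er rnormC ger0_norm// -[leRHS]mul1r ler_pM ?rnorm_ge0//.
    by apply: le_trans (gsmall c) _; rewrite ge_min lexx orbT.
  have : e / 6 / (n' + 1) * (n' + 1) = e / 6 by rewrite divfK ?gt_eqF.
  lra.
have t1 := rnorm_sub_le a (iota f).
have t2 := rnorm_sub_le (iota f) (iota (fun c => h c * f c)).
have t3 := rnorm_sub_le (iota (fun c => h c * f c)) (iota (fun c => h c * g c)).
lra.
Qed.

(** A bisection that meets no unit contains a point with different range and source,
    by effectiveness; small neighbourhoods of such a point move their ranges off
    their sources. One bisection is treated at a time, shrinking the open set. *)
Lemma effective_shrink (s : seq G) (B : G -> set G) V : effective G ->
  (forall i, i \in s -> bisection (B i) /\ forall z, B i z -> ~ gunits z) ->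
  open V -> V !=set0 -> V `<=` @gunits G ->
  exists V', [/\ open V', V' !=set0, V' `<=` V &
    forall i c, i \in s -> B i c -> V' (grange c) -> ~ V' (gsource c)].
Proof.
move=> eff; elim: s V => [V _ oV nV Vu|i s ih V hs oV nV Vu].
  by exists V; split.
have [|V1 [oV1 nV1 V1V h1]] := ih V _ oV nV Vu.
  by move=> j js; apply: hs; rewrite inE js orbT.
have [bB Bu] := hs i (mem_head _ _).
have [[c [Bc Vr Vs]]|nex] := pselect (exists c, [/\ B i c, V1 (grange c) & V1 (gsource c)]); last first.
  exists V1; split => // j c; rewrite inE => /predU1P[->|js] Bc Vr Vs.
    by apply: nex; exists c.
  exact: (h1 j c js Bc Vr Vs).
pose O := B i `&` (@grange G @^-1` V1 `&` @gsource G @^-1` V1).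
have oO : open O.
  apply: openI; first exact: bisection_open bB.
  by apply: openI; apply: open_preimage => //; [exact: grange_continuous|exact: gsource_continuous].
have [d [Od dne]] : exists d, O d /\ grange d <> gsource d.
  apply: contrapT => nd; apply: (Bu c Bc).
  have : interior [set a : G | grange a = gsource a] c.
    have : nbhs c O by apply: open_nbhs_nbhs; split.
    apply: filterS => d Od; apply: contrapT => dne; by apply: nd; exists d.
  by rewrite (_ : interior _ = @gunits G).
have [P [Q [oP oQ Pd Qd PQ]]] := hausdorff_separate G_hausdorff dne.
pose O' := O `&` (@grange G @^-1` P `&` @gsource G @^-1` Q).
have oO' : open O'.
  apply: openI => //.
  by apply: openI; apply: open_preimage => //; [exact: grange_continuous|exact: gsource_continuous].
exists (@grange G @` O'); split.
- exact: grange_open.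
- by exists (grange d), d.
- by move=> _ [z [[_ [Vz _]] _] <-]; exact: V1V.
- move=> j z; rewrite inE => /predU1P[->|js] Bz.
    move=> [y [[By [_ _]] [_ Qy]] yz] [w [_ [Pw _]] wz].
    have e : y = z by exact: (bisection_rinj bB).
    by apply: (PQ (grange w)) => //; rewrite wz -e.
  move=> [y [[_ [Vy _]] _] yz] [w [[_ [Vw _]] _] wz].
  by apply: (h1 j z js Bz); [rewrite -yz|rewrite -wz].
Qed.

(** Off the units the support of [f] is compact, hence covered by finitely many
    bisections without units. None of them joins two points of the open set given by
    [effective_shrink], so that compressing by a bump [k] on it removes [f] there. *)
Lemma effective_corner f (x : G) V : effective G -> Cc f -> open V -> V x -> V `<=` @gunits G ->
  exists k y, [/\ Ccin (@gunits G) k, V y, k y = 1, forall c, rnorm (k c) <= 1 &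
    forall c, ~ gunits c -> k (grange c) * f c * k (gsource c) = 0].
Proof.
move=> eff fC oV Vx Vu; have [K cK fK] := Cc_support G_hausdorff fC.
have cKu : compact (K `&` ~` (@gunits G)).
  by apply: compact_closedI => //; apply: open_closedC; exact: gunits_open.
have /choice[B hB] : forall i, exists B, (K `&` ~` (@gunits G)) i ->
    [/\ bisection B, B i & B `<=` ~` (@gunits G)].
  move=> i; have [[Ki nu]|nK] := pselect ((K `&` ~` (@gunits G)) i); last by exists set0.
  have oN : open (~` (@gunits G)) by apply: closed_openC; exact: gunits_closed.
  by have [B [bB Bi BN]] := exists_bisection G_etale oN nu; exists B.
have [i Ki|s [sK hs]] := compact_finite_cover (f := B) cKu.
  by have [bB Bi _] := hB i Ki; apply: open_nbhs_nbhs; split => //; exact: bisection_open bB.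
have [||V' [oV' [y Vy] V'V hV']] := @effective_shrink s B V eff _ oV _ Vu.
- by move=> i /sK/hB[bB _ BN]; split => // z /BN.
- by exists x.
have [k [kV ky k1 _]] := exists_Ccin R G_hausdorff G_lc oV' Vy.
exists k, y; split => //; first by apply: CcinS kV; exact: subset_trans Vu.
  exact: V'V.
move=> c nu; have [->|/fK Kc] := eqVneq (f c) 0; first by rewrite mulr0 mul0r.
have [i iS Bc] := hs c (conj Kc nu).
have [Vr|nVr] := pselect (V' (grange c)); last by rewrite (Ccin_out kV nVr) !mul0r.
by rewrite (Ccin_out kV (hV' i c iS Bc Vr)) mulr0.
Qed.

Section one_ideal.
Variable J : set A.
Hypothesis J_ideal : closed_ideal J.

Lemma idealD (a b : A) : J a -> J b -> J (a + b).
Proof. by case: J_ideal => _ _ h _ _ Ja Jb; rewrite -[a]scale1r; exact: h. Qed.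

Lemma ideal_approx (a : A) : (forall e : R, 0 < e -> exists2 b, J b & rnorm (a - b) < e) -> J a.
Proof.
case: J_ideal => clJ _ _ _ _ h; apply: clJ => N /nbhs_rnormP[e e0 hN].
by have [b Jb ab] := h e e0; exists b; split => //; exact: hN.
Qed.

(** If [p = p q] and [q] is within [1/2] of [d] in the ideal, then, modulo the
    ideal, [p = p (q - d) = p (q - d)^2 = ...], which tends to [0]. *)
Lemma ideal_absorb (p q d : A) : J d -> cmul p q = p -> rnorm (q - d) <= 2^-1 -> J p.
Proof.
move=> Jd pq qd; case: (J_ideal) => _ J0 _ Jl Jr.
pose x n := iter n (fun y => cmul y (q - d)) p.
have Jx n : J (p - x n).
  elim: n => [|n ih]; first by rewrite subrr.
  have -> : p - x n.+1 = cmul p d + cmul (p - x n) (q - d).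
    rewrite cmulBl /= addrA; congr (_ - _).
    by rewrite cmulBr pq addrC subrK.
  by apply: idealD; [exact: Jl|exact: Jr].
have xn n : rnorm (x n) * n.+1%:R <= rnorm p.
  have pow : rnorm (x n) <= rnorm p * 2^-1 ^+ n.
    elim: n => [|n ih]; first by rewrite expr0 mulr1.
    rewrite (le_trans (rnorm_cmul _ _))// exprSr mulrA.
    by apply: ler_pM; rewrite ?rnorm_ge0.
  rewrite (le_trans (ler_wpM2r (ler0n _ _) pow))// -mulrA -[leRHS]mulr1 ler_wpM2l ?rnorm_ge0//.
  rewrite exprVn mulrC ler_pdivrMr ?exprn_gt0// mul1r -natrX ler_nat.
  exact: ltn_expl.
apply: ideal_approx => e e0; pose n := Num.bound (rnorm p / e).
exists (p - x n) => //; rewrite opprB addrC subrK.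
have hn : rnorm p / e < n%:R by rewrite archi_boundP// divr_ge0 ?rnorm_ge0// ltW.
have n1 : 0 < n.+1%:R :> R by rewrite ltr0n.
rewrite -(ltr_pM2r n1); apply: (le_lt_trans (xn n)).
move: hn; rewrite ltr_pdivrMr// => hn; rewrite (lt_trans hn)// mulrC ltr_pM2l// ltr_nat//.
Qed.

Lemma unit_algebra_function (p q : G -> C) :
  Ccin (@gunits G) p -> convolution p q = (fun c => p (grange c) * q c).
Proof.
move=> pC; apply/funext => c; apply: convolution_unitl => // a nu; exact: (Ccin_out pC).
Qed.

(** If [c] approximates [phi] and [psi phi = q], then [psi c] in [J] approximates [q],
    which is [1] where [|phi|] is at least [e / 2]; so [q] is a local unit for [p],
    supported where [|phi|] exceeds [e / 2], and [ideal_absorb] applies. *)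
Lemma ideal_unit_function (phi : G -> C) (y : G) (c : A) (e : R) : 0 < e ->
  Ccin (@gunits G) phi -> e < rnorm (phi y) -> J c -> rnorm (c - iota phi) <= e / 4 ->
  exists2 p : G -> C, Ccin (@gunits G) p /\ J (iota p) & p y != 0.
Proof.
move=> e0 pC ey Jc cphi; case: (J_ideal) => _ _ _ Jl _.
have pc := Ccin_continuous pC; have pCc := Ccin_Cc G_hausdorff pC.
pose n x := rnorm (phi x); pose D x := Num.max (n x ^+ 2) ((e / 2) ^+ 2).
have n0 x : 0 <= n x by exact: rnorm_ge0.
have e2 : 0 < e / 2 by exact: divr_gt0.
have D0 x : 0 < D x by rewrite /D lt_max; apply/orP; right; exact: exprn_gt0.
have nc : continuous n.
  by move=> x; apply: (continuous_at_comp (pc x)); exact: continuous_rnorm.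
have n2c : continuous (fun x => n x ^+ 2).
  by move=> x; apply: (@continuousM R G n n); exact: nc.
have Dc : continuous D.
  by move=> x; apply: (@continuous_max R G (fun x => n x ^+ 2) (fun=> (e / 2) ^+ 2));
    [exact: n2c|exact: cst_continuous].
have Dic : continuous (fun x => (D x)^-1).
  by move=> x; apply: continuousV; [rewrite gt_eqF|exact: Dc].
pose psi x : C := (phi x)^* * (D x)^-1%:C%C.
have supp (f : G -> C) : continuous f -> (forall x, f x != 0 -> phi x != 0) -> Ccin (@gunits G) f.
  by move=> fc hf; split => //; exact: supported_in_sub pC.2.
have psiC : Ccin (@gunits G) psi.
  apply: supp; first by apply: continuousMC; [exact: continuous_conj|exact: realC_continuous].
  by move=> x; apply: contra_neq => px; rewrite /psi px rmorph0 mul0r.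
pose q x : R := n x ^+ 2 / D x.
have qC : Ccin (@gunits G) (toC q).
  apply: supp.
    apply: realC_continuous => x; apply: (@continuousM R G (fun x => n x ^+ 2) (fun x => (D x)^-1)).
      exact: n2c.
    exact: Dic.
  by move=> x; apply: contra_neq => px; rewrite /q /n px rnorm0 expr0n mul0r.
pose p x : R := Num.max 0 (n x - e / 2).
have pC' : Ccin (@gunits G) (toC p).
  apply: supp.
    apply: realC_continuous => x; apply: (@continuous_max R G (fun=> 0) (fun x => n x - e / 2)).
      exact: cst_continuous.
    by apply: (@continuousB R R^o G n (fun=> e / 2)); [exact: nc|exact: cst_continuous].
  move=> x; apply: contra_neq => px; rewrite /p /n px rnorm0 max_l//; lra.
have u1 f : Ccin (@gunits G) f -> forall x, ~ gunits x -> f x = 0.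
  by move=> fC x nu; exact: (Ccin_out fC).
have psiphi : convolution psi phi = toC q.
  apply/funext => x; rewrite unit_algebra_function//.
  have [ux|nu] := pselect (gunits x); last by rewrite (u1 _ pC)// mulr0 (u1 _ qC).
  rewrite gunits_grange// /psi /q rmorphM/= rnorm_sqr; ring.
have pq : convolution (toC p) (toC q) = toC p.
  apply/funext => x; rewrite unit_algebra_function//.
  have [ux|nu] := pselect (gunits x); last by rewrite (u1 _ qC)// mulr0 (u1 _ pC').
  rewrite gunits_grange// -rmorphM/=; congr (_%:C)%C.
  rewrite /p; case: (leP (n x - e / 2) 0) => [h|h]; first by rewrite mul0r.
  rewrite /q /D max_l ?divff ?mulr1//.
    by rewrite expf_neq0// gt_eqF// (lt_trans e2)// -subr_gt0.
  have e2n : e / 2 <= n x by rewrite -subr_ge0 ltW.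
  by rewrite ler_pXn2r// nnegrE; first exact: ltW.
have Cc1 := Ccin_Cc G_hausdorff psiC; have Cc2 := Ccin_Cc G_hausdorff pC'.
have Cc3 := Ccin_Cc G_hausdorff qC.
exists (toC p); last first.
  by rewrite gt_eqF// ltcR /p lt_max subr_gt0 (lt_trans _ ey) ?orbT//; lra.
split => //; apply: (@ideal_absorb _ (iota (toC q)) (cmul (iota psi) c)).
- exact: Jl.
- by rewrite -(iotaM A_full)// pq.
rewrite -psiphi (iotaM A_full)// -cmulBr (le_trans (rnorm_cmul _ _))// rnormBC.
have psi_le : rnorm (iota psi) <= (e / 2)^-1.
  apply: (iota_bisection_le G_etale G_hausdorff G_lc A_full (bisection_units G_etale) psiC).
    by rewrite invr_ge0 ltW.
  move=> x; rewrite /psi rnormM rnorm_conj rnormC -/(n x) ger0_norm; last by rewrite invr_ge0 ltW.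
  rewrite ler_pdivrMr// mulrC ler_pdivlMr//.
  rewrite /D; have [h|h] := leP (e / 2) (n x).
    rewrite max_l; last by rewrite ler_pXn2r// nnegrE; first exact: ltW.
    by rewrite expr2 ler_wpM2l.
  by rewrite le_max; apply/orP; right; rewrite expr2 ler_wpM2r// ltW.
apply: (@le_trans _ _ ((e / 2)^-1 * (e / 4))).
  by apply: ler_pM; rewrite ?rnorm_ge0.
have -> : (e / 2)^-1 * (e / 4) = 2^-1; last exact: lexx.
by field; rewrite gt_eqF.
Qed.

(** By [faithful_on_functions] approximants of a nonzero element of [J] cannot be
    uniformly small. A bump on a bisection moves a point where one is large to a unit,
    and [effective_corner] compresses the result to a function on the units. *)
Lemma ideal_meets_units : amenable R G -> effective G -> J <> [set 0] ->
  exists p y, [/\ Ccin (@gunits G) p, J (iota p), gunits y & p y != 0].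
Proof.
move=> am eff Jn0; case: (J_ideal) => _ J0 _ Jl Jr.
have [a [Ja a0]] : exists a, J a /\ a <> 0.
  apply: contrapT => na; apply: Jn0; apply/seteqP; split=> [a Ja|_ ->//] /=.
  by apply: contrapT => a0; apply: na; exists a.
have [e e0 ha] : exists2 e : R, 0 < e & forall f, Cc f -> rnorm (a - iota f) < e -> exists c, e < rnorm (f c).
  apply: contrapT => ne; apply: a0; apply: faithful_on_functions => // e e0.
  apply: contrapT => nf; apply: ne; exists e => // f fC af.
  apply: contrapT => nc; apply: nf; exists f; split => // c.
  by rewrite leNgt; apply/negP => h; apply: nc; exists c.
have [f fC af] := iota_dense A_full a (divr_gt0 e0 (ltr0Sn _ 3)).
have [|g0 eg] := ha f fC; first by apply: (lt_le_trans af); lra.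
have [U [bU Ug _]] := exists_bisection G_etale openT (I : setT g0).
have [g [gU gg g1 _]] := exists_Ccin R G_hausdorff G_lc (bisection_open bU) Ug.
have sU := fun_star_Ccin gU; have sC := Ccin_Cc G_hausdorff sU.
have bV := bisection_inv bU.
have s0 b : ~ (@ginv G @^-1` U) b -> fun_star g b = 0 by move=> nb; exact: (Ccin_out sU nb).
pose f' := convolution (fun_star g) f.
have f'C : Cc f' by exact: convolution_Cc.
pose b := cmul (iota (fun_star g)) a.
have sg1 : rnorm (iota (fun_star g)) <= 1.
  apply: (iota_bisection_le G_etale G_hausdorff G_lc A_full bV sU) => // c.
  by rewrite /fun_star rnorm_conj.
have bf' : rnorm (b - iota f') <= e / 4.
  rewrite /f' (iotaM A_full)// -cmulBr (le_trans (rnorm_cmul _ _))//.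
  by rewrite -[leRHS]mul1r ler_pM ?rnorm_ge0// ltW.
pose x := gsource g0.
have f'x : f' x = f g0.
  rewrite /f' convolutionE (fint_bisection _ bV s0 (a := ginv g0)).
  - by rewrite /fun_star ginvK gg rmorph1 scale1r gsourcer.
  - by rewrite /= ginvK.
  - by rewrite grange_inv grange_gsource.
pose V := @gunits G `&` [set y | e < rnorm (f' y)].
have oV : open V.
  apply: openI; first exact: gunits_open.
  have f'c := Cc_continuous f'C.
  have nc : continuous (fun y => rnorm (f' y)).
    by move=> y; apply: (continuous_at_comp (f'c y)); exact: continuous_rnorm.
  have o : open [set r : R | e < r] by exact: open_gt.
  exact: (open_preimage nc o).
have Vx : V x by split; [exact: gunits_source|rewrite /= f'x].
have [k [y [kU Vy ky k1 koff]]] := effective_corner eff f'C oV Vx (@subIsetl _ _ _).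
have kC := Ccin_Cc G_hausdorff kU; have [uy ey] := Vy.
pose phi := convolution (convolution k f') k.
have kfC : Cc (convolution k f') by exact: convolution_Cc.
have phiC : Cc phi by exact: convolution_Cc.
have k0 c : ~ gunits c -> k c = 0 by move=> nu; exact: (Ccin_out kU nu).
have phiE c : phi c = k (grange c) * f' c * k (gsource c).
  by rewrite /phi convolution_unitr// unit_algebra_function.
have phiU : Ccin (@gunits G) phi by apply: Ccin_units => // c nu; rewrite phiE koff.
have ik1 : rnorm (iota k) <= 1.
  exact: (iota_bisection_le G_etale G_hausdorff G_lc A_full (bisection_units G_etale) kU).
have [|||p [pU Jp] py] := @ideal_unit_function phi y (cmul (cmul (iota k) b) (iota k)) e e0 phiU.
- by rewrite phiE gunits_grange// gunits_gsource// ky mul1r mulr1.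
- by apply: Jr; apply: (Jl); exact: Jl.
- rewrite /phi (iotaM A_full kfC kC) (iotaM A_full kC f'C) -cmulBl -cmulBr (le_trans (rnorm_cmul _ _))//.
  rewrite -[leRHS]mulr1 ler_pM ?rnorm_ge0// (le_trans (rnorm_cmul _ _))//.
  by rewrite -[leRHS]mul1r ler_pM ?rnorm_ge0.
by exists p, y.
Qed.

(** Conjugating [p] by a bump on a bisection that joins a given unit to one where [p]
    does not vanish gives a function [k] in [J] that does not vanish at the given unit;
    a function supported where [k], read along the range map, does not vanish is a
    multiple of it. *)
Lemma ideal_full : minimal_groupoid G -> (exists p y, [/\ Ccin (@gunits G) p, J (iota p),
  gunits y & p y != 0]) -> J = setT.
Proof.
move=> mini [p [x [pU Jp ux px]]]; case: (J_ideal) => _ J0 _ Jl Jr.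
have pC := Ccin_Cc G_hausdorff pU; have pc := Ccin_continuous pU.
have p0 c : ~ gunits c -> p c = 0 by move=> nu; exact: (Ccin_out pU nu).
pose small (U : set G) := exists k : G -> C, [/\ Cc k, forall c, ~ gunits c -> k c = 0, J (iota k) &
  forall c, U c -> k (grange c) != 0].
have sb : small_basis small.
  move=> c0; pose y := grange c0; have uy : gunits y by exact: gunits_range.
  have nx : nbhs x (p @^-1` [set z | z != 0]).
    apply: (nbhs_preimage (pc x)); apply/nbhs_rnormP; exists (rnorm (p x)).
      by rewrite lt_neqAle rnorm_ge0 andbT eq_sym; apply: contra_neq px => /rnorm_eq0.
    by move=> z h; apply/eqP => z0; move: h; rewrite z0 subr0 ltxx.
  have [_ [[c /= cy <-] pr]] := mini y uy x ux _ nx.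
  have [U [bU Uc _]] := exists_bisection G_etale openT (I : setT c).
  have [g [gU gc _ _]] := exists_Ccin R G_hausdorff G_lc (bisection_open bU) Uc.
  have gC := Ccin_Cc G_hausdorff gU; have sU := fun_star_Ccin gU; have sC := Ccin_Cc G_hausdorff sU.
  have bV := bisection_inv bU.
  have s0 b : ~ (@ginv G @^-1` U) b -> fun_star g b = 0 by move=> nb; exact: (Ccin_out sU nb).
  have pgC : Cc (convolution p g) by exact: convolution_Cc.
  pose k := convolution (fun_star g) (convolution p g).
  have kC : Cc k by exact: convolution_Cc.
  have k0 b : ~ gunits b -> k b = 0.
    rewrite /k -[convolution p g]fun_starK; apply: (convolution_star_off bV s0) => d nd.
    by rewrite /fun_star unit_algebra_function// (Ccin_out gU nd) mulr0 rmorph0.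
  have ky : k y != 0.
    rewrite /k convolutionE (fint_bisection _ bV s0 (a := ginv c)).
    - rewrite /fun_star ginvK gc rmorph1 scale1r unit_algebra_function// -cy gsourcer gc mulr1//.
    - by rewrite /= ginvK.
    - by rewrite grange_inv gunits_grange.
  have kc := Cc_continuous kC.
  exists (@grange G @^-1` (k @^-1` [set z | z != 0])); split => //.
    apply: open_preimage; first exact: grange_continuous.
    apply: open_preimage => //; rewrite openE => z /eqP z0; apply/nbhs_rnormP; exists (rnorm z).
      by rewrite lt_neqAle rnorm_ge0 andbT eq_sym; apply/eqP => /rnorm_eq0.
    by move=> w h; apply/eqP => w0; move: h; rewrite w0 subr0 ltxx.
  exists k; split => //; rewrite /k !(iotaM A_full)//; apply: Jl; exact: Jr.
have Jall f : Cc f -> J (iota f).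
  move: f; apply: (Cc_ind G_hausdorff G_lc sb).
  - by rewrite (iota0 G_hausdorff A_full).
  - by move=> f g fC gC Jf Jg; rewrite (iota_add A_full)//; exact: idealD.
  move=> U f [k [kC k0 Jk kU]] fU; have fc := Ccin_continuous fU; have kc := Cc_continuous kC.
  pose F c := f c / k (grange c).
  have FC : Cc F.
    have [_ [K [cK KU fK]]] := fU; apply: (@Ccin_Cc _ _ G_hausdorff U); split; last first.
      by exists K; split => // c; rewrite /F => nF; apply: fK; apply: contra_neq nF => ->; rewrite mul0r.
    suff key (c : G) : {for c, continuous F} by move=> c; exact: key.
    have [Uc|nUc] := pselect (U c).
      apply: (@continuousM C G f (fun c => (k (grange c))^-1)); first exact: fc.
      apply: continuousV; first exact: kU.
      by apply: (continuous_at_comp (@grange_continuous G c)); exact: kc.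
    apply: (@continuous_near _ _ _ (fun=> 0)); last exact: cst_continuous.
    have := supported_in_near G_hausdorff fU.2 nUc.
    by apply: filterS => d fd; rewrite /F fd mul0r.
  have -> : f = convolution k F.
    apply/funext => c; rewrite convolution_unitl// /F.
    have [Uc|nUc] := pselect (U c); first by rewrite mulrC divfK// kU.
    by rewrite (Ccin_out fU nUc) mul0r mulr0.
  by rewrite (iotaM A_full)//; exact: Jr.
apply/seteqP; split => // a _; apply: ideal_approx => e e0.
by have [f fC af] := iota_dense A_full a e0; exists (iota f) => //; exact: Jall.
Qed.

End one_ideal.

Theorem effective_minimal_simple : amenable R G -> effective G -> minimal_groupoid G -> simple_cstar A.
Proof.
move=> am eff mini J J_ideal; have [J0|Jn0] := pselect (J = [set 0]); first by left.
by right; apply: ideal_full => //; exact: ideal_meets_units.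
Qed.

End simplicity.

Theorem theorem4p3p6 (R : realType) (G : topologicalGroupoidType)
    (G_second_countable : @second_countable G)
    (G_locally_compact : locally_compact [set: G])
    (G_hausdorff : hausdorff_space G)
    (G_etale : etale G)
    (G_amenable : amenable R G)
    (A : cstarAlgType R) (iota : (G -> R[i]) -> A)
    (A_full_cstar_algebra : is_full_cstar_algebra iota) :
  simple_cstar A <-> effective G /\ minimal_groupoid G.
Proof.
split=> [simple|[eff mini]].
  by split; [exact: (simple_effective _ _ _ A_full_cstar_algebra)
            |exact: (simple_minimal _ _ _ A_full_cstar_algebra)].
exact: (effective_minimal_simple _ _ _ A_full_cstar_algebra).
Qed.
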